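(* Let $\mathfrak{g}=\mathfrak{osp}_{m|n}$ ($n$ even) be simple and different from $\mathfrak{so}_3$, and let $f\in\mathfrak{g}_{\bar0}$ be nilpotent, encoded by a pair of partitions $(\alpha|\beta)$ as in the context, such that $\mathfrak{g}^\natural$ is a direct sum of a reductive Lie algebra and copies of $\mathfrak{osp}_{1|r}$. With the partition of the set of parts into $q_1,\dots,q_t$ described in the context, the representation $\mathbb{C}\otimes\mathrm{adj}$ of $\mathfrak{g}^\natural\oplus\mathfrak{s}$ appears in $\mathfrak{g}=\Lambda^2(\mathbb{C}^{m|n})$ with multiplicity $$\begin{aligned}\mathrm{mult}(\mathbb{C}\otimes\mathrm{adj})=\ &|\{q_i: q_i>1\}|\\ &+|\{(q_p,q_j): 1\le p<j\le r,\ q_p=q_j+2,\ \mu_p=\mu_j=1,\ q_p,q_j\text{ odd}\}|\\ &+|\{(q_p,q_j): r+1\le p<j\le s,\ q_p=q_j+2,\ \nu_p=\nu_j=1,\ q_p,q_j\text{ even}\}|.\end{aligned}$$ In particular, $\mathrm{mult}(\mathbb{C}\otimes\mathrm{adj})=1$ if and only if $f$ is encoded by one of the following pairs (with $q>1$): (1) $(q^l,1^r|0)$, $m=ql+r$, $n=0$, $l$ even if $q$ is even, $m>4$; (2) $(0|q^l,1^r)$, $n=ql+r$, $m=0$, $l$ even if $q$ is odd, $r$ even; (3) $(q^l|1^n)$, $m=ql$, $l$ even if $q$ is even; (4) $(q^l,1|1^n)$, $m=ql+1$, $l$ even if $q$ is even; (5) $(1^m|q^l)$, $n=ql$, $l$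 even if $q$ is odd; (6) $(1|q^l,1^r)$, $l$ even if $q$ is odd, $r$ even; (7) $(q,1^r|q^l)$, $q+r=m$, $ql=n$, $l$ even, $q$ odd; (8) $(q^l|q,1^r)$, $q,l$ even, $r$ even; (9) $(q^l,1^r|q)$, $ql+r=m$, $q=n$, $l$ even, $q$ even; (10) $(q,1|q^l,1^r)$, $q+1=m$, $ql+r=n$, $l$ even, $q$ odd, $r$ even; (11) $(q^l,1|q,1^r)$, $m=ql+1$, $n=q+r$, $q,l$ even, $r$ even; (12) $(q|q^l,1^r)$, $q=m$, $ql+r=n$, $l$ even, $q$ odd, $r$ even.
   Context: $\mathfrak{s}=\mathrm{span}(e,x,f)\subset\mathfrak{g}_{\bar0}$ is an $\mathfrak{sl}_2$-triple and $\mathfrak{g}^\natural$ is its centralizer in $\mathfrak{g}$. $\mathbb{C}$ is the trivial representation of $\mathfrak{g}^\natural$ and $\mathrm{adj}$ the adjoint representation of $\mathfrak{s}\cong\mathfrak{sl}_2$. $\mathfrak{osp}_{m|0}=\mathfrak{so}_m$ and $\mathfrak{osp}_{0|n}=\mathfrak{sp}_n$. Encoding: $\alpha=(m_1^{\mu_1},\dots,m_t^{\mu_t})\vdash m$, $\beta=(m_1^{\nu_1},\dots,m_t^{\nu_t})\vdash n$, with the $m_i$ distinct positive integers, $\mu_i,\nu_i\ge0$, $\mu_i+\nu_i>0$, such that as an $\mathfrak{s}$-module the even part of $\mathbb{C}^{m|n}$ is $\bigoplus_iV(m_i-1)^{\oplus\mu_i}$ and the odd part is $\bigoplus_iV(m_i-1)^{\oplus\nu_i}$,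 where $V(p)$ is the irreducible module of dimension $p+1$. The assumption on $\mathfrak{g}^\natural$ implies that for each $i$ either $0\le\mu_i\le1$ or $0\le\nu_i\le1$. Partition of the parts: the set $\{m_1,\dots,m_t\}$ is written as a disjoint union $\{q_1\ge\dots\ge q_r\}\sqcup\{q_{r+1}\ge\dots\ge q_s\}\sqcup\{q_{s+1}\ge\dots\ge q_u\}\sqcup\{q_{u+1}\ge\dots\ge q_t\}$, where (with $\mu_i,\nu_i$ now the multiplicities of $q_i$ in $\alpha,\beta$): $\nu_i=0$ for $1\le i\le r$; $\mu_i=0$ for $r+1\le i\le s$; $\mu_i=1,\nu_i>0$ for $s+1\le i\le u$; $\nu_i=1,\mu_i>0$ for $u+1\le i\le t$. (The index $r$ in this partition is unrelated to the multiplicity $r$ in the list (1)–(12).) *)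

(* Defs.v *)
From HB Require Import structures.
From mathcomp Require Import all_boot all_order all_algebra.
From mathcomp Require Export reals complex.

Set Implicit Arguments.
Unset Strict Implicit.
Unset Printing Implicit Defensive.

Import GRing.Theory.
Local Open Scope ring_scope.

(** * The Lie superalgebra gl(m|n)

    An element of gl(m|n) is a matrix in block form, the first [m] coordinates
    being even and the last [n] odd. All Lie superalgebras below are subspaces
    of some gl(m|n). *)

Definition even_part (F : fieldType) (m n : nat) (X : 'M[F]_(m + n)) :
  'M[F]_(m + n) := block_mx (ulsubmx X) 0 0 (drsubmx X).

Definition odd_part (F : fieldType) (m n : nat) (X : 'M[F]_(m + n)) :
  'M[F]_(m + n) := block_mx 0 (ursubmx X) (dlsubmx X) 0.

(* The bilinear extension of [X, Y] = XY - (-1)^(|X||Y|) YX: the correction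
   term turns the minus sign into a plus sign on pairs of odd elements. *)
Definition sbracket (F : fieldType) (m n : nat) (X Y : 'M[F]_(m + n)) :
  'M[F]_(m + n) :=
  X *m Y - Y *m X + (odd_part Y *m odd_part X) *+ 2.

Definition graded (F : fieldType) (m n : nat) (U : {vspace 'M[F]_(m + n)}) :
  Prop := forall X, X \in U -> even_part X \in U.

Definition purely_even (F : fieldType) (m n : nat)
  (U : {vspace 'M[F]_(m + n)}) : Prop := forall X, X \in U -> odd_part X = 0.

Lemma even_part_is_linear (F : fieldType) (m n : nat) :
  linear (@even_part F m n).
Proof.
move=> a X Y; rewrite /even_part /ulsubmx /drsubmx !linearP /=.
by rewrite scale_block_mx add_block_mx !scaler0 !addr0.
Qed.
HB.instance Definition _ (F : fieldType) (m n : nat) :=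
  GRing.isLinear.Build F _ _ _ (@even_part F m n) (@even_part_is_linear F m n).

Lemma odd_part_is_linear (F : fieldType) (m n : nat) :
  linear (@odd_part F m n).
Proof.
move=> a X Y; rewrite /odd_part /ursubmx /dlsubmx !linearP /=.
by rewrite scale_block_mx add_block_mx !scaler0 !addr0.
Qed.
HB.instance Definition _ (F : fieldType) (m n : nat) :=
  GRing.isLinear.Build F _ _ _ (@odd_part F m n) (@odd_part_is_linear F m n).

(** * osp(m|n) *)

(* Block diagonal with 2 x 2 blocks (0 1 // -1 0); nondegenerate for n even. *)
Definition symplectic_mx (F : fieldType) (n : nat) : 'M[F]_n :=
  \matrix_(i, j) (if ~~ odd i && (j == i.+1 :> nat) then 1
                  else if ~~ odd j && (i == j.+1 :> nat) then -1 else 0).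

Definition osp_form (F : fieldType) (m n : nat) : 'M[F]_(m + n) :=
  block_mx 1%:M 0 0 (symplectic_mx F n).

Definition parity_mx (F : fieldType) (m n : nat) : 'M[F]_(m + n) :=
  block_mx 1%:M 0 0 (- 1%:M).

(* With (u, v) = u^T B v, the condition (Xu, v) + (-1)^(|X||u|) (u, Xv) = 0 for
   all homogeneous u and all v reads X^T B + B X = 0 for even X and
   X^T B + P B X = 0 for odd X, where P = parity_mx. *)
Definition osp_defect (F : fieldType) (m n : nat) (X : 'M[F]_(m + n)) :
  'M[F]_(m + n) :=
  X^T *m osp_form F m n + osp_form F m n *m even_part X
    + parity_mx F m n *m osp_form F m n *m odd_part X.

Lemma osp_defect_is_linear (F : fieldType) (m n : nat) :
  linear (@osp_defect F m n).
Proof.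
move=> a X Y; rewrite /osp_defect !linearP /= mulmxDl -scalemxAl.
by rewrite !scalerDr [RHS]addrACA; congr (_ + _); rewrite addrACA.
Qed.
HB.instance Definition _ (F : fieldType) (m n : nat) :=
  GRing.isLinear.Build F _ _ _ (@osp_defect F m n)
    (@osp_defect_is_linear F m n).

Definition osp (F : fieldType) (m n : nat) : {vspace 'M[F]_(m + n)} :=
  lker (linfun (@osp_defect F m n)).

Lemma mem_osp (F : fieldType) (m n : nat) (X : 'M[F]_(m + n)) :
  (X \in osp F m n) = (osp_defect X == 0).
Proof. by rewrite memv_ker lfunE. Qed.

(** * Modules, ideals, centralizers, isomorphisms *)

(* [U] is a (graded) [K]-submodule of [L] for the adjoint action. *)
Definition submodule (F : fieldType) (m n : nat)
  (K L U : {vspace 'M[F]_(m + n)}) : Prop :=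
  [/\ (U <= L)%VS, graded U &
      forall X Y, X \in K -> Y \in U -> sbracket X Y \in U].

Definition ideal (F : fieldType) (m n : nat) (L I : {vspace 'M[F]_(m + n)}) :
  Prop := submodule L L I.

Definition simple_superalgebra (F : fieldType) (m n : nat)
  (L : {vspace 'M[F]_(m + n)}) : Prop :=
  (exists X Y, [/\ X \in L, Y \in L & sbracket X Y <> 0]) /\
  (forall I, ideal L I -> I = 0%VS \/ I = L).

Lemma sbracket_is_linear (F : fieldType) (m n : nat) (X : 'M[F]_(m + n)) :
  linear (sbracket X).
Proof.
move=> a Y Z; rewrite /sbracket !linearP /= !mulmxDl -!scalemxAl.
rewrite !mulr2n !scalerDr opprD -scalerN [X in _ + X = _]addrACA.
by rewrite [X in X + _]addrACA [RHS]addrACA.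
Qed.
HB.instance Definition _ (F : fieldType) (m n : nat) (X : 'M[F]_(m + n)) :=
  GRing.isLinear.Build F _ _ _ (sbracket X) (sbracket_is_linear X).

Definition sbracketr (F : fieldType) (m n : nat) (Y X : 'M[F]_(m + n)) :=
  sbracket X Y.

Lemma sbracketr_is_linear (F : fieldType) (m n : nat) (Y : 'M[F]_(m + n)) :
  linear (sbracketr Y).
Proof.
move=> a X Z; rewrite /sbracketr /sbracket !linearP /= mulmxDl -scalemxAl.
rewrite !mulr2n !scalerDr [X in _ + X = _]addrACA.
by rewrite [RHS]addrACA; congr (_ + _); rewrite addrACA.
Qed.
HB.instance Definition _ (F : fieldType) (m n : nat) (Y : 'M[F]_(m + n)) :=
  GRing.isLinear.Build F _ _ _ (sbracketr Y) (sbracketr_is_linear Y).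

Definition centralizer (F : fieldType) (m n : nat)
  (L S : {vspace 'M[F]_(m + n)}) : {vspace 'M[F]_(m + n)} :=
  (L :&: \bigcap_(Y <- vbasis S) lker (linfun (sbracketr Y)))%VS.

Lemma mem_centralizer (F : fieldType) (m n : nat)
  (L S : {vspace 'M[F]_(m + n)}) (X : 'M[F]_(m + n)) :
  reflect (X \in L /\ forall Y, Y \in S -> sbracket X Y = 0)
          (X \in centralizer L S).
Proof.
have in_cap (s : seq 'M[F]_(m + n)) :
    (X \in \bigcap_(Y <- s) lker (linfun (sbracketr Y)))%VS
    = all (fun Y => sbracket X Y == 0) s.
  elim: s => [|Y s IH]; first by rewrite big_nil memvf.
  by rewrite big_cons memv_cap IH /= memv_ker lfunE.
rewrite memv_cap in_cap.
apply: (iffP andP) => -[XL XS]; split=> //.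
  move=> Y /coord_vbasis ->; rewrite linear_sum big1 //= => i _.
  rewrite linearZ /=; have /allP/(_ (vbasis S)`_i) := XS.
  by rewrite mem_nth ?size_tuple // => /(_ isT)/eqP ->; rewrite scaler0.
by apply/allP=> Y /vbasis_mem/XS ->.
Qed.

Definition superalgebra_iso (F : fieldType) (m n m' n' : nat)
  (A : {vspace 'M[F]_(m + n)}) (B : {vspace 'M[F]_(m' + n')}) : Prop :=
  exists phi : 'Hom('M[F]_(m + n), 'M[F]_(m' + n')),
    [/\ (phi @: A = B)%VS, (A :&: lker phi = 0)%VS,
        forall X, X \in A -> phi (even_part X) = even_part (phi X) &
        forall X Y, X \in A -> Y \in A ->
          phi (sbracket X Y) = sbracket (phi X) (phi Y)].

(* The adjoint representation is completely reducible. *)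
Definition reductive (F : fieldType) (m n : nat)
  (A : {vspace 'M[F]_(m + n)}) : Prop :=
  purely_even A /\
  forall I, ideal A I ->
    exists J, [/\ ideal A J, directv (I + J) & (I + J = A)%VS].

(* The numbers [r i] may differ from one copy to another. *)
Definition reductive_plus_osp1 (F : fieldType) (m n : nat)
  (L : {vspace 'M[F]_(m + n)}) : Prop :=
  exists (A : {vspace 'M[F]_(m + n)}) (k : nat)
         (B : 'I_k -> {vspace 'M[F]_(m + n)}) (r : 'I_k -> nat),
    [/\ directv (A + \sum_i B i), (A + \sum_i B i = L)%VS,
        ideal L A /\ reductive A &
        forall i, [/\ ideal L (B i), ~~ odd (r i) &
                      superalgebra_iso (B i) (osp F 1 (r i))]].

(** * sl2-triples and multiplicity *)

(* Normalized by [x, e] = e, [x, f] = - f, [e, f] = x, so x is half the usual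
   h. The condition f != 0 makes the span of the triple a copy of sl2. *)
Definition sl2_triple (F : fieldType) (m n : nat)
  (L : {vspace 'M[F]_(m + n)}) (e x f : 'M[F]_(m + n)) : Prop :=
  [/\ (<<[:: e; x; f]>> <= L)%VS, purely_even <<[:: e; x; f]>>%VS,
      f != 0 &
      [/\ sbracket x e = e, sbracket x f = - f & sbracket e f = x]].

Definition nilpotent_mx (F : fieldType) (d : nat) (f : 'M[F]_d) : Prop :=
  exists k : nat, iter k (mulmx f) 1%:M = 0.

(* [U] is a submodule of the module [L] over N (+) S isomorphic to C (x) adj.
   The space of C (x) adj is [S], on which a + y (a in N, y in S) acts by
   z |-> [y, z]. *)
Definition triv_adj_submodule (F : fieldType) (m n : nat)
  (N S L U : {vspace 'M[F]_(m + n)}) : Prop :=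
  submodule (N + S) L U /\
  exists phi : 'End('M[F]_(m + n)),
    [/\ (phi @: S = U)%VS, (S :&: lker phi = 0)%VS &
        forall a y z, a \in N -> y \in S -> z \in S ->
          phi (sbracket y z) = sbracket (a + y) (phi z)].

(* C (x) adj appears exactly [k] times in [L]: splitting off [k] submodules
   isomorphic to it leaves a submodule containing no further one. *)
Definition triv_adj_multiplicity (F : fieldType) (m n : nat)
  (N S L : {vspace 'M[F]_(m + n)}) (k : nat) : Prop :=
  exists (W : 'I_k -> {vspace 'M[F]_(m + n)}) (W' : {vspace 'M[F]_(m + n)}),
    [/\ directv (W' + \sum_i W i), (W' + \sum_i W i = L)%VS,
        forall i, triv_adj_submodule N S L (W i),
        submodule (N + S) L W' &
        forall U, (U <= W')%VS -> ~ triv_adj_submodule N S L U].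

(** * The encoding of f by a pair of partitions *)

Definition is_partition (lam : seq nat) (d : nat) : Prop :=
  [/\ sorted geq lam, 0%N \notin lam & sumn lam = d].

Definition stable (F : fieldType) (d : nat) (gs : seq 'M[F]_d)
  (U : {vspace 'cV[F]_d}) : Prop :=
  forall g v, g \in gs -> v \in U -> g *m v \in U.

Definition irreducible (F : fieldType) (d : nat) (gs : seq 'M[F]_d)
  (U : {vspace 'cV[F]_d}) : Prop :=
  [/\ stable gs U, U <> 0%VS &
      forall U', stable gs U' -> (U' <= U)%VS -> U' = 0%VS \/ U' = U].

(* F^d is the direct sum, over the parts p of [lam], of irreducible submodules
   of dimension p; when [gs] spans sl2, such a summand is V(p - 1). *)
Definition module_type (F : fieldType) (d : nat) (gs : seq 'M[F]_d)
  (lam : seq nat) : Prop :=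
  exists U : 'I_(size lam) -> {vspace 'cV[F]_d},
    [/\ directv (\sum_i U i), (\sum_i U i = fullv)%VS &
        forall i, irreducible gs (U i) /\ \dim (U i) = nth 0%N lam i].

Definition encoded_by (F : fieldType) (m n : nat) (e x f : 'M[F]_(m + n))
  (alpha beta : seq nat) : Prop :=
  [/\ is_partition alpha m, is_partition beta n,
      module_type [:: ulsubmx e; ulsubmx x; ulsubmx f] alpha &
      module_type [:: drsubmx e; drsubmx x; drsubmx f] beta].

Definition mult_of (lam : seq nat) (q : nat) : nat := count_mem q lam.

(** * The partition of the set of parts and the multiplicity formula *)

(* [Q1] is q_1, ..., q_r; [Q2] is q_(r+1), ..., q_s; [Q3] is q_(s+1), ..., q_u;
   [Q4] is q_(u+1), ..., q_t. *)
Definition parts_partition (alpha beta Q1 Q2 Q3 Q4 : seq nat) : Prop :=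
  [/\ uniq (Q1 ++ Q2 ++ Q3 ++ Q4),
      Q1 ++ Q2 ++ Q3 ++ Q4 =i alpha ++ beta,
      [/\ sorted geq Q1, sorted geq Q2, sorted geq Q3 & sorted geq Q4] &
      [/\ forall q, q \in Q1 -> mult_of beta q = 0%N,
          forall q, q \in Q2 -> mult_of alpha q = 0%N,
          forall q, q \in Q3 ->
            mult_of alpha q = 1%N /\ (0 < mult_of beta q)%N &
          forall q, q \in Q4 ->
            mult_of beta q = 1%N /\ (0 < mult_of alpha q)%N]].

(* The number of pairs p < j of positions in [Q] such that q_p = q_j + 2, both
   have multiplicity 1 in [lam], and both satisfy [par]. *)
Definition step2_pairs (lam Q : seq nat) (par : pred nat) : nat :=
  #|[set pj : 'I_(size Q) * 'I_(size Q) |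
      let qp := nth 0%N Q pj.1 in let qj := nth 0%N Q pj.2 in
      [&& (pj.1 < pj.2)%N, qp == (qj + 2)%N, mult_of lam qp == 1%N,
          mult_of lam qj == 1%N, par qp & par qj]]|.

Definition mult_formula (alpha beta Q1 Q2 Q3 Q4 : seq nat) : nat :=
  (count (fun q => 1 < q) (Q1 ++ Q2 ++ Q3 ++ Q4)
   + step2_pairs alpha Q1 (fun q => odd q)
   + step2_pairs beta Q2 (fun q => ~~ odd q))%N.

(** * The pairs with multiplicity one *)

Definition pair1 (m n : nat) (alpha beta : seq nat) (q l r : nat) : Prop :=
  [/\ alpha = nseq l q ++ nseq r 1%N, beta = [::],
      m = (q * l + r)%N /\ n = 0%N, ~~ odd q -> ~~ odd l & (4 < m)%N].

Definition pair2 (m n : nat) (alpha beta : seq nat) (q l r : nat) : Prop :=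
  [/\ alpha = [::], beta = nseq l q ++ nseq r 1%N,
      n = (q * l + r)%N /\ m = 0%N, odd q -> ~~ odd l & ~~ odd r].

Definition pair3 (m n : nat) (alpha beta : seq nat) (q l : nat) : Prop :=
  [/\ alpha = nseq l q, beta = nseq n 1%N, m = (q * l)%N &
      ~~ odd q -> ~~ odd l].

Definition pair4 (m n : nat) (alpha beta : seq nat) (q l : nat) : Prop :=
  [/\ alpha = nseq l q ++ [:: 1%N], beta = nseq n 1%N, m = (q * l + 1)%N &
      ~~ odd q -> ~~ odd l].

Definition pair5 (m n : nat) (alpha beta : seq nat) (q l : nat) : Prop :=
  [/\ alpha = nseq m 1%N, beta = nseq l q, n = (q * l)%N &
      odd q -> ~~ odd l].

Definition pair6 (alpha beta : seq nat) (q l r : nat) : Prop :=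
  [/\ alpha = [:: 1%N], beta = nseq l q ++ nseq r 1%N, odd q -> ~~ odd l &
      ~~ odd r].

Definition pair7 (m n : nat) (alpha beta : seq nat) (q l r : nat) : Prop :=
  [/\ alpha = q :: nseq r 1%N, beta = nseq l q,
      (q + r)%N = m /\ (q * l)%N = n, ~~ odd l & odd q].

Definition pair8 (alpha beta : seq nat) (q l r : nat) : Prop :=
  [/\ alpha = nseq l q, beta = q :: nseq r 1%N, ~~ odd q, ~~ odd l &
      ~~ odd r].

Definition pair9 (m n : nat) (alpha beta : seq nat) (q l r : nat) : Prop :=
  [/\ alpha = nseq l q ++ nseq r 1%N, beta = [:: q],
      (q * l + r)%N = m /\ q = n, ~~ odd l & ~~ odd q].

Definition pair10 (m n : nat) (alpha beta : seq nat) (q l r : nat) : Prop :=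
  [/\ alpha = [:: q; 1%N], beta = nseq l q ++ nseq r 1%N,
      (q + 1)%N = m /\ (q * l + r)%N = n & [/\ ~~ odd l, odd q & ~~ odd r]].

Definition pair11 (m n : nat) (alpha beta : seq nat) (q l r : nat) : Prop :=
  [/\ alpha = nseq l q ++ [:: 1%N], beta = q :: nseq r 1%N,
      m = (q * l + 1)%N /\ n = (q + r)%N &
      [/\ ~~ odd q, ~~ odd l & ~~ odd r]].

Definition pair12 (m n : nat) (alpha beta : seq nat) (q l r : nat) : Prop :=
  [/\ alpha = [:: q], beta = nseq l q ++ nseq r 1%N,
      q = m /\ (q * l + r)%N = n & [/\ ~~ odd l, odd q & ~~ odd r]].

(* The exponent l of q is positive; the exponents r, m, n of 1 may vanish. *)
Definition mult_one_pair (m n : nat) (alpha beta : seq nat) : Prop :=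
  exists q l r : nat, (1 < q)%N /\ (0 < l)%N /\
    (pair1 m n alpha beta q l r \/ pair2 m n alpha beta q l r \/
     pair3 m n alpha beta q l \/ pair4 m n alpha beta q l \/
     pair5 m n alpha beta q l \/ pair6 alpha beta q l r \/
     pair7 m n alpha beta q l r \/ pair8 alpha beta q l r \/
     pair9 m n alpha beta q l r \/ pair10 m n alpha beta q l r \/
     pair11 m n alpha beta q l r \/ pair12 m n alpha beta q l r).

(* Main.v *)
From HB Require Import structures.
Require Import Defs.
From mathcomp Require Import all_boot all_order all_algebra.
From mathcomp Require Import reals complex.
From mathcomp Require Import ring zify.

Set Implicit Arguments.
Unset Strict Implicit.
Unset Printing Implicit Defensive.

Import Order.TTheory GRing.Theory Num.Theory.
Local Open Scope ring_scope.

(** Write V for the superspace F^(m|n). As a module over the sl2-triple it is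
    the sum, over the string lengths d, of M_d (x) V(d - 1), where the
    multiplicity space M_d has dimension (mu_d | nu_d). The form of V induces on
    M_d a nondegenerate form, supersymmetric for odd d and superantisymmetric
    for even d, and the operators of M_d that are skew for it lie in the
    centralizer of the triple ([gnat_blockop]).

    The multiplicity of C (x) adj is the dimension of the space of highest
    vectors, the elements h of osp(m|n) that are killed by the centralizer and
    by e and have weight one: a copy of C (x) adj contains exactly one of them
    up to scalars, and a homogeneous nonzero one generates a copy. In
    particular the multiplicity is unique
    ([triv_adj_multiplicity_unique]).

    A highest vector h maps a string of length d into strings of length d - 2,
    d and d + 2, and is determined by a matrix, its symbol. Commutation with
    the skew operators of the M_d makes the symbol scalar on each M_d and kills
    its components between M_d and M_(d + 2), unless both are lines with a
    symmetric form, on which the centralizer acts by zero ([symbol_row],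
    [symbol_col], [symbol_block], [odd_highest]). Hence the highest vectors have
    a basis formed of the restrictions of e to the strings of a given length
    q > 1, and of one further vector for each pair q, q + 2 of such lines
    ([highest_span]). Counting them gives the formula.

    Complete reducibility is not available, so the required complement of the
    copies is taken to be their orthogonal for the supertrace form
    ([triv_adj_multiplicity_exists]). It is a complement because the pairing of
    the basis vectors is diagonal with nonzero entries: the entry at q > 1 is a
    positive number times the superdimension mu_q - nu_q. This is where the
    assumption on the centralizer is used. A nonzero odd element of a sum of a
    reductive Lie algebra and of copies of osp(1|r) never squares to zero,
    whereas an isotropic vector in the symmetric part of M_q, paired with a
    vector of the alternating part, would give such an element. So if both
    parts of M_q are nonzero then the symmetric one is a line
    ([no_mixed_block]); the alternating one having even dimension, mu_q and nu_q
    are different.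

    Finally, the formula takes the value 1 exactly when a single part exceeds 1
    and no pair of parts q, q + 2 contributes. A pair contributes next to a
    single part greater than 1 only for (3, 1|0), which lives in so(4), and
    so(4) is not simple. *)

(** * Even and odd parts, and the brackets of osp(m|n) *)

(** Proves the matrix identities that hold in every abelian group once the
    products are regarded as atoms. *)
Ltac mx_abel :=
  repeat (match goal with
    |- context [?A *m ?B] =>
      let t := fresh in set t := (A *m B); clearbody t end);
  apply/matrixP => ? ?; rewrite !mxE; ring.

Section Parity.
Variables (F : fieldType) (m n : nat).
Implicit Types X Y Z : 'M[F]_(m + n).

Local Notation ev := (@even_part F m n).
Local Notation od := (@odd_part F m n).
Local Notation P := (parity_mx F m n).
Local Notation B := (osp_form F m n).

Lemma even_addodd X : ev X + od X = X.
Proof. by rewrite /even_part /odd_part add_block_mx !addr0 !add0r submxK. Qed.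

Lemma even_even X : ev (ev X) = ev X.
Proof. by rewrite /even_part block_mxKul block_mxKdr. Qed.

Lemma odd_odd X : od (od X) = od X.
Proof. by rewrite /odd_part block_mxKur block_mxKdl. Qed.

Lemma odd_even X : od (ev X) = 0.
Proof. by rewrite /even_part /odd_part block_mxKur block_mxKdl block_mx0. Qed.

Lemma even_odd X : ev (od X) = 0.
Proof. by rewrite /even_part /odd_part block_mxKul block_mxKdr block_mx0. Qed.

Lemma even_partD X Y : ev (X + Y) = ev X + ev Y. Proof. exact: linearD. Qed.
Lemma odd_partD X Y : od (X + Y) = od X + od Y. Proof. exact: linearD. Qed.
Lemma even_partN X : ev (- X) = - ev X. Proof. exact: linearN. Qed.
Lemma odd_partN X : od (- X) = - od X. Proof. exact: linearN. Qed.
Lemma even_part0 : ev 0 = 0. Proof. exact: linear0. Qed.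
Lemma odd_part0 : od 0 = 0. Proof. exact: linear0. Qed.
Lemma even_partZ c X : ev (c *: X) = c *: ev X. Proof. exact: linearZ. Qed.
Lemma odd_partZ c X : od (c *: X) = c *: od X. Proof. exact: linearZ. Qed.
Lemma trD X Y : (X + Y)^T = X^T + Y^T. Proof. exact: linearD. Qed.
Lemma trN X : (- X)^T = - X^T. Proof. exact: linearN. Qed.
Definition parityE := (even_partD, odd_partD, even_partN, odd_partN,
  even_partZ, odd_partZ, even_part0, odd_part0).

Lemma even_mul X Y : ev (X *m Y) = ev X *m ev Y + od X *m od Y.
Proof.
rewrite -{1}[X]submxK -{1}[Y]submxK mulmx_block /even_part /odd_part.
by rewrite block_mxKul block_mxKdr !mulmx_block !mulmx0 !mul0mx add_block_mx
  !addr0 !add0r [X in block_mx _ _ _ X]addrC.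
Qed.

Lemma odd_mul X Y : od (X *m Y) = ev X *m od Y + od X *m ev Y.
Proof.
rewrite -{1}[X]submxK -{1}[Y]submxK mulmx_block /even_part /odd_part.
by rewrite block_mxKur block_mxKdl !mulmx_block !mulmx0 !mul0mx add_block_mx
  !addr0 !add0r [X in block_mx _ _ X _]addrC.
Qed.

Lemma even_tr X : ev X^T = (ev X)^T.
Proof.
rewrite -{1}[X]submxK tr_block_mx /even_part block_mxKul block_mxKdr.
by rewrite tr_block_mx !trmx0.
Qed.

Lemma odd_tr X : od X^T = (od X)^T.
Proof.
rewrite -{1}[X]submxK tr_block_mx /odd_part block_mxKur block_mxKdl.
by rewrite tr_block_mx !trmx0.
Qed.

Lemma even_id X : od X = 0 -> ev X = X.
Proof. by move=> X0; rewrite -[RHS]even_addodd X0 addr0. Qed.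

Lemma odd_id X : ev X = 0 -> od X = X.
Proof. by move=> X0; rewrite -[RHS]even_addodd X0 add0r. Qed.

Lemma parity_even X : P *m ev X = ev X *m P.
Proof.
by rewrite /parity_mx /even_part !mulmx_block !mulmx0 !mul0mx !addr0 !add0r
  !mulmxN !mulNmx !mulmx1 !mul1mx.
Qed.

Lemma parity_odd X : P *m od X = - (od X *m P).
Proof.
rewrite /parity_mx /odd_part !mulmx_block !mulmx0 !mul0mx !addr0 !add0r.
by rewrite !mulmxN !mulNmx !mulmx1 !mul1mx opp_block_mx !oppr0 opprK.
Qed.

Lemma parity_sqr : P *m P = 1%:M.
Proof.
rewrite /parity_mx mulmx_block !mulmx0 !mul0mx !addr0 !add0r mulmxN mulNmx.
by rewrite !mulmx1 opprK -scalar_mx_block.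
Qed.

Lemma parity_tr : P^T = P.
Proof. by rewrite /parity_mx tr_block_mx !trmx0 linearN /= !trmx1. Qed.

Lemma symplectic_tr : (symplectic_mx F n)^T = - symplectic_mx F n.
Proof.
apply/matrixP=> i j; rewrite !mxE.
case: (boolP (~~ odd i && (j == i.+1 :> nat)));
case: (boolP (~~ odd j && (i == j.+1 :> nat))); rewrite ?opprK ?oppr0 //.
by case/andP=> _ /eqP-> /andP[_ /eqP]; lia.
Qed.

(** Each row of the symplectic matrix has a single nonzero entry, which makes
    the product of two such matrices computable. *)
Lemma symplecticE (i j : 'I_n) : symplectic_mx F n i j =
  (-1) ^+ odd i *+ (j == (if odd i then i.-1 else i.+1) :> nat).
Proof.
rewrite mxE; have [oi|ei] := boolP (odd i); rewrite /= ?expr1 ?expr0.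
  rewrite (_ : _ && _ = (j == i.-1 :> nat)); first by case: eqP.
  by apply/andP/eqP => [[_ /eqP->] //|->]; split; [|apply/eqP]; lia.
case: eqP => //= ne; rewrite (_ : _ && _ = false) //.
by apply/negP => /andP[ej /eqP eij]; move: ei ej; rewrite eij /= => /negbNE ->.
Qed.

Lemma symplectic_sqr : ~~ odd n ->
  symplectic_mx F n *m symplectic_mx F n = - 1%:M.
Proof.
move=> evn; apply/matrixP=> i j; rewrite !mxE.
have := ltn_ord i; have := ltn_ord j => ltj lti.
pose k := if odd i then i.-1 else i.+1.
have ltk : (k < n)%N by rewrite /k; case: ifP => oi; lia.
rewrite (bigD1 (Ordinal ltk)) //= big1 ?addr0 => [|l /eqP nel]; last first.
  rewrite symplecticE; case: eqP => [el|_]; last by rewrite mul0r.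
  by case: nel; apply: val_inj.
rewrite !symplecticE /= -/k eqxx mulr1n.
have -> : odd k = ~~ odd i by rewrite /k; case: ifP => oi; lia.
have -> : (if ~~ odd i then k.-1 else k.+1) = i.
  by rewrite /k; have [oi|ei] := boolP (odd i) => /=; lia.
rewrite eq_sym -[_ == _ :> nat]/(i == j); case: eqP => _.
  by case: (odd i); rewrite /= ?expr1 ?expr0 ?mulr1 ?mul1r.
by rewrite !mulr0n mulr0 oppr0.
Qed.

Lemma form_tr : B^T = P *m B.
Proof.
rewrite /osp_form /parity_mx tr_block_mx !trmx0 trmx1 symplectic_tr.
by rewrite mulmx_block !mulmx0 !mul0mx !addr0 !add0r mulNmx !mul1mx.
Qed.

Lemma even_form : ev B = B.
Proof. by rewrite /even_part block_mxKul block_mxKdr. Qed.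

Lemma form_sqr : ~~ odd n -> B *m B = P.
Proof.
move=> evn; rewrite /osp_form mulmx_block !mulmx0 !mul0mx !addr0 !add0r.
by rewrite mulmx1 symplectic_sqr.
Qed.

Lemma form_unit : ~~ odd n -> B \in unitmx.
Proof.
move=> evn; have : B *m (B *m P) = 1%:M by rewrite mulmxA form_sqr // parity_sqr.
by move/mulmx1_unit => [].
Qed.

(** The defect of X has even part the even condition and odd part the odd one,
    so membership splits along the grading. *)
Lemma ospP X : reflect
  ((ev X)^T *m B + B *m ev X = 0 /\ (od X)^T *m B + P *m B *m od X = 0)
  (X \in osp F m n).
Proof.
have odB : od B = 0 by rewrite -even_form odd_even.
have odP : od P = 0 by rewrite /odd_part block_mxKur block_mxKdl block_mx0.
have odPB : od (P *m B) = 0 by rewrite odd_mul odB odP mulmx0 mul0mx addr0.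
have E1 : ev (osp_defect X) = (ev X)^T *m B + B *m ev X.
  rewrite /osp_defect !parityE !even_mul odPB odB !mul0mx !mulmx0 !addr0.
  by rewrite even_even even_odd mulmx0 addr0 even_tr even_form.
have E2 : od (osp_defect X) = (od X)^T *m B + P *m B *m od X.
  rewrite /osp_defect !parityE (odd_mul X^T) (odd_mul B) (odd_mul (P *m B)).
  rewrite odPB odB !mul0mx !mulmx0 odd_even odd_odd mulmx0 !addr0 ?add0r.
  by rewrite odd_tr even_form (even_id odPB).
rewrite mem_osp -E1 -E2; apply: (iffP eqP) => [->|[e0 o0]].
  by rewrite !parityE.
by rewrite -[LHS]even_addodd e0 o0 addr0.
Qed.

Lemma sbracket_evenl X Y : od X = 0 -> sbracket X Y = X *m Y - Y *m X.
Proof. by move=> oX; rewrite /sbracket oX mulmx0 mul0rn addr0. Qed.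

Lemma sbracket_evenr X Y : od Y = 0 -> sbracket X Y = X *m Y - Y *m X.
Proof. by move=> oY; rewrite /sbracket oY mul0mx mul0rn addr0. Qed.

(** The bracket sorted by parity: commutators, except for the anticommutator of
    the odd parts. *)
Lemma sbracketE X Y : sbracket X Y =
  (ev X *m Y - Y *m ev X) + (od X *m ev Y - ev Y *m od X)
  + (od X *m od Y + od Y *m od X).
Proof.
move: (even_addodd X) (even_addodd Y); rewrite /sbracket.
move: (ev X) (od X) (ev Y) (od Y) => X0 X1 Y0 Y1 <- <-.
rewrite !mulmxDl !mulmxDr mulr2n.
mx_abel.
Qed.

Lemma sbracketDr X Y Z : sbracket X (Y + Z) = sbracket X Y + sbracket X Z.
Proof. exact: (linearD (sbracket X)). Qed.
Lemma sbracket0r X : sbracket X 0 = 0.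
Proof. exact: (linear0 (sbracket X)). Qed.
Lemma sbracketZr a X Y : sbracket X (a *: Y) = a *: sbracket X Y.
Proof. by have := sbracket_is_linear X a Y 0; rewrite sbracket0r !addr0. Qed.
Lemma sbracketDl X Y Z : sbracket (X + Y) Z = sbracket X Z + sbracket Y Z.
Proof. exact: (linearD (sbracketr Z)). Qed.
Lemma sbracket0l X : sbracket 0 X = 0.
Proof. exact: (linear0 (sbracketr X)). Qed.
Lemma sbracketZl a X Y : sbracket (a *: X) Y = a *: sbracket X Y.
Proof.
by have := sbracketr_is_linear Y a X 0; rewrite /sbracketr sbracket0l !addr0.
Qed.

Lemma even_sbracket X Y : ev (sbracket X Y) =
  (ev X *m ev Y - ev Y *m ev X) + (od X *m od Y + od Y *m od X).
Proof.
rewrite sbracketE !parityE !even_mul !even_even !odd_odd !even_odd.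
by rewrite !odd_even !mulmx0 !mul0mx !addr0 !subr0 !add0r ?oppr0 ?addr0.
Qed.

Lemma odd_sbracket X Y : od (sbracket X Y) =
  (ev X *m od Y - od Y *m ev X) + (od X *m ev Y - ev Y *m od X).
Proof.
rewrite sbracketE !parityE !odd_mul !even_even !odd_odd !even_odd.
by rewrite !odd_even !mulmx0 !mul0mx !addr0 !add0r ?subr0 ?addr0.
Qed.

Lemma osp_graded : graded (osp F m n).
Proof.
move=> X /ospP[e0 o0]; apply/ospP; rewrite even_even odd_even e0.
by rewrite trmx0 mul0mx mulmx0 addr0.
Qed.

(** Both parts of the bracket are combinations of products of two homogeneous
    elements, and transposing such a product against the form reverses it, with
    a sign that depends on the parities. *)
Lemma osp_sbracket X Y :
  X \in osp F m n -> Y \in osp F m n -> sbracket X Y \in osp F m n.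
Proof.
move=> /ospP[/eqP]; rewrite addr_eq0 => /eqP eX /eqP.
rewrite addr_eq0 => /eqP oX /ospP[/eqP]; rewrite addr_eq0 => /eqP eY /eqP.
rewrite addr_eq0 => /eqP oY.
have pX : P *m (od X)^T = - ((od X)^T *m P).
  by rewrite -!odd_tr parity_odd.
have pY : P *m (od Y)^T = - ((od Y)^T *m P).
  by rewrite -!odd_tr parity_odd.
have qX : P *m (ev X)^T = ((ev X)^T *m P) by rewrite -!even_tr parity_even.
have qY : P *m (ev Y)^T = ((ev Y)^T *m P) by rewrite -!even_tr parity_even.
have EE : (ev X *m ev Y)^T *m B = B *m (ev Y *m ev X).
  by rewrite trmx_mul -[LHS]mulmxA eX mulmxN !mulmxA eY mulNmx opprK.
have EE' : (ev Y *m ev X)^T *m B = B *m (ev X *m ev Y).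
  by rewrite trmx_mul -[LHS]mulmxA eY mulmxN !mulmxA eX mulNmx opprK.
have OO : (od X *m od Y)^T *m B = - (B *m (od Y *m od X)).
  rewrite trmx_mul -[LHS]mulmxA oX mulmxN !mulmxA -[_ *m P]opprK -pY !mulNmx opprK.
  by rewrite -!mulmxA (mulmxA (od Y)^T) oY mulNmx mulmxN !mulmxA parity_sqr mul1mx.
have OO' : (od Y *m od X)^T *m B = - (B *m (od X *m od Y)).
  rewrite trmx_mul -[LHS]mulmxA oY mulmxN !mulmxA -[_ *m P]opprK -pX !mulNmx opprK.
  by rewrite -!mulmxA (mulmxA (od X)^T) oX mulNmx mulmxN !mulmxA parity_sqr mul1mx.
have EO S T : S^T *m B = - (B *m S) -> T^T *m B = - (P *m B *m T) ->
    (S *m T)^T *m B = P *m B *m (T *m S).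
  move=> eS eT.
  by rewrite trmx_mul -[LHS]mulmxA eS mulmxN !mulmxA eT mulNmx opprK.
have OE S T : P *m S^T = S^T *m P ->
    S^T *m B = - (B *m S) -> T^T *m B = - (P *m B *m T) ->
    (T *m S)^T *m B = P *m B *m (S *m T).
  move=> pS eS eT; rewrite trmx_mul -[LHS]mulmxA eT mulmxN !mulmxA -pS -!mulmxA.
  by rewrite (mulmxA S^T) eS mulNmx mulmxN opprK !mulmxA.
apply/ospP; rewrite even_sbracket odd_sbracket !(trD, trN).
rewrite !(mulmxDl, mulmxDr, mulNmx, mulmxN) EE EE' OO OO'.
rewrite (EO _ _ eX oY) (OE _ _ qX eX oY) (EO _ _ eY oX) (OE _ _ qY eY oX).
by split; mx_abel.
Qed.

End Parity.

(** * Strings of weight vectors of sl2 *)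

Section Eigenvectors.
Variables (F : fieldType) (V : vectType F) (X : {linear V -> V}).

(** Eigenvectors for distinct eigenvalues: apply X - a K to a vanishing
    combination to remove its last term. *)
Lemma eigenvectors_free (u : nat -> V) (a : nat -> F) K :
  (forall i j, (i < K)%N -> (j < K)%N -> a i = a j -> i = j) ->
  (forall i, (i < K)%N -> X (u i) = a i *: u i) ->
  (forall i, (i < K)%N -> u i != 0) -> free (mkseq u K).
Proof.
move=> a_inj Xu u0.
suff main (c : nat -> F) : \sum_(i < K) c i *: u i = 0 -> forall i, (i < K)%N -> c i = 0.
  have sz : size (mkseq u K) == K by rewrite size_mkseq.
  apply/(@freeP _ _ _ (Tuple sz)) => k s0 i.
  pose c (j : nat) := if insub j is Some i then k i else 0.
  have := main c; rewrite -[k i](_ : c i = _); last by rewrite /c valK.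
  apply=> //; rewrite -[RHS]s0; apply: eq_bigr => j _.
  by rewrite /c valK /= nth_mkseq.
elim: K c a_inj Xu u0 => [//|K IH] c a_inj Xu u0 s0.
have small i : (i < K)%N -> c i = 0.
  move=> ltiK; have /eqP : c i * (a i - a K) = 0.
    apply: (IH (fun j => c j * (a j - a K))) => //.
    - by move=> ? ? ? ?; apply: a_inj; apply: ltnW.
    - by move=> ? ?; apply/Xu/ltnW.
    - by move=> ? ?; apply/u0/ltnW.
    have /(congr1 ( *:%R (a K))) := s0; rewrite scaler0 scaler_sumr => aK0.
    have := congr1 X s0; rewrite linear0 linear_sum /= -[in RHS]aK0.
    move/eqP; rewrite -subr_eq0 -sumrB big_ord_recr /= linearZ /= Xu //.
    rewrite !scalerA [c K * _]mulrC subrr addr0 => /eqP s1; rewrite -[RHS]s1.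
    apply: eq_bigr => j _; rewrite linearZ /= Xu ?(ltn_trans (ltn_ord j)) //.
    by rewrite !scalerA -scalerBl mulrBr [c j * a K]mulrC.
  rewrite mulf_eq0 subr_eq0 => /orP[/eqP //|/eqP /a_inj]; lia.
move=> i; rewrite ltnS leq_eqVlt => /orP[/eqP->|/small//].
move: s0; rewrite big_ord_recr /= big1 => [|j _]; last first.
  by rewrite small ?scale0r.
rewrite add0r => /eqP; rewrite scaler_eq0 (negPf (u0 K _)) // orbF.
by move/eqP.
Qed.

Lemma eigenvectors_bound (u : nat -> V) (a : nat -> F) K :
  (forall i j, (i < K)%N -> (j < K)%N -> a i = a j -> i = j) ->
  (forall i, (i < K)%N -> X (u i) = a i *: u i) ->
  (forall i, (i < K)%N -> u i != 0) -> (K <= \dim {:V})%N.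
Proof.
move=> a_inj Xu u0; have := eigenvectors_free a_inj Xu u0.
move/eqP; rewrite size_mkseq => <-; exact/dimvS/subvf.
Qed.

End Eigenvectors.

Section LowestWeight.
Variables (F : numFieldType) (V : vectType F) (E X Y : {linear V -> V}).
Hypothesis XE : forall v, X (E v) = E (X v) + E v.
Hypothesis EY : forall v, E (Y v) = Y (E v) + X v.

Variables (mu : F) (b : V).
Hypotheses (Xb : X b = mu *: b) (Yb : Y b = 0).

Lemma string_weight k : X (iter k E b) = (mu + k%:R) *: iter k E b.
Proof.
elim: k => [|k IH]; first by rewrite addr0.
rewrite iterS XE IH linearZ /= -[X in _ + X]scale1r -scalerDl -addrA.
by rewrite natr1.
Qed.

(** The coefficients are forced by commuting Y past one more E at a time. *)
Lemma string_down k : Y (iter k.+1 E b) =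
  - (k.+1%:R * (mu + k%:R / 2)) *: iter k E b.
Proof.
elim: k => [|k IH].
  have := EY b; rewrite Yb linear0 /= Xb => /eqP.
  by rewrite eq_sym addr_eq0 => /eqP->; rewrite scaleNr; congr (- (_ *: _)); field.
have := EY (iter k.+1 E b); rewrite IH string_weight linearZ /= -!iterS.
move/eqP; rewrite -subr_eq => /eqP <-; rewrite -scalerBl; congr (_ *: _).
by rewrite -!natr1; field.
Qed.

(** The string through a lowest weight vector stops, since its members have
    distinct weights, and where it stops determines the weight. *)
Lemma string_length : b != 0 -> exists D : nat,
  [/\ (0 < D)%N, mu = - (D%:R - 1) / 2, forall k, (D <= k)%N -> iter k E b = 0 &
      forall k, (k < D)%N -> iter k E b != 0].
Proof.
move=> b0; have exD : exists D, iter D E b == 0.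
  have [/existsP[k k0]|nz] := boolP [exists k : 'I_(\dim {:V}).+1, iter k E b == 0].
    by exists k.
  have nz' i : (i < (\dim {:V}).+1)%N -> iter i E b != 0.
    by move=> lti; apply: contraNneq nz => e0; apply/existsP; exists (Ordinal lti); apply/eqP.
  suff : ((\dim {:V}).+1 <= \dim {:V})%N by rewrite ltnn.
  apply: (@eigenvectors_bound _ _ X (fun k => iter k E b) (fun k => mu + k%:R)) => //.
  - by move=> i j _ _ /addrI/eqP; rewrite eqr_nat => /eqP.
  - by move=> i _; apply: string_weight.
case: (ex_minnP exD) => D /eqP D0 minD.
have Dgt0 : (0 < D)%N by case: D D0 {minD} => // /= b00; rewrite b00 eqxx in b0.
exists D; split=> //.
- have := string_down D.-1; rewrite prednK // D0 linear0 => /esym/eqP.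
  rewrite scaler_eq0 oppr_eq0 mulf_eq0 pnatr_eq0 (gtn_eqF Dgt0) /=.
  have /negPf -> : iter D.-1 E b != 0.
    by apply/negP => /minD; rewrite leqNgt prednK // leqnn.
  rewrite orbF addr_eq0 -subn1 natrB // => /eqP->; by field.
- move=> k /subnK <-; elim: (k - D)%N => [//|i /= ->]; exact: linear0.
- by move=> k; apply: contraTneq => /eqP /minD; rewrite -leqNgt.
Qed.

End LowestWeight.

(** * Decomposition of an sl2-module into strings *)

Definition sl2_relations (F : fieldType) (d : nat) (e x f : 'M[F]_d) : Prop :=
  [/\ x *m e - e *m x = e, x *m f - f *m x = - f & e *m f - f *m e = x].

(** The vectors [v j k], [k < dd j], form a basis with dual basis [co j k],
    and for fixed [j] they span a copy of the irreducible module of dimension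
    [dd j], whose lowest weight vector is [v j 0]. *)
Record strings (F : fieldType) (d N : nat) (e x f : 'M[F]_d)
    (dd : 'I_N -> nat) (v : 'I_N -> nat -> 'cV[F]_d)
    (co : 'I_N -> nat -> 'cV[F]_d -> F) : Prop := Strings {
  str_gt0 : forall j, (0 < dd j)%N;
  str_e : forall j k, e *m v j k = v j k.+1;
  str_0 : forall j k, (dd j <= k)%N -> v j k = 0;
  str_x : forall j k, x *m v j k = (k%:R - ((dd j)%:R - 1) / 2) *: v j k;
  str_f : forall j k, f *m v j k.+1 =
    (k.+1%:R * ((dd j)%:R - k.+1%:R) / 2) *: v j k;
  str_f0 : forall j, f *m v j 0%N = 0;
  str_lin : forall j k a y z, co j k (a *: y + z) = a * co j k y + co j k z;
  str_co : forall i l j k, (k < dd j)%N ->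
    co i l (v j k) = ((i == j) && (l == k))%:R;
  str_sum : forall y, y = \sum_j \sum_(k < dd j) co j k y *: v j k }.

Section Module.
Variables (F : numClosedFieldType) (d : nat).
Implicit Types (e x f : 'M[F]_d) (U : {vspace 'cV[F]_d}).

(** Cayley-Hamilton on the whole space: the product of the x - r over the roots
    r of the characteristic polynomial kills v, so some partial product maps v
    to an eigenvector, which stays in U. *)
Lemma stable_eigenvector x U : U <> 0%VS ->
  (forall v, v \in U -> x *m v \in U) ->
  exists a v, [/\ v \in U, v != 0 & x *m v = a *: v].
Proof.
move=> /eqP; rewrite -vpick0 => U0 stab; move: (memv_pick U) => vU; move: (vpick U) vU U0 => v.
case: d x U stab v => [|d'] y W stab v vW v0.
  by case/eqP: v0; apply/matrixP => -[].
have [rs Drs] := closed_field_poly_normal (char_poly y).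
have main : forall w, w \in W -> w != 0 ->
    horner_mx y (\prod_(z <- rs) ('X - z%:P)) *m w = 0 ->
    exists a v, [/\ v \in W, v != 0 & y *m v = a *: v].
  elim: {Drs} rs => [|r rs IH] w wW w0.
    by rewrite big_nil rmorph1 mul1mx => w00; rewrite w00 eqxx in w0.
  rewrite big_cons mulrC rmorphM /= -mulmxE -mulmxA.
  rewrite rmorphB /= horner_mx_X horner_mx_C mulmxBl mul_scalar_mx.
  have [yw _|yw] := eqVneq (y *m w - r *: w) 0; last first.
    by apply: IH => //; rewrite rpredB ?rpredZ ?stab.
  by exists r, w; split=> //; apply/eqP; rewrite -subr_eq0 yw.
apply: (main v) => //.
have := Cayley_Hamilton y; rewrite Drs (monicP (char_poly_monic y)) scale1r.
by move->; rewrite mul0mx.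
Qed.

Lemma nilpotent_iter f (v : 'cV[F]_d) : nilpotent_mx f ->
  exists k, iter k (mulmx f) v = 0.
Proof.
case=> k k0; exists k; rewrite -[RHS](mul0mx _ v) -k0.
by elim: k {k0} => [|k IH] /=; rewrite ?mul1mx // IH mulmxA.
Qed.

Section Triple.
Variables (e x f : 'M[F]_d).
Hypotheses (rel : sl2_relations e x f) (fnil : nilpotent_mx f).

Let xe (v : 'cV[F]_d) : x *m (e *m v) = e *m (x *m v) + e *m v.
Proof.
case: rel => /(congr1 (mulmx^~ v)) + _ _; rewrite mulmxBl -!mulmxA.
by move/eqP; rewrite subr_eq addrC => /eqP.
Qed.

Let xf (v : 'cV[F]_d) : x *m (f *m v) = f *m (x *m v) - f *m v.
Proof.
case: rel => _ /(congr1 (mulmx^~ v)) + _; rewrite mulmxBl mulNmx -!mulmxA.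
by move/eqP; rewrite subr_eq addrC => /eqP.
Qed.

Let ef (v : 'cV[F]_d) : e *m (f *m v) = f *m (e *m v) + x *m v.
Proof.
case: rel => _ _ /(congr1 (mulmx^~ v)); rewrite mulmxBl -!mulmxA.
by move/eqP; rewrite subr_eq addrC => /eqP.
Qed.

(** Applying the nilpotent f to an eigenvector of x gives eigenvectors of x until
    it gives zero. *)
Lemma stable_lowest U : stable [:: e; x; f] U -> U <> 0%VS ->
  exists mu b, [/\ b \in U, b != 0, x *m b = mu *: b & f *m b = 0].
Proof.
move=> stab U0; have stabx v : v \in U -> x *m v \in U.
  by apply: stab; rewrite !inE eqxx orbT.
have stabf v : v \in U -> f *m v \in U.
  by apply: stab; rewrite !inE eqxx !orbT.
have [a [v [vU v0 xv]]] := stable_eigenvector U0 stabx.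
have [k] := nilpotent_iter v fnil.
elim: k a v vU v0 xv => [|k IH] a v vU v0 xv.
  by move=> /= v00; rewrite v00 eqxx in v0.
have [fv0 _|fv0] := eqVneq (f *m v) 0; first by exists a, v; split.
rewrite iterSr => k0; apply: (IH (a - 1) (f *m v)) => //; first exact: stabf.
by rewrite xf xv -scalemxAr scalerBl scale1r.
Qed.

(** The string through a lowest weight vector spans a stable subspace, hence
    everything, and its length is then the dimension. *)
Lemma irreducible_string U : irreducible [:: e; x; f] U ->
  exists b, [/\ basis_of U (mkseq (fun k => iter k (mulmx e) b) (\dim U)),
    forall k, (\dim U <= k)%N -> iter k (mulmx e) b = 0,
    f *m b = 0,
    forall k, x *m iter k (mulmx e) b =
      (k%:R - ((\dim U)%:R - 1) / 2) *: iter k (mulmx e) b &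
    forall k, f *m iter k.+1 (mulmx e) b =
      (k.+1%:R * ((\dim U)%:R - k.+1%:R) / 2) *: iter k (mulmx e) b].
Proof.
case=> stab U0 irr; have [mu [b [bU b0 xb fb]]] := stable_lowest stab U0.
have xw k := string_weight (E := mulmx e) (X := mulmx x) xe xb k.
have fw k := string_down (E := mulmx e) (X := mulmx x) (Y := mulmx f) xe ef xb fb k.
have [D [D0 muD e0 en0]] :=
  string_length (E := mulmx e) (X := mulmx x) (Y := mulmx f) xe ef xb fb b0.
pose u k := iter k (mulmx e) b.
have uU k : u k \in U.
  by elim: k => [//|k IH]; apply: stab => //; rewrite !inE eqxx.
have fr : free (mkseq u D).
  apply: (@eigenvectors_free _ _ (mulmx x) _ (fun k => mu + k%:R)) => //=.
    by move=> i j _ _ /addrI/eqP; rewrite eqr_nat => /eqP.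
  by move=> i _; apply: xw.
have us k : u k \in <<mkseq u D>>%VS.
  have [leDk|ltkD] := leqP D k; first by rewrite /u e0 // mem0v.
  by apply: memv_span; apply: map_f; rewrite mem_iota.
have sU : <<mkseq u D>>%VS = U.
  have [| |s0|//] := irr <<mkseq u D>>%VS.
  - move=> g v gin vin; rewrite -[g *m v](lfunE (mulmx g)).
    have /subvP : (linfun (mulmx g) @: <<mkseq u D>> <= <<mkseq u D>>)%VS.
      rewrite limg_span; apply/span_subvP => _ /mapP[_ /mapP[k _ ->] ->].
      rewrite lfunE /=; move: gin; rewrite !inE => /or3P[]/eqP->.
      - exact: (us k.+1).
      - by rewrite xw rpredZ ?us.
      - by case: k => [|k]; [rewrite fb mem0v|rewrite fw rpredZ ?us].
    by apply; apply: memv_img.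
  - by apply/span_subvP => _ /mapP[k _ ->].
  - by have := us 0%N; rewrite s0 memv0 /u /= (negPf b0).
have dimU : \dim U = D by rewrite -sU; move/eqP: fr; rewrite size_mkseq.
rewrite dimU; exists b; split=> //.
- by rewrite /basis_of sU eqxx fr.
- by move=> k; rewrite xw muD; congr (_ *: _); field.
- move=> k; rewrite fw muD; congr (_ *: _); rewrite -natr1; by field.
Qed.

End Triple.
End Module.

Section ModuleStrings.
Variables (F : numClosedFieldType) (d : nat) (e x f : 'M[F]_d).
Hypotheses (rel : sl2_relations e x f) (fnil : nilpotent_mx f).

(** The dual basis is obtained by projecting to a summand and taking coordinates
    in its string. *)
Lemma module_strings (lam : seq nat) : module_type [:: e; x; f] lam ->
  exists v co, strings e x f (fun j : 'I_(size lam) => nth 0%N lam j) v co.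
Proof.
case=> U [dU sU irrU].
have /fin_all_exists[b bP] i := irreducible_string rel fnil (irrU i).1.
pose v i k := iter k (mulmx e) (b i).
have dimU i : \dim (U i) = nth 0%N lam i by case: (irrU i).
have sz i : size (mkseq (v i) (\dim (U i))) == \dim (U i) by rewrite size_mkseq.
pose t i := Tuple (sz i).
have tB i : basis_of (U i) (t i) by case: (bP i).
pose pi i : 'cV[F]_d -> 'cV[F]_d := sumv_pi_for (erefl (\sum_i U i)%VS) i.
have piU i j u : u \in U j -> pi i u = if i == j then u else 0.
  move=> uj; have /directv_sum_unique uniqU := dU.
  have : \sum_i pi i u = \sum_i (if i == j then u else 0).
    rewrite (@sumv_pi_sum _ _ _ predT) ?sU ?memvf //.
    by rewrite -big_mkcond /= big_pred1_eq.
  move/eqP; rewrite uniqU => [/forallP/(_ i)/implyP/(_ isT)/eqP //|k _|k _].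
    exact: memv_sum_pi.
  by case: eqP => [->|_]; rewrite ?mem0v.
pose co i l (y : 'cV[F]_d) : F :=
  if insub l is Some l' then coord (t i) l' (pi i y) else 0.
have tE i (k : 'I_(\dim (U i))) : (t i)`_k = v i k by rewrite nth_mkseq.
exists v, co; split.
- by move=> j; rewrite -dimU lt0n dimv_eq0; case: (irrU j) => -[_ /eqP].
- by [].
- by move=> j k; rewrite -dimU; case: (bP j) => _ + _ _ _; apply.
- by move=> j k; rewrite -dimU; case: (bP j) => _ _ _ + _; apply.
- by move=> j k; rewrite -dimU; case: (bP j) => _ _ _ _; apply.
- by move=> j; case: (bP j).
- move=> j k a y z; rewrite /co /pi; case: insubP => [l _ _|_].
    by rewrite !linearP.
  by rewrite mulr0 addr0.
- move=> i l j k; rewrite -dimU => ltk.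
  have vE : v j k = (t j)`_(Ordinal ltk) by rewrite tE.
  have vU : v j k \in U j.
    by apply: (basis_mem (tB j)); rewrite vE mem_nth // size_tuple.
  rewrite /co (piU _ _ _ vU) eq_sym; case: insubP => [l' ltl lE|].
    case: eqP => [ij|_]; last by rewrite linear0.
    by case: _ / ij l' ltl lE => l' ltl <-; rewrite vE coord_free ?(basis_free (tB j)) // eq_sym.
  case: eqP => [<-|_ _]; last by [].
  by rewrite -leqNgt; case: eqP => [->|//]; rewrite leqNgt ltk.
- move=> y; rewrite -{1}[y](sumv_pi_sum (erefl (\sum_i U i)%VS)) ?sU ?memvf //.
  apply: eq_bigr => i _; rewrite -/(pi i y).
  have piy : pi i y \in U i by apply: memv_sum_pi.
  rewrite {1}(coord_basis (tB i) piy) -dimU; apply: eq_bigr => k _.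
  by rewrite tE /co valK.
Qed.

End ModuleStrings.

(** * Homogeneous strings in a superspace *)

(** The strings are numbered by the parts of alpha followed by those of beta. *)
Definition pair_len (alpha beta : seq nat) (j : 'I_(size alpha + size beta)) :=
  match split j with
  | inl i => nth 0%N alpha i
  | inr i => nth 0%N beta i
  end.

Definition pair_odd (alpha beta : seq nat) (j : 'I_(size alpha + size beta)) :=
  if split j is inr _ then true else false.

Lemma split_lshiftE m n (i : 'I_m) : split (lshift n i) = inl i.
Proof. by rewrite -[lshift _ _]/(unsplit (inl i)) unsplitK. Qed.

Lemma split_rshiftE m n (i : 'I_n) : split (rshift m i) = inr i.
Proof. by rewrite -[rshift _ _]/(unsplit (inr i)) unsplitK. Qed.

Section SuperStrings.
Variables (F : numClosedFieldType) (m n : nat) (e x f : 'M[F]_(m + n)).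
Hypotheses (eev : odd_part e = 0) (xev : odd_part x = 0) (fev : odd_part f = 0).
Hypotheses (rel : sl2_relations e x f) (fnil : nilpotent_mx f).

Let even_block (y : 'M[F]_(m + n)) : odd_part y = 0 ->
  y = block_mx (ulsubmx y) 0 0 (drsubmx y).
Proof. by move/even_id. Qed.

Let relations_ul : sl2_relations (ulsubmx e) (ulsubmx x) (ulsubmx f).
Proof.
case: rel; rewrite (even_block eev) (even_block xev) (even_block fev).
rewrite !mulmx_block !mulmx0 !mul0mx !addr0 !opp_block_mx !add_block_mx.
by move=> /eq_block_mx[? _ _ _] /eq_block_mx[? _ _ _] /eq_block_mx[? _ _ _];
  rewrite !block_mxKul.
Qed.

Let relations_dr : sl2_relations (drsubmx e) (drsubmx x) (drsubmx f).
Proof.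
case: rel; rewrite (even_block eev) (even_block xev) (even_block fev).
rewrite !mulmx_block !mulmx0 !mul0mx !add0r !opp_block_mx !add_block_mx.
by move=> /eq_block_mx[_ _ _ ?] /eq_block_mx[_ _ _ ?] /eq_block_mx[_ _ _ ?];
  rewrite !block_mxKdr.
Qed.

Let f_iter k : iter k (mulmx f) 1%:M =
  block_mx (iter k (mulmx (ulsubmx f)) 1%:M) 0 0
           (iter k (mulmx (drsubmx f)) 1%:M).
Proof.
elim: k => [|k IH]; first by rewrite /= -scalar_mx_block.
rewrite !iterS IH {1}(even_block fev) mulmx_block !mulmx0 !mul0mx.
by rewrite !addr0 !add0r.
Qed.

Let nil_ul : nilpotent_mx (ulsubmx f).
Proof.
case: fnil => k; rewrite f_iter -[RHS]block_mx0 => /eq_block_mx[? _ _ _].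
by exists k.
Qed.

Let nil_dr : nilpotent_mx (drsubmx f).
Proof.
case: fnil => k; rewrite f_iter -[RHS]block_mx0 => /eq_block_mx[_ _ _ ?].
by exists k.
Qed.

Lemma encoded_strings alpha beta : encoded_by e x f alpha beta ->
  exists v co, strings e x f (@pair_len alpha beta) v co /\
    forall j k, parity_mx F m n *m v j k = (-1) ^+ @pair_odd alpha beta j *: v j k.
Proof.
case=> _ _ mod0 mod1.
have [v0 [co0 S0]] := module_strings relations_ul nil_ul mod0.
have [v1 [co1 S1]] := module_strings relations_dr nil_dr mod1.
pose v (j : 'I_(size alpha + size beta)) k : 'cV[F]_(m + n) :=
  match split j with
  | inl i => col_mx (v0 i k) 0
  | inr i => col_mx 0 (v1 i k)
  end.
pose co (j : 'I_(size alpha + size beta)) k (y : 'cV[F]_(m + n)) : F :=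
  match split j with
  | inl i => co0 i k (usubmx y)
  | inr i => co1 i k (dsubmx y)
  end.
have co00 i k : co0 i k 0 = 0.
  by have := str_lin S0 i k (-1) 0 0; rewrite scaler0 addr0 mulN1r addNr.
have co10 i k : co1 i k 0 = 0.
  by have := str_lin S1 i k (-1) 0 0; rewrite scaler0 addr0 mulN1r addNr.
have act (y : 'M[F]_(m + n)) (a : 'cV_m) (b : 'cV_n) : odd_part y = 0 ->
    y *m col_mx a b = col_mx (ulsubmx y *m a) (drsubmx y *m b).
  move=> oy; rewrite {1}(even_block oy) mul_block_col !mul0mx.
  by rewrite addr0 add0r.
have z0 c : c *: (0 : 'cV[F]_m) = 0 by rewrite scaler0.
exists v, co; split; last first.
  move=> j k; rewrite /v /pair_odd; case: (split j) => i.
    rewrite /parity_mx mul_block_col !mul0mx !mulmx0 !addr0 mul1mx.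
    by rewrite expr0 scale1r.
  rewrite /parity_mx mul_block_col !mul0mx !mulmx0 !add0r mulNmx mul1mx.
  by rewrite expr1 scaleN1r opp_col_mx oppr0.
split; rewrite /v /co /pair_len.
- by move=> j; case: (split j) => i; [apply: (str_gt0 S0)|apply: (str_gt0 S1)].
- move=> j k; case: (split j) => i; rewrite act // mulmx0.
    by rewrite (str_e S0).
  by rewrite (str_e S1).
- move=> j k; case: (split j) => i le.
    by rewrite (str_0 S0) // col_mx0.
  by rewrite (str_0 S1) // col_mx0.
- move=> j k; case: (split j) => i; rewrite act // mulmx0 scale_col_mx scaler0.
    by rewrite (str_x S0).
  by rewrite (str_x S1).
- move=> j k; case: (split j) => i; rewrite act // mulmx0 scale_col_mx scaler0.
    by rewrite (str_f S0).
  by rewrite (str_f S1).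
- move=> j; case: (split j) => i; rewrite act // mulmx0.
    by rewrite (str_f0 S0) col_mx0.
  by rewrite (str_f0 S1) col_mx0.
- move=> j k a y z; case: (split j) => i; rewrite !linearP.
    by rewrite (str_lin S0).
  by rewrite (str_lin S1).
- move=> i l j k.
  have -> : (i == j) = (unsplit (split i) == unsplit (split j)) by rewrite !splitK.
  case: (split i) => i'; case: (split j) => j' ltk.
  + rewrite col_mxKu (str_co S0) // (inj_eq (@lshift_inj _ _)) //.
  + by rewrite col_mxKu co00 eq_lrshift.
  + by rewrite col_mxKd co10 eq_rlshift.
  + rewrite col_mxKd (str_co S1) // (inj_eq (@rshift_inj _ _)) //.
move=> y; rewrite big_split_ord /=.
under eq_bigr do rewrite split_lshiftE.
under [X in _ = _ + X]eq_bigr do rewrite split_rshiftE.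
rewrite -{1}[y]vsubmxK {1}[usubmx y](str_sum S0) {1}[dsubmx y](str_sum S1).
rewrite -[X in col_mx X _]addr0 -[X in col_mx _ X]add0r -add_col_mx.
congr (_ + _).
  rewrite -[RHS]vsubmxK !linear_sum /=; congr col_mx; last first.
    rewrite [RHS]big1 // => i _; rewrite linear_sum big1 //= => k _.
    by rewrite linearZ /= col_mxKd scaler0.
  apply: eq_bigr => i _; rewrite linear_sum /=.
  by apply: eq_bigr => k _; rewrite linearZ /= col_mxKu.
rewrite -[RHS]vsubmxK !linear_sum /=; congr col_mx.
  rewrite [RHS]big1 // => i _; rewrite linear_sum big1 //= => k _.
  by rewrite linearZ /= col_mxKu scaler0.
apply: eq_bigr => i _; rewrite linear_sum /=.
by apply: eq_bigr => k _; rewrite linearZ /= col_mxKd.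
Qed.

End SuperStrings.

(** * The invariant form on strings *)

(** The setting of most of what follows: a triple of even elements of osp(m|n)
    and a basis of V formed of homogeneous strings, [dd j] and [p j] being the
    length and the parity of the string [j]. *)
Record osp_strings (F : fieldType) (m n N : nat) (e x f : 'M[F]_(m + n))
    (dd : 'I_N -> nat) (p : 'I_N -> bool) (v : 'I_N -> nat -> 'cV[F]_(m + n))
    (co : 'I_N -> nat -> 'cV[F]_(m + n) -> F) : Prop := OspStrings {
  os_n : ~~ odd n;
  os_e : e \in osp F m n; os_x : x \in osp F m n; os_f : f \in osp F m n;
  os_eev : odd_part e = 0; os_xev : odd_part x = 0; os_fev : odd_part f = 0;
  os_rel : sl2_relations e x f;
  os_str : strings e x f dd v co;
  os_par : forall j k, parity_mx F m n *m v j k = (-1) ^+ p j *: v j k }.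

Definition bform (F : fieldType) (m n : nat) (u w : 'cV[F]_(m + n)) : F :=
  (u^T *m osp_form F m n *m w) 0 0.

Section Bform.
Variables (F : numFieldType) (m n : nat).
Implicit Types (u w : 'cV[F]_(m + n)) (A : 'M[F]_(m + n)).
Local Notation P := (parity_mx F m n).
Local Notation bf := (@bform F m n).

Lemma bformDl u u' w : bf (u + u') w = bf u w + bf u' w.
Proof. by rewrite /bform linearD /= !mulmxDl mxE. Qed.
Lemma bformZl a u w : bf (a *: u) w = a * bf u w.
Proof. by rewrite /bform linearZ /= -!scalemxAl mxE. Qed.
Lemma bformDr u w w' : bf u (w + w') = bf u w + bf u w'.
Proof. by rewrite /bform mulmxDr mxE. Qed.
Lemma bformZr a u w : bf u (a *: w) = a * bf u w.
Proof. by rewrite /bform -scalemxAr mxE. Qed.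
Lemma bform0l w : bf 0 w = 0.
Proof. by rewrite /bform trmx0 !mul0mx mxE. Qed.
Lemma bform0r u : bf u 0 = 0.
Proof. by rewrite /bform mulmx0 mxE. Qed.
Lemma bform_suml I (r : seq I) (Q : pred I) (u : I -> 'cV[F]_(m + n)) w :
  bf (\sum_(i <- r | Q i) u i) w = \sum_(i <- r | Q i) bf (u i) w.
Proof. by elim/big_rec2: _ => [|i y1 y2 _ <-]; rewrite ?bform0l ?bformDl. Qed.
Lemma bform_sumr I (r : seq I) (Q : pred I) u (w : I -> 'cV[F]_(m + n)) :
  bf u (\sum_(i <- r | Q i) w i) = \sum_(i <- r | Q i) bf u (w i).
Proof. by elim/big_rec2: _ => [|i y1 y2 _ <-]; rewrite ?bform0r ?bformDr. Qed.

Lemma bformC u w : bf w u = bf (P *m u) w.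
Proof.
have E : (w^T *m osp_form F m n *m u)^T = (P *m u)^T *m osp_form F m n *m w.
  by rewrite !trmx_mul trmxK form_tr parity_tr !mulmxA.
by rewrite /bform -E [RHS]mxE.
Qed.

Lemma bform_even A u w : A \in osp F m n -> odd_part A = 0 ->
  bf (A *m u) w = - bf u (A *m w).
Proof.
move=> /ospP[/eqP + _] oA; rewrite (even_id oA) addr_eq0 => /eqP AB.
rewrite /bform trmx_mul -(mulmxA u^T) AB mulmxN mulNmx [LHS]mxE.
by rewrite !mulmxA.
Qed.

(** Conjugation by the parity matrix detects the grading. *)
Lemma even_parityP A : reflect (P *m A = A *m P) (odd_part A == 0).
Proof.
apply: (iffP eqP) => [/even_id <-|]; first exact: parity_even.
rewrite -{1 2}[A]even_addodd mulmxDr mulmxDl parity_even parity_odd.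
move/addrI => /eqP; rewrite eq_sym -addr_eq0 -mulr2n => /eqP.
move/(congr1 (mulmx^~ P)); rewrite mul0mx mulmxDl -!mulmxA parity_sqr.
rewrite mulmx1 -mulr2n => /eqP; rewrite -scaler_nat scaler_eq0 pnatr_eq0 /=.
by move/eqP.
Qed.

Lemma odd_parityP A : reflect (P *m A = - (A *m P)) (even_part A == 0).
Proof.
apply: (iffP eqP) => [/odd_id <-|]; first exact: parity_odd.
rewrite -{1 2}[A]even_addodd mulmxDr mulmxDl parity_even parity_odd opprD.
move/addIr => /eqP; rewrite -addr_eq0 => /eqP.
move/(congr1 (mulmx^~ P)); rewrite mul0mx mulmxDl -!mulmxA parity_sqr.
rewrite mulmx1 -mulr2n => /eqP; rewrite -scaler_nat scaler_eq0 pnatr_eq0 /=.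
by move/eqP.
Qed.

End Bform.

Section Strings.
Variables (F : numFieldType) (d N : nat) (e x f : 'M[F]_d).
Variables (dd : 'I_N -> nat) (v : 'I_N -> nat -> 'cV[F]_d).
Variable (co : 'I_N -> nat -> 'cV[F]_d -> F).
Hypothesis S : strings e x f dd v co.

Lemma str_mulmx_ext n' (A A' : 'M[F]_(n', d)) :
  (forall j k, (k < dd j)%N -> A *m v j k = A' *m v j k) -> A = A'.
Proof.
move=> eqA; have all (y : 'cV_d) : A *m y = A' *m y.
  rewrite (str_sum S y) !mulmx_sumr; apply: eq_bigr => j _.
  rewrite !mulmx_sumr; apply: eq_bigr => k _.
  by rewrite -!scalemxAr eqA.
apply/matrixP => i j; have := all (delta_mx j 0).
by rewrite -!colE => /matrixP/(_ i 0); rewrite !mxE.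
Qed.

Lemma str_form_ext (A : 'M[F]_d) :
  (forall j k r l, (k < dd j)%N -> (l < dd r)%N -> (v j k)^T *m A *m v r l = 0) ->
  A = 0.
Proof.
move=> eqA; apply: str_mulmx_ext => r l lt; rewrite mul0mx.
apply: trmx_inj; apply: str_mulmx_ext => j k lt'.
have -> : (A *m v r l)^T *m v j k = ((v j k)^T *m A *m v r l)^T.
  by rewrite !trmx_mul trmxK mulmxA.
by rewrite eqA // !trmx0 mul0mx.
Qed.

(** The operator that sends each [v j k] to [g j k]. *)
Definition string_map (g : 'I_N -> nat -> 'cV[F]_d) : 'M[F]_d :=
  \matrix_(r, c) (\sum_j \sum_(k < dd j) co j k (delta_mx c 0) *: g j k) r 0.

Lemma str_co0 j k : co j k 0 = 0.
Proof. by have := str_lin S j k (-1) 0 0; rewrite scaler0 addr0 mulN1r addNr. Qed.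

Lemma str_coD j k y z : co j k (y + z) = co j k y + co j k z.
Proof. by have := str_lin S j k 1 y z; rewrite scale1r mul1r. Qed.

Lemma str_coZ j k a y : co j k (a *: y) = a * co j k y.
Proof. by have := str_lin S j k a y 0; rewrite str_co0 !addr0. Qed.

Lemma str_co_sum j k I (r : seq I) (Q : pred I) (u : I -> 'cV[F]_d) :
  co j k (\sum_(i <- r | Q i) u i) = \sum_(i <- r | Q i) co j k (u i).
Proof. by elim/big_rec2: _ => [|i y1 y2 _ <-]; rewrite ?str_co0 ?str_coD. Qed.

Lemma string_mapE g j k : (k < dd j)%N -> string_map g *m v j k = g j k.
Proof.
have all (y : 'cV_d) : string_map g *m y = \sum_i \sum_(l < dd i) co i l y *: g i l.
  have Dy : y = \sum_c y c 0 *: delta_mx c 0.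
    by rewrite {1}[y]matrix_sum_delta; apply: eq_bigr => c _; rewrite big_ord1.
  rewrite {2}Dy; apply/matrixP => r z; rewrite (ord1 z) mxE summxE.
  under eq_bigr do rewrite mxE summxE mulr_suml.
  rewrite exchange_big /=; apply: eq_bigr => i _.
  under eq_bigr do rewrite summxE mulr_suml.
  rewrite exchange_big summxE /=; apply: eq_bigr => l _.
  rewrite mxE str_co_sum mulr_suml; apply: eq_bigr => c _.
  by rewrite str_coZ !mxE mulrAC; ring.
move=> ltk; rewrite all (bigD1 j) //= [X in _ + X]big1 ?addr0 => [|i ij].
  rewrite (bigD1 (Ordinal ltk)) //= [X in _ + X]big1 ?addr0 => [|l lk].
    by rewrite (str_co S) // !eqxx scale1r.
  rewrite (str_co S) // eqxx (_ : (l == k :> nat) = false) ?scale0r //.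
  by apply/eqP => lk'; case/eqP: lk; apply: val_inj.
by rewrite big1 // => l _; rewrite (str_co S) // (negPf ij) scale0r.
Qed.

End Strings.

Lemma span3P (F : fieldType) (V : vectType F) (a b c y : V) :
  reflect (exists t, y = t.1.1 *: a + t.1.2 *: b + t.2 *: c)
    (y \in <<[:: a; b; c]>>%VS).
Proof.
apply: (iffP idP) => [|[t ->]]; last first.
  by rewrite !rpredD ?rpredZ // memv_span // !inE eqxx ?orbT.
rewrite !span_cons span_nil addv0 => /memv_addP[a' /vlineP[ta ->]].
case=> _ /memv_addP[b' /vlineP[tb ->] [c' /vlineP[tc ->] ->]] ->.
by exists (ta, tb, tc); rewrite addrA.
Qed.

Lemma in_triple_centralizer (F : fieldType) (m n : nat) (e x f A : 'M[F]_(m + n))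
    (L : {vspace 'M[F]_(m + n)}) :
  odd_part e = 0 -> odd_part x = 0 -> odd_part f = 0 ->
  reflect [/\ A \in L, A *m e = e *m A, A *m x = x *m A & A *m f = f *m A]
    (A \in centralizer L <<[:: e; x; f]>>%VS).
Proof.
move=> oe ox of'; apply: (iffP (mem_centralizer _ _ _)).
  case=> AL c; split=> //; apply/eqP; rewrite -subr_eq0 -sbracket_evenr //;
    by rewrite c // memv_span // !inE eqxx ?orbT.
case=> AL ce cx cf; split=> // _ /span3P[t ->].
have -> : sbracket A (t.1.1 *: e + t.1.2 *: x + t.2 *: f) = 
    t.1.1 *: sbracket A e + t.1.2 *: sbracket A x + t.2 *: sbracket A f.
  by rewrite !sbracketDr !sbracketZr.
by rewrite !sbracket_evenr // ce cx cf !subrr !scaler0 !addr0.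
Qed.

Section Coordinates.
Variables (F : numFieldType) (d N : nat) (e x f : 'M[F]_d).
Variables (dd : 'I_N -> nat) (v : 'I_N -> nat -> 'cV[F]_d).
Variable (co : 'I_N -> nat -> 'cV[F]_d -> F).
Hypothesis S : strings e x f dd v co.

Lemma str_functional_ext (g h : 'cV[F]_d -> F) :
  (forall a y z, g (a *: y + z) = a * g y + g z) ->
  (forall a y z, h (a *: y + z) = a * h y + h z) ->
  (forall j k, (k < dd j)%N -> g (v j k) = h (v j k)) -> g =1 h.
Proof.
move=> lg lh gh y.
have g0 : g 0 = 0 by have := lg (-1) 0 0; rewrite scaler0 addr0 mulN1r addNr.
have h0 : h 0 = 0 by have := lh (-1) 0 0; rewrite scaler0 addr0 mulN1r addNr.
rewrite (str_sum S y).
elim/big_rec: _ => [|j z _ IH]; first by rewrite g0.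
have gD a b : g (a + b) = g a + g b by have := lg 1 a b; rewrite scale1r mul1r.
have hD a b : h (a + b) = h a + h b by have := lh 1 a b; rewrite scale1r mul1r.
rewrite gD hD IH; congr (_ + _).
elim/big_rec: _ => [|k z' _ IH']; first by rewrite g0.
by rewrite lg lh IH' gh.
Qed.

Lemma co_x j k y : (k < dd j)%N ->
  co j k (x *m y) = (k%:R - ((dd j)%:R - 1) / 2) * co j k y.
Proof.
move=> ltk; move: y; apply: str_functional_ext.
- by move=> a y z; rewrite mulmxDr -scalemxAr (str_lin S).
- by move=> a y z; rewrite (str_lin S) mulrDr; ring.
move=> i l ltl; rewrite (str_x S) (str_coZ S) (str_co S) //.
by case: eqP => [->|]; case: eqP => [->|]; rewrite /= ?mulr0 ?mulr0n ?mulr0.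
Qed.

Lemma co_e j k y : (k.+1 < dd j)%N -> co j k.+1 (e *m y) = co j k y.
Proof.
move=> ltk; move: y; apply: str_functional_ext.
- by move=> a y z; rewrite mulmxDr -scalemxAr (str_lin S).
- by move=> a y z; rewrite (str_lin S).
move=> i l ltl; rewrite (str_e S) (str_co S _ _ ltl).
have [lt|le] := ltnP l.+1 (dd i); first by rewrite (str_co S).
rewrite (str_0 S) // (str_co0 S).
case: eqP => [eji|//]; case: eqP => // ekl.
by move: ltk le; rewrite eji ekl ltnNge => /negPf->.
Qed.

Lemma co_f j k y : (k.+1 < dd j)%N ->
  co j k (f *m y) = (k.+1%:R * ((dd j)%:R - k.+1%:R) / 2) * co j k.+1 y.
Proof.
move=> ltk; move: y; apply: str_functional_ext.
- by move=> a y z; rewrite mulmxDr -scalemxAr (str_lin S).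
- by move=> a y z; rewrite (str_lin S) mulrDr; ring.
move=> i [|l] ltl.
  by rewrite (str_f0 S) (str_co0 S) (str_co S) // andbF mulr0.
rewrite (str_f S) (str_coZ S) !(str_co S) ?(ltnW ltl) // eqSS.
by case: eqP => [->|]; case: eqP => [->|]; rewrite /= ?mulr0 ?mulr0n ?mulr0.
Qed.

Lemma co_iter_e j k r y : (k + r < dd j)%N ->
  co j (k + r) (iter r (mulmx e) y) = co j k y.
Proof.
elim: r => [|r IH]; first by rewrite addn0.
by rewrite addnS => lt; rewrite iterS co_e // IH // ltnW.
Qed.

End Coordinates.

Lemma weight_eq (F : numFieldType) (a b c d : nat) :
  a%:R - (b%:R - 1) / 2 = c%:R - (d%:R - 1) / 2 :> F -> (2 * a + d = 2 * c + b)%N.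
Proof.
move=> E; apply/eqP; rewrite -(eqr_nat F) -subr_eq0 !(natrM, natrD).
have -> : 2%:R * a%:R + d%:R - (2%:R * c%:R + b%:R) =
    2 * ((a%:R - (b%:R - 1) / 2) - (c%:R - (d%:R - 1) / 2)) :> F by field.
by rewrite E subrr mulr0.
Qed.

Section Gram.
Variables (F : numFieldType) (m n N : nat) (e x f : 'M[F]_(m + n)).
Variables (dd : 'I_N -> nat) (p : 'I_N -> bool).
Variable (v : 'I_N -> nat -> 'cV[F]_(m + n)).
Variable (co : 'I_N -> nat -> 'cV[F]_(m + n) -> F).
Hypothesis S : osp_strings e x f dd p v co.
Local Notation bf := (@bform F m n).
Let T := os_str S.

(** The form of the multiplicity spaces: the vectors of lowest weight of strings
    of a common length are paired with the vectors of highest weight. *)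
Definition gram : 'M[F]_N := \matrix_(i, j) bf (v i 0%N) (v j (dd j).-1).

(** Each step moves one e, which is skew for the form, across it. *)
Lemma bform_shift i k j l : bf (v i k) (v j l) = (-1) ^+ k * bf (v i 0%N) (v j (k + l)%N).
Proof.
elim: k l => [|k IH] l; first by rewrite mul1r.
rewrite -(str_e T) (bform_even _ _ (os_e S) (os_eev S)) (str_e T) IH.
by rewrite addnS exprS mulN1r mulNr.
Qed.

(** Since x is skew for the form, only opposite weights pair nontrivially. *)
Lemma bform_weight i k j l : bf (v i k) (v j l) != 0 ->
  (2 * (k + l) + 2 = dd i + dd j)%N.
Proof.
move=> b0; have := bform_even (v i k) (v j l) (os_x S) (os_xev S).
rewrite !(str_x T) bformZl bformZr -[RHS]mulNr => /(mulIf b0) E.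
apply/eqP; rewrite -(eqr_nat F) -subr_eq0 !(natrM, natrD).
have -> : 2%:R * (k%:R + l%:R) + 2%:R - ((dd i)%:R + (dd j)%:R) =
    2 * ((k%:R - ((dd i)%:R - 1) / 2) - - (l%:R - ((dd j)%:R - 1) / 2)) :> F by field.
by rewrite E subrr mulr0.
Qed.

Definition parity_sign (j : 'I_N) : F := (-1) ^+ p j.
Definition length_sign (j : 'I_N) : F := (-1) ^+ (dd j).-1.

Lemma bform_swap i k j l : bf (v j l) (v i k) = parity_sign i * bf (v i k) (v j l).
Proof. by rewrite bformC (os_par S) bformZl. Qed.

Lemma bform_parity i k j l : p i != p j -> bf (v i k) (v j l) = 0.
Proof.
move=> pij; have := bform_swap j l i k; rewrite [X in _ = _ * X]bform_swap mulrA /parity_sign -signr_addb.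
rewrite (_ : p j (+) p i = true); last by case: (p i) (p j) pij => -[].
rewrite expr1 mulN1r => /eqP; rewrite -subr_eq0 opprK -mulr2n.
by rewrite -mulr_natr mulf_eq0 pnatr_eq0 orbF => /eqP.
Qed.

(** The whole form is determined by the matrix [gram]: weights match only if
    k + l = d - 1 for strings of a common length d, and between strings of different lengths
    shifting to the lowest weight vector of the longer one leaves the other
    string. *)
Lemma bform_strings i k j l : bf (v i k) (v j l) =
  if (dd i == dd j) && (k + l == (dd j).-1)%N then (-1) ^+ k * gram i j else 0.
Proof.
case: ifP => [/andP[_ /eqP kl]|nkl]; first by rewrite mxE bform_shift kl.
apply/eqP; apply: contraFT nkl => b0; have wt := bform_weight b0.
have di := str_gt0 T i; have dj := str_gt0 T j.
have [lt|lt|eqd] := ltngtP (dd i) (dd j); last by apply/eqP; lia.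
- case/eqP: b0; rewrite bform_swap bform_shift (str_0 T (j := i)) ?bform0r ?mulr0 //; lia.
- case/eqP: b0; rewrite bform_shift (str_0 T (j := j)) ?bform0r ?mulr0 //; lia.
Qed.

Lemma gram_length i j : dd i != dd j -> gram i j = 0.
Proof.
by move=> dij; rewrite mxE bform_strings (negPf dij).
Qed.

Lemma gram_parity i j : p i != p j -> gram i j = 0.
Proof. by move=> pij; rewrite mxE bform_parity. Qed.

(** The form of a multiplicity space is symmetric or alternating on each parity:
    one sign comes from the form of V, the other from V(d - 1). *)
Lemma gramC i j : gram j i = parity_sign i * length_sign i * gram i j.
Proof.
have [dij|dij] := eqVneq (dd i) (dd j); last first.
  by rewrite !gram_length ?mulr0 // eq_sym.
rewrite [LHS]mxE bform_swap bform_strings dij eqxx addn0 eqxx mulrA.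
by rewrite /length_sign dij.
Qed.

(** A vector in the kernel would give a combination of vectors of highest weight
    orthogonal to all strings. *)
Lemma gram_unit : gram \in unitmx.
Proof.
rewrite -unitmx_tr -row_free_unit -kermx_eq0; apply/rowV0P => y /sub_kermxP.
move=> yG; pose w := \sum_j y 0 j *: v j (dd j).-1.
have w0 : w = 0.
  have bw i k : bf (v i k) w = 0.
    rewrite /w bform_sumr; have [->|k0] := posnP k.
      have E : (y *m gram^T) 0 i = 0 by rewrite yG mxE.
      rewrite -[RHS]E [RHS]mxE.
      by apply: eq_bigr => j _; rewrite bformZr !mxE.
    apply: big1 => j _; rewrite bformZr bform_strings.
    have -> : (k + (dd j).-1 == (dd j).-1)%N = false by lia.
    by rewrite andbF mulr0.
  have : osp_form F m n *m w = 0.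
    apply: trmx_inj; apply: (str_mulmx_ext T) => j k ltk; rewrite trmx0 mul0mx.
    have -> : (osp_form F m n *m w)^T *m v j k =
        ((v j k)^T *m osp_form F m n *m w)^T by rewrite !trmx_mul trmxK mulmxA.
    by apply/matrixP => a b; rewrite !ord1 [LHS]mxE -/(bf _ _) bw mxE.
  by move/(congr1 (mulmx (invmx (osp_form F m n)))); rewrite mulKmx ?form_unit ?(os_n S) // mulmx0.
apply/rowP => j; rewrite mxE.
have := congr1 (co j (dd j).-1) w0; rewrite (str_co0 T) /w (str_co_sum T).
have lt i : ((dd i).-1 < dd i)%N by have := str_gt0 T i; lia.
rewrite (bigD1 j) //= big1 => [|i ij]; last first.
  by rewrite (str_coZ T) (str_co T) // eq_sym (negPf ij) mulr0.
by rewrite (str_coZ T) (str_co T) // !eqxx mulr1 addr0.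
Qed.

End Gram.

(** * Operators of the multiplicity spaces and the centralizer *)

Section Commutant.
Variables (F : numFieldType) (m n N : nat) (e x f : 'M[F]_(m + n)).
Variables (dd : 'I_N -> nat) (p : 'I_N -> bool).
Variable (v : 'I_N -> nat -> 'cV[F]_(m + n)).
Variable (co : 'I_N -> nat -> 'cV[F]_(m + n) -> F).
Hypothesis S : osp_strings e x f dd p v co.
Local Notation bf := (@bform F m n).
Local Notation P := (parity_mx F m n).
Local Notation G := (gram dd v).
Local Notation sp := (parity_sign F p).
Local Notation sd := (length_sign F dd).
Local Notation gnat := (centralizer (osp F m n) <<[:: e; x; f]>>).
Let T := os_str S.

Definition blockwise (a : 'M[F]_N) := forall i j, dd i != dd j -> a i j = 0.

(** The operator of V induced by an operator [a] of the multiplicity spaces. *)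
Definition blockop (a : 'M[F]_N) : 'M[F]_(m + n) :=
  string_map dd co (fun j k => \sum_i a i j *: v i k).

Lemma blockopE a j k : blockwise a -> blockop a *m v j k = \sum_i a i j *: v i k.
Proof.
move=> ba; have [lt|le] := ltnP k (dd j); first by rewrite /blockop (string_mapE T).
rewrite (str_0 T) // mulmx0 big1 // => i _.
have [dij|dij] := eqVneq (dd i) (dd j); last by rewrite ba ?scale0r.
by rewrite (str_0 T) ?scaler0 ?dij.
Qed.

Lemma blockop_eq0 a : blockwise a -> blockop a = 0 -> a = 0.
Proof.
move=> ba a0; apply/matrixP => i j; rewrite mxE.
have := congr1 (co i 0%N) (blockopE j 0 ba); rewrite a0 mul0mx (str_co0 T).
rewrite (str_co_sum T) (bigD1 i) //= big1 => [|l li].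
  by rewrite (str_coZ T) (str_co T) ?(str_gt0 T) // eqxx mulr1 addr0.
by rewrite (str_coZ T) (str_co T) ?(str_gt0 T) // eq_sym (negPf li) mulr0.
Qed.

Lemma blockop_mul a b : blockwise a -> blockwise b ->
  blockop a *m blockop b = blockop (a *m b).
Proof.
move=> ba bb; have bab : blockwise (a *m b).
  move=> i j dij; rewrite mxE big1 // => l _.
  have [dil|dil] := eqVneq (dd i) (dd l); last by rewrite ba ?mul0r.
  by rewrite bb ?mulr0 // -dil.
apply: (str_mulmx_ext T) => j k _; rewrite -mulmxA !blockopE // mulmx_sumr.
under eq_bigr => l _ do rewrite -scalemxAr blockopE // scaler_sumr.
rewrite exchange_big /=; apply: eq_bigr => i _; rewrite mxE scaler_suml.
by apply: eq_bigr => l _; rewrite scalerA mulrC.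
Qed.

(** It commutes with any operator that acts on a string in a way that depends
    only on its length. *)
Lemma blockop_comm a y : blockwise a ->
  (exists c : nat -> nat -> F, exists s : nat -> nat,
     forall j k, y *m v j k = c (dd j) k *: v j (s k)) ->
  blockop a *m y = y *m blockop a.
Proof.
move=> ba [c [s yv]]; apply: (str_mulmx_ext T) => j k _.
rewrite -!mulmxA yv blockopE // mulmx_sumr -scalemxAr blockopE // scaler_sumr.
apply: eq_bigr => i _; rewrite -scalemxAr yv !scalerA mulrC.
have [->//|dij] := eqVneq (dd i) (dd j).
by rewrite ba // !mul0r !scale0r.
Qed.

Lemma blockop_e a : blockwise a -> blockop a *m e = e *m blockop a.
Proof.
move=> ba; apply: blockop_comm => //; exists (fun _ _ => 1), (fun k => k.+1) => j k.
by rewrite (str_e T) scale1r.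
Qed.

Lemma blockop_x a : blockwise a -> blockop a *m x = x *m blockop a.
Proof.
move=> ba; apply: blockop_comm => //.
by exists (fun d k => k%:R - (d%:R - 1) / 2), id => j k; rewrite (str_x T).
Qed.

Lemma blockop_f a : blockwise a -> blockop a *m f = f *m blockop a.
Proof.
move=> ba; apply: blockop_comm => //.
exists (fun d k => k%:R * (d%:R - k%:R) / 2), predn => j [|k].
  by rewrite (str_f0 T) !mul0r scale0r.
by rewrite (str_f T).
Qed.

Definition parity_type t (K : 'M[F]_N) :=
  forall i j, K i j != 0 -> dd i = dd j /\ p i (+) p j = t.

(** With the sign rule of the Gram matrix, this says that K G is skew for the
    form of the multiplicity spaces. *)
Definition super_skew (t : bool) (K : 'M[F]_N) :=
  forall i j, K i j = - (sp i * sd i * sp i ^+ t) * K j i.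

Lemma gram_type : parity_type false G.
Proof.
move=> i j Gij; split; apply/eqP; move: Gij; apply: contraTT => d.
  by rewrite (gram_length S) ?eqxx.
by rewrite (gram_parity S) ?eqxx //; case: (p i) (p j) d => -[].
Qed.

Lemma parity_type_mul t t' a b : parity_type t a -> parity_type t' b ->
  parity_type (t (+) t') (a *m b).
Proof.
move=> ta tb i j; rewrite mxE => nz.
have [l] : exists l, a i l * b l j != 0.
  apply/existsP; apply: contraR nz; rewrite negb_exists => /forallP z.
  by rewrite big1 // => l _; apply/eqP; rewrite -[_ == _]negbK.
rewrite mulf_eq0 negb_or => /andP[/ta[-> <-] /tb[-> <-]]; split=> //.
by rewrite addbA addbK.
Qed.

Lemma parity_type_blockwise t a : parity_type t a -> blockwise a.
Proof. by move=> ta i j; apply: contraNeq => /ta[->]. Qed.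

Lemma blockop_parity t a : parity_type t a ->
  if t then even_part (blockop a) = 0 else odd_part (blockop a) = 0.
Proof.
move=> ta; have ba := parity_type_blockwise ta.
have E : P *m blockop a = (-1) ^+ t *: (blockop a *m P).
  apply: (str_mulmx_ext T) => j k _; rewrite -scalemxAl -!mulmxA (os_par S).
  rewrite -scalemxAr blockopE // mulmx_sumr !scaler_sumr; apply: eq_bigr => i _.
  rewrite -scalemxAr (os_par S) !scalerA.
  have [->|/ta[_ <-]] := eqVneq (a i j) 0; first by rewrite !(mul0r, mulr0).
  by rewrite signr_addb -[X in _ = X * _ *: _]mulrA -expr2 sqrr_sign mulr1 mulrC.
by case: t E {ta} => E; apply/eqP; [apply/odd_parityP|apply/even_parityP];
  rewrite E ?scaleN1r ?scale1r.
Qed.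

(** The defining condition of osp, checked on the vectors of the strings. *)
Lemma osp_homogeneous t A : 
  (if t then even_part A = 0 else odd_part A = 0) ->
  (forall j k r l, bf (A *m v j k) (v r l) + sp j ^+ t * bf (v j k) (A *m v r l) = 0) ->
  A \in osp F m n.
Proof.
move=> pA bA; suff E : A^T *m osp_form F m n + (if t then P else 1%:M) *m osp_form F m n *m A = 0.
  apply/ospP; case: t pA {bA} E => pA; rewrite pA ?mul1mx => E.
    by rewrite (odd_id pA) E trmx0 mul0mx mulmx0 addr0.
  by rewrite (even_id pA) E trmx0 mul0mx mulmx0 addr0.
apply: (str_form_ext T) => j k r l _ _; rewrite mulmxDr mulmxDl.
have := bA j k r l; rewrite /bform.
have -> : (A *m v j k)^T *m osp_form F m n *m v r l =
          (v j k)^T *m (A^T *m osp_form F m n) *m v r l.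
  by rewrite trmx_mul !mulmxA.
have -> : (v j k)^T *m ((if t then P else 1%:M) *m osp_form F m n *m A) *m v r l =
   sp j ^+ t *: ((v j k)^T *m osp_form F m n *m (A *m v r l)).
  rewrite -(mulmxA _ (osp_form F m n)) !mulmxA; case: t {bA pA}.
    by rewrite -[P]parity_tr -trmx_mul (os_par S) linearZ /= -!scalemxAl expr1.
  by rewrite mulmx1 expr0 scale1r.
by move=> E; apply/matrixP => a b; rewrite !ord1 [LHS]mxE [X in _ + X]mxE [RHS]mxE.
Qed.

(** Both terms of the defining condition of osp reduce to matrix products of K
    and the Gram matrix, which cancel by the skewness of K. *)
Lemma gnat_blockop t K : parity_type t K -> super_skew t K ->
  blockop (K *m G) \in gnat.
Proof.
move=> tK sK; have tKG : parity_type t (K *m G).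
  by rewrite -[t]addbF; apply: parity_type_mul tK gram_type.
have ba := parity_type_blockwise tKG.
apply/in_triple_centralizer; rewrite ?(os_eev S) ?(os_xev S) ?(os_fev S) //.
split; rewrite ?blockop_e ?blockop_x ?blockop_f //.
apply: (osp_homogeneous (blockop_parity tKG)) => j k r l.
rewrite !blockopE // bform_suml bform_sumr.
under eq_bigr do rewrite bformZl (bform_strings S).
under [X in _ + _ * X]eq_bigr do rewrite bformZr (bform_strings S).
have [kl|kl] := eqVneq (k + l)%N (dd r).-1; last first.
  rewrite big1 ?[X in _ + _ * X]big1 ?mulr0 ?addr0 // => i _.
    have [dir|dir] := eqVneq (dd i) (dd r); last by rewrite ba ?mul0r.
    by rewrite dir (negPf kl) andbF mulr0.
  by rewrite andbF mulr0.
have -> : \sum_i (K *m G) i j * (if (dd i == dd r) && true then (-1) ^+ k * G i r else 0)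
    = (-1) ^+ k * ((K *m G)^T *m G) j r.
  rewrite mxE mulr_sumr; apply: eq_bigr => i _; rewrite [_^T _ _]mxE andbT.
  case: eqP => [_|/eqP dir]; first by rewrite mulrCA.
  by rewrite (gram_length S) // !mulr0.
have -> : \sum_i (K *m G) i r *
     (if (dd j == dd i) && (k + l == (dd i).-1)%N then (-1) ^+ k * G j i else 0)
    = (-1) ^+ k * (G *m (K *m G)) j r.
  rewrite mxE mulr_sumr; apply: eq_bigr => i _.
  have [dir|dir] := eqVneq (dd i) (dd r); last by rewrite ba // mul0r !mulr0.
  rewrite dir kl eqxx andbT -dir; case: eqP => [_|/eqP dji]; first by rewrite mulrC -mulrA.
  by rewrite (gram_length S) // !(mulr0, mul0r).
rewrite mulrCA -mulrDr; apply/eqP; rewrite mulf_eq0; apply/orP; right.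
have -> : ((K *m G)^T *m G) j r = sp j * sd j * (G *m K^T *m G) j r.
  rewrite trmx_mul -!mulmxA [LHS]mxE [in RHS]mxE mulr_sumr.
  apply: eq_bigr => i _; rewrite [in LHS]mxE (gramC S) -mulrA.
  by congr (_ * (_ * _)).
rewrite mulmxA ![(G *m _ *m G) j r]mxE !mulr_sumr -big_split /=.
apply/eqP; apply: big1 => i _; rewrite !mulrA -mulrDl.
rewrite [(G *m _) j i]mxE [(G *m K) j i]mxE !mulr_sumr -big_split /=.
rewrite big1 ?mul0r // => c _.
have [->|/gram_type[djc pjc]] := eqVneq (G j c) 0; first by rewrite !(mul0r, mulr0) addr0.
have -> : sp j = sp c by rewrite /parity_sign; case: (p j) (p c) pjc => -[].
rewrite [K c i]sK [K^T _ _]mxE.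
have -> : sd j = sd c by rewrite /length_sign djc.
have : sp c ^+ t * sp c ^+ t = 1 by rewrite -expr2 -exprM mulnC exprM /parity_sign sqrr_sign expr1n.
move: (sp c ^+ t) (sd c) => q d qq.
transitivity ((1 - q * q) * (sp c * d * G j c * K i c)); first by ring.
by rewrite qq subrr mul0r.
Qed.

End Commutant.

(** * Highest vectors and their symbols *)

(** The vectors that play the role of the highest weight vector of C (x) adj for
    the bracket, [K] being the subalgebra that acts trivially. *)
Definition highest (F : fieldType) (m n : nat) (e x : 'M[F]_(m + n))
    (K L : {vspace 'M[F]_(m + n)}) (h : 'M[F]_(m + n)) : Prop :=
  [/\ h \in L, forall a, a \in K -> sbracket a h = 0,
      sbracket x h = h & sbracket e h = 0].

Section HighestWeight.
Variables (F : numFieldType) (m n N : nat) (e x f : 'M[F]_(m + n)).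
Variables (dd : 'I_N -> nat) (p : 'I_N -> bool).
Variable (v : 'I_N -> nat -> 'cV[F]_(m + n)).
Variable (co : 'I_N -> nat -> 'cV[F]_(m + n) -> F).
Hypothesis S : osp_strings e x f dd p v co.
Local Notation bf := (@bform F m n).
Local Notation P := (parity_mx F m n).
Local Notation G := (gram dd v).
Local Notation sp := (parity_sign F p).
Local Notation g := (osp F m n).
Local Notation gnat := (centralizer g <<[:: e; x; f]>>).
Let T := os_str S.

(** An element of the centralizer preserves the lowest weight vectors of weight
    -(d - 1) / 2, that is, the multiplicity space of length d. *)
Lemma gnat_lowest a j k : a \in gnat ->
  a *m v j k = \sum_(i | dd i == dd j) co i 0%N (a *m v j 0%N) *: v i k.
Proof.
case/in_triple_centralizer; rewrite ?(os_eev S) ?(os_xev S) ?(os_fev S) //.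
move=> ag ae ax af.
have a0 : a *m v j 0%N = \sum_(i | dd i == dd j) co i 0%N (a *m v j 0%N) *: v i 0%N.
  set y := a *m v j 0%N.
  have fy : f *m y = 0 by rewrite mulmxA -af -mulmxA (str_f0 T) mulmx0.
  have xy : x *m y = (0%:R - ((dd j)%:R - 1) / 2) *: y.
    by rewrite mulmxA -ax -mulmxA (str_x T) scalemxAr.
  have cy i l : (l < dd i)%N -> co i l y != 0 -> l = 0%N /\ dd i = dd j.
    move=> lt ny; have l0 : l = 0%N.
      case: l lt ny => // l lt; have := co_f T y lt; rewrite fy (str_co0 T).
      move/esym/eqP; rewrite mulf_eq0 => /orP[|/eqP->]; last by rewrite eqxx.
      rewrite !mulf_eq0 invr_eq0 !pnatr_eq0 orbF /= subr_eq0 eqr_nat.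
      by rewrite (gtn_eqF lt).
    split=> //; have := co_x T y lt; rewrite xy (str_coZ T) => /(mulIf ny).
    by move/weight_eq; rewrite l0; lia.
  rewrite {1}(str_sum T y) [RHS]big_mkcond; apply: eq_bigr => i _.
  have d0 := str_gt0 T i; rewrite (bigD1 (Ordinal d0)) //= big1 ?addr0 => [|l l0].
    case: ifP => // dij; have [->|/(cy _ _ d0)[_ /eqP]] := eqVneq (co i 0%N y) 0.
      by rewrite scale0r.
    by rewrite dij.
  have [->|/(cy _ _ (ltn_ord l))[l00 _]] := eqVneq (co i l y) 0; first by rewrite scale0r.
  by case/eqP: l0; apply: val_inj.
elim: k => [|k IH]; first exact: a0.
rewrite -(str_e T) mulmxA ae -mulmxA IH mulmx_sumr; apply: eq_bigr => i _.
by rewrite -scalemxAr (str_e T).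
Qed.

(** A highest weight vector of weight one maps the string of length [dd j] to
    those whose length differs by at most two, shifting by [shift i j]. *)
Definition linked (i j : 'I_N) :=
  [|| (dd i == dd j) && (1 < dd i)%N, dd i == (dd j + 2)%N | dd j == (dd i + 2)%N].
Definition shift (i j : 'I_N) := ((dd i + 2 - dd j) %/ 2)%N.

Lemma linked_shift i j : linked i j ->
  [/\ (shift i j < dd i)%N, (2 * shift i j + dd j = dd i + 2)%N &
      (dd i <= shift i j + dd j)%N].
Proof.
move=> lk; have := str_gt0 T i; have := str_gt0 T j.
by case/or3P: lk => [/andP[/eqP]|/eqP|/eqP]; rewrite /shift => H; split; lia.
Qed.

Lemma shift_linked i j k : (k < dd i)%N -> (2 * k + dd j = dd i + 2)%N ->
  (dd i <= k + dd j)%N -> linked i j /\ k = shift i j.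
Proof. by rewrite /linked /shift => *; split; lia. Qed.

Lemma linked_eq i i' j j' : dd i = dd i' -> dd j = dd j' -> linked i j = linked i' j'.
Proof. by rewrite /linked => -> ->. Qed.

Lemma shift_eq i i' j j' : dd i = dd i' -> dd j = dd j' -> shift i j = shift i' j'.
Proof. by rewrite /shift => -> ->. Qed.

(** The matrix of h between multiplicity spaces: the image of the lowest weight
    vector of the string [j] has a component only at the place [shift i j] of
    each linked string [i]. *)
Definition symbol (h : 'M[F]_(m + n)) : 'M[F]_N :=
  \matrix_(i, j) if linked i j then co i (shift i j) (h *m v j 0%N) else 0.

Lemma symbol_linked h i j : symbol h i j != 0 -> linked i j.
Proof. by rewrite mxE; case: ifP; rewrite ?eqxx. Qed.

Section Vector.
Variable h : 'M[F]_(m + n).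
Hypotheses (hg : h \in g) (ha : forall a, a \in gnat -> sbracket a h = 0).
Hypotheses (xh : x *m h - h *m x = h) (eh : e *m h = h *m e).
Local Notation Z := (symbol h).

(** The image of a lowest weight vector has one weight more, and is killed by the
    power of e that kills this vector, which leaves one place in each linked
    string; commutation with e propagates this along the string. *)
Lemma highest_string j k : h *m v j k = \sum_i Z i j *: v i (k + shift i j)%N.
Proof.
have h0 : h *m v j 0%N = \sum_i Z i j *: v i (shift i j).
  set y := h *m v j 0%N.
  have xy : x *m y = (1%:R - ((dd j)%:R - 1) / 2) *: y.
    have -> : x *m y = h *m (x *m v j 0%N) + y.
      by rewrite /y -{3}xh mulmxBl !mulmxA [RHS]addrC subrK.
    rewrite (str_x T) -scalemxAr -/y -{2}[y]scale1r -scalerDl.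
    by congr (_ *: _); rewrite add0r [LHS]addrC.
  have ey r : iter r (mulmx e) y = h *m v j r.
    elim: r => [//|r IH]; by rewrite iterS IH mulmxA eh -mulmxA (str_e T).
  have cy i k' : (k' < dd i)%N -> co i k' y != 0 -> linked i j /\ k' = shift i j.
    move=> lt ny; apply: shift_linked => //.
      have := co_x T y lt; rewrite xy (str_coZ T) => /(mulIf ny)/weight_eq; lia.
    rewrite leqNgt; apply/negP => lt'; case/eqP: ny; rewrite -(co_iter_e T y lt').
    by rewrite ey (str_0 T) // mulmx0 (str_co0 T).
  rewrite {1}(str_sum T y); apply: eq_bigr => i _; rewrite mxE.
  case: ifP => [lk|nlk].
    have [lt _ _] := linked_shift lk.
    rewrite (bigD1 (Ordinal lt)) //= big1 ?addr0 // => l nl.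
    have [->|/(cy _ _ (ltn_ord l))[_ le]] := eqVneq (co i l y) 0; first by rewrite scale0r.
    by case/eqP: nl; apply: val_inj.
  rewrite scale0r big1 // => l _.
  have [->|/(cy _ _ (ltn_ord l))[]] := eqVneq (co i l y) 0; first by rewrite scale0r.
  by rewrite nlk.
elim: k => [|k IH]; first exact: h0.
rewrite -(str_e T) mulmxA -eh -mulmxA IH mulmx_sumr; apply: eq_bigr => i _.
by rewrite -scalemxAr (str_e T).
Qed.

Lemma symbol_eq0 : Z = 0 -> h = 0.
Proof.
move=> Z0; apply: (str_mulmx_ext T) => j k _; rewrite highest_string Z0 mul0mx.
by apply: big1 => i _; rewrite mxE scale0r.
Qed.

(** Conjugation by the parity of the strings, which appears when odd operators
    of the centralizer are used. *)
Definition twist t (M : 'M[F]_N) : 'M[F]_N :=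
  \matrix_(i, j) ((sp i * sp j) ^+ t * M i j).

(** Commutation of h with the operator given by K G, read on lowest weight
    vectors. *)
Lemma symbol_commute t K : parity_type dd p t K -> super_skew dd p t K ->
  K *m G *m Z = twist t Z *m (K *m G).
Proof.
move=> tK sK; have tKG : parity_type dd p t (K *m G).
  by rewrite -[t]addbF; apply: parity_type_mul tK (gram_type S).
have ba := parity_type_blockwise tKG.
have pA := blockop_parity S tKG.
set A := blockop dd v co (K *m G); set a := K *m G in tKG ba pA A *.
(* For odd A the super bracket makes A commute with h up to conjugation of h by
   the parity matrix. *)
have c0 : A *m h = (if t then P *m h *m P else h) *m A.
  have /ha := gnat_blockop S tK sK; rewrite -/a -/A.
  case: t pA {tKG sK tK} => pA.
    rewrite /sbracket (odd_id pA) => /eqP; rewrite -addrA addr_eq0 => /eqP ->.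
    have -> : P *m h *m P = even_part h - odd_part h.
      rewrite -{1}[h]even_addodd mulmxDr parity_even parity_odd mulmxBl.
      by rewrite -!mulmxA parity_sqr !mulmx1.
    rewrite -{1}[h]even_addodd mulmxDl mulmxBl mulr2n opprD opprK opprD !addrA.
    by rewrite addrK.
  by rewrite sbracket_evenl // => /eqP; rewrite subr_eq0 => /eqP.
have PhP i k : (if t then P *m h *m P else h) *m v i k =
    \sum_l twist t Z l i *: v l (k + shift l i)%N.
  case: t {tKG sK tK pA c0}; last first.
    by rewrite highest_string; apply: eq_bigr => l _; rewrite [twist _ _ _ _]mxE mul1r.
  rewrite -!mulmxA (os_par S) -!scalemxAr highest_string mulmx_sumr scaler_sumr.
  apply: eq_bigr => l _; rewrite -scalemxAr (os_par S) !scalerA; congr (_ *: _).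
  by rewrite [in RHS]mxE expr1 /parity_sign; ring.
set h' := (if t then _ else _) in c0 PhP.
apply/matrixP => l j; have [lk|nlk] := boolP (linked l j); last first.
  rewrite !mxE !big1 // => i _.
    have [dij|dij] := eqVneq (dd i) (dd j); last by rewrite ba ?mulr0.
    have [|/symbol_linked] := eqVneq (Z l i) 0; first by rewrite [twist _ _ _ _]mxE => ->; rewrite mulr0 mul0r.
    by rewrite (linked_eq (erefl _) dij) (negPf nlk).
  have [dij|dij] := eqVneq (dd l) (dd i); last by rewrite ba ?mul0r.
  have [->|/symbol_linked] := eqVneq (Z i j) 0; first by rewrite mulr0.
  by rewrite -(linked_eq dij (erefl _)) (negPf nlk).
have [lt _ _] := linked_shift lk.
(* Extracts the component at the place where the symbol lives. *)
have cE (c : 'I_N -> F) : co l (shift l j) (\sum_i c i *: v i (shift i j)) = c l.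
  rewrite (str_co_sum T) (bigD1 l) //= big1 ?addr0.
    by rewrite (str_coZ T) (str_co T) // !eqxx mulr1.
  move=> i il; rewrite (str_coZ T); have [le|lt'] := leqP (dd i) (shift i j).
    by rewrite (str_0 T) // (str_co0 T) mulr0.
  by rewrite (str_co T) // eq_sym (negPf il) mulr0.
have := congr1 (fun M => co l (shift l j) (M *m v j 0%N)) c0.
rewrite -!mulmxA highest_string (blockopE S) // !mulmx_sumr.
have -> : \sum_i A *m (Z i j *: v i (0 + shift i j)%N) =
    \sum_i (a *m Z) i j *: v i (shift i j).
  under eq_bigr => i _ do rewrite -scalemxAr (blockopE S) // scaler_sumr.
  rewrite exchange_big /=; apply: eq_bigr => i _; rewrite mxE scaler_suml.
  apply: eq_bigr => c _; rewrite scalerA mulrC.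
  have [dic|dic] := eqVneq (dd i) (dd c); last by rewrite ba // !mul0r !scale0r.
  by rewrite (shift_eq dic (erefl _)).
have -> : \sum_i h' *m (a i j *: v i 0%N) =
    \sum_i (twist t Z *m a) i j *: v i (shift i j).
  under eq_bigr => i _ do rewrite -scalemxAr PhP scaler_sumr.
  rewrite exchange_big /=; apply: eq_bigr => i _; rewrite mxE scaler_suml.
  apply: eq_bigr => c _; rewrite scalerA mulrC.
  have [dcj|dcj] := eqVneq (dd c) (dd j); last by rewrite ba // !mulr0 !scale0r.
  by rewrite (shift_eq (erefl _) dcj).
by rewrite !cE /a !mulmxA.
Qed.

(** That h is even and skew for the form, read on symbols; the sign comes from
    the number of steps that h climbs along a string. *)
Lemma symbol_adjoint j r : odd_part h = 0 -> linked r j ->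
  (-1) ^+ shift r j * (Z^T *m G) j r + (G *m Z) j r = 0.
Proof.
move=> oh lk; have dj := str_gt0 T j; have dr := str_gt0 T r.
have lk' : linked j r.
  case/or3P: lk => [/andP[/eqP E lt]|E|E]; apply/or3P; [apply: Or31|apply: Or33|apply: Or32] => //.
  by rewrite -E eqxx lt.
have [s1 s2 s3] := linked_shift lk; have [s1' s2' s3'] := linked_shift lk'.
pose l := ((dd r).-1 - shift r j)%N.
have lE : (shift r j + l = (dd r).-1)%N by rewrite /l; lia.
have lE' : (l + shift j r = (dd j).-1)%N by rewrite /l; lia.
have := bform_even (v j 0%N) (v r l) hg oh; rewrite !highest_string.
rewrite bform_suml bform_sumr => /eqP; rewrite -subr_eq0 opprK => /eqP.
have -> : \sum_i bf (Z i j *: v i (0 + shift i j)%N) (v r l) =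
   (-1) ^+ shift r j * (Z^T *m G) j r.
  rewrite mxE mulr_sumr; apply: eq_bigr => i _; rewrite bformZl (bform_strings S).
  rewrite [Z^T _ _]mxE; have [dir|dir] := eqVneq (dd i) (dd r); last first.
    by rewrite /= (gram_length S) // !mulr0.
  by rewrite (shift_eq dir (erefl _)) add0n lE eqxx /= mulrCA.
have -> // : \sum_i bf (v j 0%N) (Z i r *: v i (l + shift i r)%N) = (G *m Z) j r.
rewrite mxE; apply: eq_bigr => i _; rewrite bformZr (bform_strings S).
have [dij|dij] := eqVneq (dd j) (dd i); last by rewrite /= (gram_length S) // mulr0 mul0r.
by rewrite -(shift_eq dij (erefl _)) add0n lE' dij eqxx /= mul1r mulrC.
Qed.

End Vector.
End HighestWeight.

(** * Schur lemma for symbols *)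

Section Symbols.
Variables (F : numFieldType) (m n N : nat) (e x f : 'M[F]_(m + n)).
Variables (dd : 'I_N -> nat) (p : 'I_N -> bool).
Variable (v : 'I_N -> nat -> 'cV[F]_(m + n)).
Variable (co : 'I_N -> nat -> 'cV[F]_(m + n) -> F).
Hypothesis S : osp_strings e x f dd p v co.
Local Notation P := (parity_mx F m n).
Local Notation G := (gram dd v).
Local Notation sp := (parity_sign F p).
Local Notation sd := (length_sign F dd).
Local Notation g := (osp F m n).
Local Notation gnat := (centralizer g <<[:: e; x; f]>>).
Let T := os_str S.

Lemma parity_sign_sqr i : sp i * sp i = 1.
Proof. by rewrite -expr2 sqrr_sign. Qed.

Lemma length_sign_sqr i : sd i * sd i = 1.
Proof. by rewrite -expr2 sqrr_sign. Qed.

(** [symplectic i]: the parity part of the multiplicity space containing [i]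
    carries an alternating form. *)
Definition symplectic i := p i (+) odd (dd i).-1.

Lemma sign_symplectic i : sp i * sd i = (-1) ^+ symplectic i.
Proof. by rewrite signr_addb signr_odd. Qed.

Lemma two_neq0 : 2 != 0 :> F. Proof. by rewrite pnatr_eq0. Qed.

(** The elementary skew operators, one for each pair of strings of a common
    length; commutation with these is all that is used of the centralizer. *)
Definition skew_delta (k l : 'I_N) : 'M[F]_N :=
  delta_mx k l - (sp k * sd k * sp k ^+ (p k (+) p l)) *: delta_mx l k.

Lemma skew_delta_type k l : dd k = dd l -> parity_type dd p (p k (+) p l) (skew_delta k l).
Proof.
move=> dkl i j; rewrite !mxE.
case: (boolP ((i == k) && (j == l))) => [/andP[/eqP-> /eqP->] //|_].
case: (boolP ((i == l) && (j == k))) => [/andP[/eqP-> /eqP->] //|_].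
  by rewrite addbC.
by rewrite mulr0 subr0 eqxx.
Qed.

Lemma skew_delta_supp k l i j : dd k = dd l -> skew_delta k l i j != 0 ->
  dd i = dd k /\ dd j = dd k.
Proof.
move=> dkl; rewrite !mxE.
case: (boolP ((i == k) && (j == l))) => [/andP[/eqP-> /eqP->] //|_].
case: (boolP ((i == l) && (j == k))) => [/andP[/eqP-> /eqP->] //|_].
by rewrite mulr0 subr0 eqxx.
Qed.

Lemma skew_delta_skew k l : dd k = dd l -> super_skew dd p (p k (+) p l) (skew_delta k l).
Proof.
move=> dkl i j; set t := _ (+) _.
have mu_kl : sp k * sd k * sp k ^+ t = sp l * sd l * sp l ^+ t.
  have -> : sd k = sd l by rewrite /length_sign dkl.
  by rewrite /t /parity_sign; case: (p k) (p l) => -[]; rewrite /= ?expr0 ?expr1; ring.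
have mu_sqr : sp k * sd k * sp k ^+ t * (sp k * sd k * sp k ^+ t) = 1.
  have Sq : sp k ^+ t * sp k ^+ t = 1.
    by rewrite -expr2 -exprM mulnC exprM /parity_sign sqrr_sign expr1n.
  transitivity ((sp k * sp k) * (sd k * sd k) * (sp k ^+ t * sp k ^+ t)); first by ring.
  by rewrite Sq parity_sign_sqr length_sign_sqr !mulr1.
have E i' j' : skew_delta k l i' j' = ((i' == k) && (j' == l))%:R -
    sp k * sd k * sp k ^+ t * ((i' == l) && (j' == k))%:R by rewrite !mxE.
rewrite !{}E [(j == k) && _]andbC [(j == l) && _]andbC.
have [/andP[/eqP-> /eqP->]|_] := boolP ((i == k) && (j == l)).
  by rewrite mulr1 mulrBr !mulNr opprK mu_sqr addrC.
have [/andP[/eqP-> _]|_] := boolP ((i == l) && (j == k)) => /=.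
  by rewrite -mu_kl !mulr0 sub0r subr0 mulr1 mulr1.
by rewrite !mulr0 subrr mulr0.
Qed.

(** The Gram matrix is invertible. *)
Lemma row_cancel (M : 'M[F]_N) i : (forall s, (M *m G) i s = 0) -> forall c, M i c = 0.
Proof.
move=> MG c; have : row i M *m G = 0.
  by apply/rowP => s; rewrite -row_mul mxE MG mxE.
move/(congr1 (mulmx^~ (invmx G))); rewrite mulmxK ?(gram_unit S) // mul0mx.
by move/rowP/(_ c); rewrite !mxE.
Qed.

Lemma col_cancel (z : 'cV[F]_N) : G *m z = 0 -> z = 0.
Proof.
by move/(congr1 (mulmx (invmx G))); rewrite mulKmx ?(gram_unit S) // mulmx0.
Qed.

Lemma blockwise_mul (a b : 'M[F]_N) : blockwise dd a -> blockwise dd b -> blockwise dd (a *m b).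
Proof.
move=> ba bb i j dij; rewrite mxE big1 // => l _.
have [dil|dil] := eqVneq (dd i) (dd l); last by rewrite ba ?mul0r.
by rewrite bb ?mulr0 // -dil.
Qed.

Lemma gram_blockwise : blockwise dd G.
Proof. exact: parity_type_blockwise (gram_type S). Qed.

Section Vector.
Variable h : 'M[F]_(m + n).
Hypotheses (hg : h \in g) (ha : forall a, a \in gnat -> sbracket a h = 0).
Hypotheses (xh : x *m h - h *m x = h) (eh : e *m h = h *m e).
Local Notation Z := (symbol dd v co h).

Let comm k l : dd k = dd l ->
  skew_delta k l *m G *m Z = twist p (p k (+) p l) Z *m skew_delta k l *m G.
Proof.
move=> dkl; rewrite -[RHS]mulmxA.
exact: (symbol_commute S hg ha xh eh (skew_delta_type dkl) (skew_delta_skew dkl)).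
Qed.

Lemma twist0 t (M : 'M[F]_N) i j : (twist p t M i j == 0) = (M i j == 0).
Proof. by rewrite mxE mulf_eq0 expf_eq0 mulf_eq0 !signr_eq0 andbF. Qed.

Lemma skew_deltaE k l i j : skew_delta k l i j = ((i == k) && (j == l))%:R -
    sp k * sd k * sp k ^+ (p k (+) p l) * ((i == l) && (j == k))%:R.
Proof. by rewrite !mxE. Qed.

Lemma skew_delta_diag k : symplectic k -> skew_delta k k = 2 *: delta_mx k k.
Proof.
move=> sk; apply/matrixP => i j; rewrite skew_deltaE !mxE addbb expr0 mulr1.
by rewrite sign_symplectic sk expr1 mulN1r opprK mulr_natl mulr2n.
Qed.

(** If the component of the symbol from M_(dd j) to another multiplicity space is
    nonzero, it is killed by the elementary operators of M_(dd j), which act by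
    zero on the target. So there are none: M_(dd j) is a line with a symmetric
    form. *)
Lemma symbol_col i j : Z i j != 0 -> dd i != dd j ->
  (forall l, dd l = dd j -> l = j) /\ ~~ symplectic j.
Proof.
move=> Zij dij.
have main l : dd j = dd l -> forall c, (twist p (p j (+) p l) Z *m skew_delta j l) i c = 0.
  move=> djl; apply: row_cancel => s; rewrite -comm // mxE big1 // => c _.
  rewrite mxE big1 ?mul0r // => b _.
  have [->|/(skew_delta_supp djl)[dij' _]] := eqVneq (skew_delta j l i b) 0; first by rewrite mul0r.
  by rewrite dij' eqxx in dij.
split.
  move=> l dlj; apply/eqP; apply: contraNT Zij => nlj.
  have := main l (esym dlj) l; rewrite mxE (bigD1 j) //= big1 => [|c nc].
    rewrite skew_deltaE !eqxx (negPf nlj) andbF /= mulr0 subr0 mulr1 addr0 => /eqP.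
    by rewrite twist0.
  by rewrite skew_deltaE (negPf nc) (negPf nlj) andbF /= !(mulr0, subr0).
apply: contraNN Zij => sj; have := main j erefl j.
rewrite skew_delta_diag // mxE (bigD1 j) //= big1 => [|c nc].
  rewrite !mxE !eqxx mulr1 addr0 addbb mul1r => /eqP.
  by rewrite mulf_eq0 (negPf two_neq0) orbF.
by rewrite !mxE (negPf nc) mulr0 mulr0.
Qed.

Lemma block_col_cancel i j :
  (forall l, dd l = dd i -> (G *m Z) l j = 0) -> Z i j = 0.
Proof.
move=> GZ; pose z : 'cV[F]_N := \col_c if dd c == dd i then Z c j else 0.
suff /colP/(_ i) : z = 0 by rewrite [z _ _]mxE eqxx [RHS]mxE.
apply: col_cancel; apply/colP => l; rewrite mxE [RHS]mxE.
have [dli|dli] := eqVneq (dd l) (dd i).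
  rewrite -[RHS](GZ l dli) [RHS]mxE; apply: eq_bigr => c _; rewrite [z _ _]mxE.
  have [->//|/(gram_type S)[dlc _]] := eqVneq (G l c) 0; first by rewrite !mul0r.
  by rewrite -dlc dli eqxx.
apply: big1 => c _; rewrite [z _ _]mxE; case: eqP => [dci|_]; last by rewrite mulr0.
by rewrite gram_blockwise ?mul0r // dci.
Qed.

(** The same as [symbol_col] for the target of the component. *)
Lemma symbol_row i j : Z i j != 0 -> dd i != dd j ->
  (forall l, dd l = dd i -> l = i) /\ ~~ symplectic i.
Proof.
move=> Zij dij.
have main k l : dd k = dd i -> dd l = dd i -> (skew_delta k l *m (G *m Z)) k j = 0.
  move=> dk dl; have dkl : dd k = dd l by rewrite dk.
  rewrite mulmxA comm // mxE big1 // => c _.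
  have [dcj|dcj] := eqVneq (dd c) (dd j); last by rewrite gram_blockwise ?mulr0.
  rewrite mxE big1 ?mul0r // => b _.
  have [->|/(skew_delta_supp dkl)[_ dc]] := eqVneq (skew_delta k l b c) 0; first by rewrite mulr0.
  by move: dij; rewrite -dcj dc dk eqxx.
have offd k l : k != l -> dd k = dd i -> dd l = dd i -> (G *m Z) l j = 0.
  move=> nkl dk dl; have := main k l dk dl; rewrite mxE (bigD1 l) //= big1 => [|c nc].
    by rewrite skew_deltaE !eqxx (negPf nkl) /= mulr0 subr0 mul1r addr0.
  by rewrite skew_deltaE (negPf nc) (negPf nkl) andbF /= mulr0 subr0 mul0r.
split.
  move=> k dk; apply/eqP; apply: contraNT Zij => nki; apply/eqP.
  apply: block_col_cancel => l dl; have [->|nli] := eqVneq l i.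
    exact: (offd k).
  by apply: (offd i) => //; rewrite eq_sym.
apply: contraNN Zij => si; apply/eqP.
apply: block_col_cancel => l dl; have [->|nli] := eqVneq l i; last first.
  by apply: (offd i) => //; rewrite eq_sym.
have := main i i erefl erefl; rewrite skew_delta_diag // mxE (bigD1 i) //= big1 => [|c nc].
  by rewrite !mxE !eqxx mulr1 addr0 => /eqP; rewrite mulf_eq0 (negPf two_neq0) => /eqP.
by rewrite !mxE (negPf nc) andbF mulr0 mul0r.
Qed.

Lemma co_parity j k y : (k < dd j)%N -> co j k (P *m y) = sp j * co j k y.
Proof.
move=> ltk; move: y; apply: (str_functional_ext T).
- by move=> a y z; rewrite mulmxDr -scalemxAr (str_lin T).
- by move=> a y z; rewrite (str_lin T) mulrDr; ring.
move=> i l ltl; rewrite (os_par S) (str_coZ T) (str_co T) //.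
by case: eqP => [->//|_]; rewrite !mulr0.
Qed.

Lemma symbol_parity t i j :
  (if t then even_part h = 0 else odd_part h = 0) ->
  Z i j != 0 -> p i (+) p j = t.
Proof.
move=> ph Zij; have lk := symbol_linked Zij; have [lt _ _] := linked_shift S lk.
have ZE : Z i j = co i (shift dd i j) (h *m v j 0%N) by rewrite mxE lk.
have Ph : P *m h = (-1) ^+ t *: (h *m P).
  case: t ph => [/eqP/odd_parityP|/eqP/even_parityP] ->.
    by rewrite expr1 scaleN1r.
  by rewrite expr0 scale1r.
have := co_parity (h *m v j 0%N) lt.
rewrite mulmxA Ph -scalemxAl -mulmxA (os_par S) -scalemxAr scalerA (str_coZ T).
rewrite -ZE => /(mulIf Zij); rewrite /parity_sign -signr_addb.
by move/signr_inj <-; rewrite addbK.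
Qed.

(** An odd symbol has no components between solitary strings, for reasons of
    parity; inside a block, commuting with the diagonal operators of the
    alternating part kills its rows and columns there, and parity the rest. *)
Lemma odd_highest : even_part h = 0 -> h = 0.
Proof.
move=> h0; apply: (symbol_eq0 S hg xh eh).
have off i j : dd i != dd j -> Z i j = 0.
  move=> dij; apply/eqP; apply: contraT => Zij.
  have [_ si] := symbol_row Zij dij; have [_ sj] := symbol_col Zij dij.
  have := @symbol_parity true i j h0 Zij; have := linked_shift S (symbol_linked Zij).
  case=> _ dd2 _; move: si sj; rewrite /symplectic.
  have := str_gt0 T i; have := str_gt0 T j; case: (p i); case: (p j) => //=; lia.
have comm0 k : symplectic k -> delta_mx k k *m G *m Z = Z *m delta_mx k k *m G.
  move=> sk; have := comm (erefl (dd k)); rewrite skew_delta_diag // addbb.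
  have -> : twist p false Z = Z by apply/matrixP => i j; rewrite mxE mul1r.
  rewrite -!scalemxAl -scalemxAr -scalemxAl => /(scalerI two_neq0) //.
have dcol k (M : 'M[F]_N) i c : (M *m delta_mx k k) i c = M i k * (c == k)%:R.
  rewrite mxE (bigD1 k) //= big1 => [|l nl].
    by rewrite mxE eqxx /= addr0.
  by rewrite mxE (negPf nl) mulr0.
have drow k (M : 'M[F]_N) i c : (delta_mx k k *m M) i c = (i == k)%:R * M k c.
  rewrite mxE (bigD1 k) //= big1 => [|l nl].
    by rewrite mxE eqxx andbT addr0.
  by rewrite mxE (negPf nl) andbF mul0r.
have scol k r : symplectic k -> Z r k = 0.
  move=> sk; have [->|nrk] := eqVneq r k.
    apply/eqP; apply: contraT => Zkk.
    by have := @symbol_parity true k k h0 Zkk; rewrite addbb.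
  have : forall s, (Z *m delta_mx k k *m G) r s = 0.
    by move=> s; rewrite -comm0 // -mulmxA drow (negPf nrk) mul0r.
  by move/row_cancel/(_ k); rewrite dcol eqxx mulr1.
have srow k s : symplectic k -> (G *m Z) k s = 0.
  move=> sk; have := drow k (G *m Z) k s; rewrite eqxx mul1r => <-.
  rewrite mulmxA comm0 // mxE big1 // => c _.
  by rewrite dcol scol // !mul0r.
apply/matrixP => r s; rewrite [RHS]mxE.
have [ss|ss] := boolP (symplectic s); first exact: scol.
apply: block_col_cancel => l dl.
have [sl|sl] := boolP (symplectic l); first exact: srow.
rewrite mxE big1 // => c _.
have [->|/(gram_type S)[dlc plc]] := eqVneq (G l c) 0; first by rewrite mul0r.
have [->|Zcs] := eqVneq (Z c s) 0; first by rewrite mulr0.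
have [dcs|dcs] := eqVneq (dd c) (dd s); last by rewrite (off _ _ dcs) eqxx in Zcs.
have := @symbol_parity true c s h0 Zcs; move: ss sl plc; rewrite /symplectic dlc dcs.
by case: (p s); case: (p l); case: (p c); case: (odd _).
Qed.

End Vector.
End Symbols.

Section EvenHighest.
Variables (F : numFieldType) (m n N : nat) (e x f : 'M[F]_(m + n)).
Variables (dd : 'I_N -> nat) (p : 'I_N -> bool).
Variable (v : 'I_N -> nat -> 'cV[F]_(m + n)).
Variable (co : 'I_N -> nat -> 'cV[F]_(m + n) -> F).
Hypothesis S : osp_strings e x f dd p v co.
Local Notation G := (gram dd v).
Local Notation sp := (parity_sign F p).
Local Notation sd := (length_sign F dd).
Local Notation g := (osp F m n).
Local Notation gnat := (centralizer g <<[:: e; x; f]>>).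
Local Notation symplectic := (symplectic dd p).
Local Notation skew_delta := (skew_delta F dd p).
Let T := os_str S.

Variable h : 'M[F]_(m + n).
Hypotheses (hg : h \in g) (ha : forall a, a \in gnat -> sbracket a h = 0).
Hypotheses (xh : x *m h - h *m x = h) (eh : e *m h = h *m e).
Hypothesis oh : odd_part h = 0.
Local Notation Z := (symbol dd v co h).

Let D : 'M[F]_N := \matrix_(i, j) if dd i == dd j then Z i j else 0.

Let D_blockwise : blockwise dd D.
Proof. by move=> i j /negPf dij; rewrite [D _ _]mxE dij. Qed.

Let DE i j : dd i = dd j -> D i j = Z i j.
Proof. by move=> dij; rewrite [D _ _]mxE dij eqxx. Qed.

Let mulDl (a : 'M[F]_N) i j : blockwise dd a -> dd i = dd j -> (a *m D) i j = (a *m Z) i j.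
Proof.
move=> ba dij; rewrite [LHS]mxE [RHS]mxE; apply: eq_bigr => c _.
have [dic|dic] := eqVneq (dd i) (dd c); last by rewrite ba ?mul0r.
by rewrite DE // -dic.
Qed.

Let mulDr (a : 'M[F]_N) i j : blockwise dd a -> dd i = dd j -> (D *m a) i j = (Z *m a) i j.
Proof.
move=> ba dij; rewrite [LHS]mxE [RHS]mxE; apply: eq_bigr => c _.
have [dic|dic] := eqVneq (dd c) (dd j); last by rewrite ba ?mulr0.
by rewrite DE // dic.
Qed.

Let comm k l : dd k = dd l -> skew_delta k l *m D^T = D *m skew_delta k l.
Proof.
move=> dkl; have bK := parity_type_blockwise (skew_delta_type (F := F) (p := p) dkl).
have bG := gram_blockwise S.
have bKG := blockwise_mul bK bG.
have E1 : skew_delta k l *m G *m D = D *m (skew_delta k l *m G).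
  apply/matrixP => i j; have [dij|dij] := eqVneq (dd i) (dd j); last first.
    by rewrite (blockwise_mul bKG D_blockwise) // (blockwise_mul D_blockwise bKG).
  rewrite mulDl // mulDr //.
  rewrite (symbol_commute S hg ha xh eh (skew_delta_type (F := F) (p := p) dkl) (skew_delta_skew F p dkl)).
  rewrite [LHS]mxE [RHS]mxE; apply: eq_bigr => c _; congr (_ * _).
  rewrite [LHS]mxE; have [->|Zic] := eqVneq (Z i c) 0; first by rewrite mulr0.
  have := symbol_parity S (t := false) oh Zic.
  have -> : sp i * sp c = (-1) ^+ (p i (+) p c) by rewrite signr_addb.
  by move->; rewrite expr0 expr1n mul1r.
have E2 : G *m D = D^T *m G.
  apply/matrixP => i j; have [dij|dij] := eqVneq (dd i) (dd j); last first.
    have bDT : blockwise dd D^T.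
      by move=> r s drs; rewrite [D^T _ _]mxE D_blockwise // eq_sym.
    by rewrite (blockwise_mul bG D_blockwise) // (blockwise_mul bDT bG).
  have -> : (D^T *m G) i j = (Z^T *m G) i j.
    rewrite [LHS]mxE [RHS]mxE; apply: eq_bigr => c _.
    have [dcj|dcj] := eqVneq (dd c) (dd j); last by rewrite bG ?mulr0.
    by rewrite ![_^T _ _]mxE DE // dcj.
  rewrite mulDl //; have [lk|nlk] := boolP (linked dd j i).
    have := symbol_adjoint S hg xh eh oh lk.
    have [_ s _] := linked_shift S lk.
    have -> : shift dd j i = 1%N by lia.
    by rewrite expr1 mulN1r => /eqP; rewrite addrC subr_eq0 => /eqP.
  rewrite [LHS]mxE [RHS]mxE !big1 // => c _.
    rewrite [Z^T _ _]mxE.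
    have [->|/symbol_linked] := eqVneq (Z c i) 0; first by rewrite mul0r.
    have [dcj|dcj] := eqVneq (dd c) (dd j); last by rewrite bG ?mulr0.
    by rewrite (linked_eq dcj (erefl _)) (negPf nlk).
  have [->|/symbol_linked] := eqVneq (Z c j) 0; first by rewrite mulr0.
  have [dic|dic] := eqVneq (dd i) (dd c); last by rewrite bG ?mul0r.
  by rewrite -(linked_eq dic (erefl _)) (linked_eq dij (esym dij)) (negPf nlk).
have := E1; rewrite -mulmxA E2 !mulmxA => /(congr1 (mulmx^~ (invmx G))).
by rewrite !mulmxK ?(gram_unit S).
Qed.

(** Schur lemma inside a block: the diagonal block D satisfies K D^T = D K for all
    elementary skew K, and comparing entries shows that D is scalar. *)
Lemma symbol_block k l : dd k = dd l -> k != l -> Z l k = 0 /\ Z k k = Z l l.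
Proof.
move=> dkl nkl; rewrite -!DE //.
pose mu a b := sp a * sd a * sp a ^+ (p a (+) p b).
have E a b r s : dd a = dd b ->
    (r == a)%:R * D s b - mu a b * (r == b)%:R * D s a =
    D r a * (s == b)%:R - mu a b * D r b * (s == a)%:R.
  move=> /comm /matrixP/(_ r s).
  have L (i j : 'I_N) (M : 'M[F]_N) : (delta_mx i j *m M^T) r s = (r == i)%:R * M s j.
    rewrite mxE (bigD1 j) //= big1 => [|c nc].
      by rewrite !mxE eqxx andbT addr0.
    by rewrite !mxE (negPf nc) andbF mul0r.
  have R (i j : 'I_N) (M : 'M[F]_N) : (M *m delta_mx i j) r s = M r i * (s == j)%:R.
    rewrite mxE (bigD1 i) //= big1 => [|c nc].
      by rewrite !mxE eqxx /= addr0.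
    by rewrite !mxE (negPf nc) mulr0.
  have sub (A B : 'M[F]_N) c : (A - c *: B) r s = A r s - c * B r s by rewrite !mxE.
  by rewrite mulmxBl mulmxBr -scalemxAl -scalemxAr !sub !L !R !mulrA.
split; last first.
  have := E k l k l dkl; rewrite !eqxx (negPf nkl) [l == k]eq_sym (negPf nkl).
  by rewrite !(mulr0, mul0r, subr0, mul1r, mulr1).
have := E k l l l dkl; rewrite !eqxx [l == k]eq_sym (negPf nkl).
rewrite !(mulr0, mul0r, subr0, sub0r, mul1r, mulr1).
have [pkl|pkl] := eqVneq (p k) (p l); last first.
  move=> _; apply/eqP; apply: contraT; rewrite DE // => Zlk.
  by have := symbol_parity S (t := false) oh Zlk; move: pkl; case: (p k); case: (p l).
rewrite /mu pkl addbb expr0 mulr1 (sign_symplectic F dd p k).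
have [sk _|sk] := boolP (symplectic k).
  have := E k k l k erefl; rewrite !eqxx [l == k]eq_sym (negPf nkl) /mu addbb.
  rewrite expr0 mulr1 (sign_symplectic F dd p k) sk expr1.
  rewrite !(mulr0, mul0r, subr0, sub0r, mulr1, mulN1r, opprK) oppr0 => /eqP.
  by rewrite eq_sym -mulr2n mulrn_eq0 => /eqP.
rewrite expr0 mul1r => /eqP; rewrite eq_sym -subr_eq0 opprK -mulr2n mulrn_eq0.
by move/eqP.
Qed.

End EvenHighest.

(** * The two families of highest vectors *)

Section HighestBasis.
Variables (F : numFieldType) (m n N : nat) (e x f : 'M[F]_(m + n)).
Variables (dd : 'I_N -> nat) (p : 'I_N -> bool).
Variable (v : 'I_N -> nat -> 'cV[F]_(m + n)).
Variable (co : 'I_N -> nat -> 'cV[F]_(m + n) -> F).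
Hypothesis S : osp_strings e x f dd p v co.
Local Notation bf := (@bform F m n).
Local Notation P := (parity_mx F m n).
Local Notation G := (gram dd v).
Local Notation sp := (parity_sign F p).
Local Notation g := (osp F m n).
Local Notation gnat := (centralizer g <<[:: e; x; f]>>).
Local Notation symplectic := (symplectic dd p).
Let T := os_str S.

(** The multiplicity space of strings of the length of [j] is a line with a
    symmetric form. *)
Definition solitary j := ~~ symplectic j && [forall l, (dd l == dd j) ==> (l == j)].

Lemma solitaryP j : reflect (~~ symplectic j /\ forall l, dd l = dd j -> l = j) (solitary j).
Proof.
apply: (iffP andP) => -[sj].
  by move/forallP=> sol; split=> // l dl; have := sol l; rewrite dl eqxx => /eqP.
by move=> sol; split=> //; apply/forallP => l; apply/implyP => /eqP/sol->.
Qed.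

(** The operator e, restricted to the strings of length q. *)
Definition diag_vector q := string_map dd co (fun j k => if dd j == q then v j k.+1 else 0).

(** It raises weights by one: the string [j] goes onto the upper part of the
    string [l], which is two steps longer, and [l] onto [j], its two upper
    vectors going to zero. The factor makes the operator skew for the form. *)
Definition pair_vector l j := string_map dd co (fun i k =>
  if i == j then v l k.+2 else
  if i == l then (- (G l l / G j j)) *: v j k else 0).

(** For an even h the conditions become commutation relations. *)
Lemma highestE h : odd_part h = 0 -> h \in g ->
  (forall a, a \in gnat -> a *m h = h *m a) -> x *m h = h *m x + h ->
  e *m h = h *m e -> highest e x gnat g h.
Proof.
move=> oh hg ha xh eh; split=> //.
- by move=> a /ha ah; rewrite sbracket_evenr // ah subrr.
- by rewrite sbracket_evenr // xh addrC addKr.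
- by rewrite sbracket_evenr // eh subrr.
Qed.

Lemma diag_vectorE q j k : diag_vector q *m v j k = if dd j == q then v j k.+1 else 0.
Proof.
have [lt|le] := ltnP k (dd j); first by rewrite /diag_vector (string_mapE T).
by rewrite !(str_0 T) ?mulmx0 ?if_same // ltnW.
Qed.

Lemma even_by_strings A :
  (forall j k, P *m (A *m v j k) = sp j *: (A *m v j k)) -> odd_part A = 0.
Proof.
move=> PA; apply/eqP/even_parityP; apply: (str_mulmx_ext T) => j k _.
by rewrite -!mulmxA (os_par S) -scalemxAr PA.
Qed.

Lemma diag_vector_even q : odd_part (diag_vector q) = 0.
Proof.
apply: even_by_strings => j k; rewrite diag_vectorE; case: ifP => _.
  by rewrite (os_par S).
by rewrite mulmx0 scaler0.
Qed.

Lemma diag_vector_osp q : diag_vector q \in g.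
Proof.
apply: (osp_homogeneous S (t := false)) => [|j k r l]; first exact: diag_vector_even.
rewrite expr0 mul1r !diag_vectorE.
have [djr|djr] := eqVneq (dd j) (dd r); last first.
  by case: ifP; case: ifP; rewrite ?bform0l ?bform0r ?(bform_strings S) ?(negPf djr) /= ?addr0.
rewrite djr; case: ifP => _; last by rewrite bform0l bform0r addr0.
by rewrite -!(str_e T) (bform_even _ _ (os_e S) (os_eev S)) addNr.
Qed.

Lemma diag_highest q : highest e x gnat g (diag_vector q).
Proof.
apply: (highestE (diag_vector_even q) (diag_vector_osp q)).
- move=> a ag; apply: (str_mulmx_ext T) => j k _.
  rewrite -!mulmxA diag_vectorE (gnat_lowest S j k ag) mulmx_sumr.
  case: ifP => djq.
    rewrite (gnat_lowest S j k.+1 ag); apply: eq_bigr => i /eqP dij.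
    by rewrite -scalemxAr diag_vectorE dij djq.
  rewrite mulmx0 big1 // => i /eqP dij.
  by rewrite -scalemxAr diag_vectorE dij djq scaler0.
- apply: (str_mulmx_ext T) => j k _; rewrite mulmxDl -!mulmxA (str_x T) -scalemxAr.
  rewrite diag_vectorE; case: ifP => _; last by rewrite mulmx0 scaler0 addr0.
  rewrite (str_x T) -[X in _ = _ + X]scale1r -scalerDl; congr (_ *: _).
  by rewrite -natr1; ring.
- apply: (str_mulmx_ext T) => j k _; rewrite -!mulmxA (str_e T) !diag_vectorE.
  by case: ifP; rewrite ?mulmx0 // (str_e T).
Qed.

Lemma solitary_gram l : solitary l -> G l l != 0.
Proof.
case/solitaryP=> _ sol; apply/eqP => Gll; case/eqP: (oner_neq0 F).
have Gl : G *m delta_mx l 0 = 0 :> 'cV[F]_N.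
  apply/colP => i; rewrite -colE [LHS]mxE [RHS]mxE.
  have [->|/(gram_type S)[dil _]] := eqVneq (G i l) 0; first by [].
  by rewrite (sol i dil).
by have /colP/(_ l) := col_cancel S Gl; rewrite !mxE !eqxx.
Qed.

(** An even element of the centralizer acts on the line by a scalar, which is
    zero since it is skew for a nonzero symmetric form; an odd one has no room. *)
Lemma gnat_solitary a l k : a \in gnat -> solitary l -> a *m v l k = 0.
Proof.
move=> ag sl; have [_ sol] := solitaryP _ sl.
have aE i : a *m v l i = co l 0%N (a *m v l 0%N) *: v l i.
  rewrite (gnat_lowest S l i ag) (bigD1 l) //= big1 ?addr0 // => r.
  by case/andP=> /eqP/sol->; rewrite eqxx.
set c := co l 0%N _ in aE; suff c0 : c = 0 by rewrite aE c0 scale0r.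
have oa i : odd_part a *m v l i = 0.
  have : P *m (a *m v l i) = sp l *: (a *m v l i).
    by rewrite aE -scalemxAr (os_par S) !scalerA mulrC.
  rewrite -{1 2}[a]even_addodd !mulmxDl mulmxDr scalerDr !mulmxA parity_even.
  rewrite parity_odd mulNmx -!mulmxA (os_par S) -!scalemxAr => /addrI/eqP.
  rewrite eq_sym -subr_eq0 opprK -mulr2n -scaler_nat scaler_eq0 pnatr_eq0 /=.
  by rewrite scaler_eq0 signr_eq0 => /eqP.
have ev i : even_part a *m v l i = c *: v l i.
  by rewrite -aE -{2}[a]even_addodd mulmxDl oa addr0.
have /in_triple_centralizer := ag.
case; rewrite ?(os_eev S) ?(os_xev S) ?(os_fev S) // => ag' _ _ _.
have := bform_even (v l 0%N) (v l (dd l).-1) (osp_graded ag') (odd_even a).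
rewrite !ev bformZl bformZr.
have -> : bf (v l 0%N) (v l (dd l).-1) = G l l by rewrite mxE.
move/eqP; rewrite -subr_eq0 opprK -mulr2n mulrn_eq0 /= mulf_eq0.
by rewrite (negPf (solitary_gram sl)) orbF => /eqP.
Qed.

Section Pair.
Variables l j : 'I_N.
Hypotheses (sl : solitary l) (sj : solitary j) (dlj : dd l = (dd j + 2)%N).
Local Notation gamma := (- (G l l / G j j)).

Let neq_lj : (l == j) = false.
Proof. by apply/eqP => lj; move: dlj; rewrite lj; lia. Qed.

Lemma pair_vectorE i k : pair_vector l j *m v i k =
  if i == j then v l k.+2 else if i == l then gamma *: v j k else 0.
Proof.
have [lt|le] := ltnP k (dd i); first by rewrite /pair_vector (string_mapE T).
rewrite (str_0 T le) mulmx0; case: eqP => [ij|_].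
  by rewrite (str_0 T) // dlj -ij; lia.
by case: eqP => // il; rewrite (str_0 T) ?scaler0 //; move: le; rewrite il dlj; lia.
Qed.

Lemma solitary_parity : p l = p j.
Proof.
case/solitaryP: sl => + _; case/solitaryP: sj => + _.
rewrite /symplectic dlj; have := str_gt0 T j.
by case: (p l); case: (p j) => //=; lia.
Qed.

Lemma pair_vector_even : odd_part (pair_vector l j) = 0.
Proof.
apply: even_by_strings => i k; rewrite pair_vectorE; case: eqP => [->|_].
  by rewrite (os_par S) solitary_parity.
case: eqP => [->|_]; last by rewrite mulmx0 scaler0.
by rewrite -scalemxAr (os_par S) !scalerA mulrC /parity_sign solitary_parity.
Qed.

Lemma bform_solitary i i' k k' : solitary i -> i != i' -> bf (v i k) (v i' k') = 0.
Proof.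
move=> /solitaryP[_ si] nii; rewrite (bform_strings S).
by case: eqP => // dii; case/eqP: nii; rewrite (si i').
Qed.

Lemma pair_vector_osp : pair_vector l j \in g.
Proof.
apply: (osp_homogeneous S (t := false)) => [|i k r s]; first exact: pair_vector_even.
rewrite expr0 mul1r !pair_vectorE.
have bjl a b : bf (v j a) (v l b) = 0 by rewrite bform_solitary // eq_sym neq_lj.
have blj a b : bf (v l a) (v j b) = 0 by rewrite bform_solitary // neq_lj.
have Gjj := solitary_gram sj.
have E a b : bf (v l a.+2) (v l b) = - (gamma * bf (v j a) (v j b)).
  rewrite !(bform_strings S) !eqxx /= dlj.
  have -> : (a.+2 + b == (dd j + 2).-1)%N = (a + b == (dd j).-1)%N.
    by have := str_gt0 T j; lia.
  by case: ifP; rewrite ?mulr0 ?oppr0 // !exprS => _; field.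
have E' a b : bf (v l a) (v l b.+2) = - (gamma * bf (v j a) (v j b)).
  rewrite !(bform_strings S) !eqxx /= dlj.
  have -> : (a + b.+2 == (dd j + 2).-1)%N = (a + b == (dd j).-1)%N.
    by have := str_gt0 T j; lia.
  by case: ifP; rewrite ?mulr0 ?oppr0 // => _; field.
have [->|nij] := eqVneq i j; have [->|nrj] := eqVneq r j.
- by rewrite blj bjl addr0.
- have [->|nrl] := eqVneq r l; first by rewrite E bformZr addNr.
  by rewrite bform0r addr0 bform_solitary // eq_sym.
- have [->|nil] := eqVneq i l; first by rewrite E' bformZl addrN.
  by rewrite bform0l add0r (bform_swap S) bform_solitary ?mulr0 // eq_sym.
have [->|nil] := eqVneq i l; have [->|nrl] := eqVneq r l.
- by rewrite bformZl bformZr bjl blj !mulr0 addr0.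
- by rewrite bform0r addr0 bformZl bform_solitary ?mulr0 // eq_sym.
- by rewrite bform0l add0r bformZr (bform_swap S) bform_solitary ?mulr0 // eq_sym.
by rewrite bform0l bform0r addr0.
Qed.

Lemma pair_highest : highest e x gnat g (pair_vector l j).
Proof.
have [_ soll] := solitaryP _ sl; have [_ solj] := solitaryP _ sj.
apply: (highestE pair_vector_even pair_vector_osp).
- move=> a ag; apply: (str_mulmx_ext T) => i k _; rewrite -!mulmxA pair_vectorE.
  case: eqP => [->|/eqP nij]; first by rewrite !gnat_solitary // mulmx0.
  case: eqP => [->|/eqP nil].
    by rewrite -scalemxAr !gnat_solitary // scaler0 mulmx0.
  rewrite mulmx0 (gnat_lowest S i k ag) mulmx_sumr big1 // => r /eqP dri.
  rewrite -scalemxAr pair_vectorE.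
  case: eqP => [rj|_]; first by case/eqP: nij; apply: solj; rewrite -dri rj.
  case: eqP => [rl|_]; first by case/eqP: nil; apply: soll; rewrite -dri rl.
  by rewrite scaler0.
- apply: (str_mulmx_ext T) => i k _; rewrite mulmxDl -!mulmxA (str_x T) -scalemxAr.
  rewrite pair_vectorE; case: eqP => [->|_].
    rewrite (str_x T) -[X in _ = _ + X]scale1r -scalerDl; congr (_ *: _).
    by rewrite dlj -!natr1 natrD; field.
  case: eqP => [->|_]; last by rewrite mulmx0 scaler0 addr0.
  rewrite -scalemxAr (str_x T) !scalerA -scalerDl; congr (_ *: _).
  by rewrite dlj natrD; field; apply: solitary_gram.
- apply: (str_mulmx_ext T) => i k _; rewrite -!mulmxA (str_e T) !pair_vectorE.
  case: eqP => _; first by rewrite (str_e T).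
  by case: eqP => _; rewrite ?mulmx0 // -scalemxAr (str_e T).
Qed.

End Pair.
End HighestBasis.

(** * A spanning family of highest vectors *)

Lemma highest_lin (F : fieldType) (m n : nat) (e x : 'M[F]_(m + n)) K L a h h' :
  highest e x K L h -> highest e x K L h' -> highest e x K L (a *: h + h').
Proof.
case=> hL hK hx he [hL' hK' hx' he']; split.
- by rewrite rpredD ?rpredZ.
- by move=> b bK; rewrite sbracketDr sbracketZr hK // hK' // scaler0 addr0.
- by rewrite sbracketDr sbracketZr hx hx'.
- by rewrite sbracketDr sbracketZr he he' scaler0 addr0.
Qed.

Lemma highest0 (F : fieldType) (m n : nat) (e x : 'M[F]_(m + n)) K L :
  highest e x K L 0.
Proof. by split; rewrite ?mem0v // => *; rewrite sbracket0r. Qed.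

Lemma graded_odd (F : fieldType) (m n : nat) (U : {vspace 'M[F]_(m + n)}) X :
  graded U -> X \in U -> odd_part X \in U.
Proof.
move=> gU XU; have -> : odd_part X = X - even_part X.
  by rewrite -{2}[X]even_addodd addrC addKr.
by rewrite rpredB ?gU.
Qed.

Lemma highest_even (F : fieldType) (m n : nat) (e x : 'M[F]_(m + n)) K L h :
  odd_part e = 0 -> odd_part x = 0 -> graded K -> graded L ->
  highest e x K L h -> highest e x K L (even_part h).
Proof.
move=> oe ox gK gL [hL hK hx he]; split; first exact: gL.
- move=> a aK; have := hK _ (gK _ aK); have := hK _ (graded_odd gK aK).
  move=> /(congr1 (@odd_part F m n)) + /(congr1 (@even_part F m n)).
  rewrite odd_sbracket even_sbracket even_odd odd_odd even_even odd_even.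
  rewrite odd_part0 even_part0 !mul0mx !mulmx0 subrr add0r !addr0.
  move=> o0 e0; rewrite sbracketE even_even odd_even mulmx0 mul0mx !addr0.
  by rewrite e0 o0 addr0.
- move/(congr1 (@even_part F m n)): hx; rewrite even_sbracket ox !mul0mx mulmx0.
  by rewrite !addr0 sbracket_evenl // (even_id ox).
- move/(congr1 (@even_part F m n)): he; rewrite even_sbracket oe !mul0mx mulmx0.
  by rewrite !addr0 sbracket_evenl // (even_id oe) even_part0.
Qed.

Lemma highest_odd (F : fieldType) (m n : nat) (e x : 'M[F]_(m + n)) K L h :
  odd_part e = 0 -> odd_part x = 0 -> graded K -> graded L ->
  highest e x K L h -> highest e x K L (odd_part h).
Proof.
move=> oe ox gK gL hh; have -> : odd_part h = (-1) *: even_part h + h.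
  by rewrite -{3}[h]even_addodd scaleN1r addKr.
by apply: highest_lin => //; apply: highest_even.
Qed.

Lemma centralizer_graded (F : fieldType) (m n : nat) (e x f : 'M[F]_(m + n)) L :
  odd_part e = 0 -> odd_part x = 0 -> odd_part f = 0 -> graded L ->
  graded (centralizer L <<[:: e; x; f]>>).
Proof.
move=> oe ox of' gL a /in_triple_centralizer[] // aL ae ax af.
have evc y : odd_part y = 0 -> a *m y = y *m a ->
    even_part a *m y = y *m even_part a.
  move=> oy /(congr1 (@even_part F m n)); rewrite !even_mul oy mulmx0 mul0mx.
  by rewrite !addr0 (even_id oy).
by apply/in_triple_centralizer => //; split; [apply: gL|apply: evc..].
Qed.

Section Keys.
Variables (F : numFieldType) (m n N : nat) (e x f : 'M[F]_(m + n)).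
Variables (dd : 'I_N -> nat) (p : 'I_N -> bool).
Variable (v : 'I_N -> nat -> 'cV[F]_(m + n)).
Variable (co : 'I_N -> nat -> 'cV[F]_(m + n) -> F).
Hypothesis S : osp_strings e x f dd p v co.
Local Notation G := (gram dd v).
Local Notation g := (osp F m n).
Local Notation gnat := (centralizer g <<[:: e; x; f]>>).
Local Notation solitary := (solitary dd p).
Local Notation diag_vector := (diag_vector dd v co).
Local Notation pair_vector := (pair_vector dd v co).
Local Notation symbol := (symbol dd v co).
Let T := os_str S.

Definition solitary_at q := [pick j | (dd j == q) && solitary j].
Definition solitary_step q : bool := solitary_at q && solitary_at (q + 2)%N.

Definition pair_vector_at q :=
  if solitary_at q is Some j then
    if solitary_at (q + 2)%N is Some l then pair_vector l j else 0
  else 0.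

Definition key_vector (k : bool * nat) := if k.1 then diag_vector k.2 else pair_vector_at k.2.

(** Labels of the highest vectors: [(true, q)] for the restriction of e to the
    strings of length q, [(false, q)] for the pair of solitary strings of
    lengths q and q + 2. *)
Definition keys (qs : seq nat) : seq (bool * nat) :=
  [seq (true, q) | q <- qs & (1 < q)%N] ++ [seq (false, q) | q <- qs & solitary_step q].

Lemma solitary_stepP q : solitary_step q -> exists l j, [/\ solitary l, solitary j,
  dd j = q, dd l = (q + 2)%N & pair_vector_at q = pair_vector l j].
Proof.
rewrite /solitary_step /pair_vector_at /solitary_at; case: pickP => //= j /andP[/eqP dj sj].
by case: pickP => //= l /andP[/eqP dl sl] _; exists l, j.
Qed.

Lemma solitary_atE j : solitary j -> solitary_at (dd j) = Some j.
Proof.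
move=> sj; rewrite /solitary_at; case: pickP => [l /andP[/eqP dl _]|/(_ j)].
  by case/solitaryP: sj => _ /(_ l dl) ->.
by rewrite eqxx sj.
Qed.

Lemma key_highest qs k : k \in keys qs ->
  highest e x gnat g (key_vector k) /\ odd_part (key_vector k) = 0.
Proof.
rewrite mem_cat => /orP[/mapP[q _ ->]|/mapP[q + ->]]; rewrite /key_vector /=.
  by split; [exact: (diag_highest S)|exact: (diag_vector_even S)].
rewrite mem_filter => /andP[/solitary_stepP[l [j [sl sj dj dl ->]]] _].
have dlj : dd l = (dd j + 2)%N by rewrite dl dj.
by split; [exact: (pair_highest S)|exact: (pair_vector_even S)].
Qed.

Lemma symbol_diag q i j :
  symbol (diag_vector q) i j = [&& i == j, dd j == q & (1 < dd j)%N]%:R.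
Proof.
rewrite mxE (diag_vectorE S); case: (eqVneq (dd j) q) => [djq|djq]; last first.
  by rewrite (str_co0 T) if_same /= andbF.
have [gt|le] := ltnP 1 (dd j); last first.
  by rewrite (str_0 T) // (str_co0 T) if_same /= andbF.
rewrite (str_co T) // /= andbT; case: eqP => [->|_]; last by rewrite /= if_same.
rewrite /linked /shift eqxx gt /= addnC addnK divnn /=.
by [].
Qed.

Lemma symbol_pair l j i r : solitary l -> solitary j -> dd l = (dd j + 2)%N ->
  symbol (pair_vector l j) i r =
   if r == j then (i == l)%:R else
   if r == l then - (G l l / G j j) * (i == j)%:R else 0.
Proof.
move=> sl sj dlj; rewrite mxE (pair_vectorE S sl sj dlj); have d0 := str_gt0 T j.
case: (eqVneq r j) => [->|_].
  rewrite (str_co T) ?dlj; last by lia.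
  case: (eqVneq i l) => [->|_]; last by rewrite /= if_same.
  have -> : linked dd l j by rewrite /linked dlj eqxx orbT.
  have -> : shift dd l j = 2%N by rewrite /shift dlj; lia.
  by [].
case: (eqVneq r l) => [->|_]; last by rewrite (str_co0 T) if_same.
rewrite (str_coZ T) (str_co T) //.
case: (eqVneq i j) => [->|_]; last by rewrite /= mulr0 if_same.
have -> : linked dd j l by rewrite /linked dlj eqxx !orbT.
have -> : shift dd j l = 0%N by rewrite /shift dlj; lia.
by rewrite mulr1.
Qed.

Lemma symbol_sum h (r : seq (bool * nat)) (c : bool * nat -> F) i j :
  symbol (h - \sum_(k <- r) c k *: key_vector k) i j =
  symbol h i j - \sum_(k <- r) c k * symbol (key_vector k) i j.
Proof.
rewrite !mxE; under [in RHS]eq_bigr do rewrite mxE.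
case: ifP => _; last by rewrite big1 ?subr0 // => *; rewrite mulr0.
rewrite mulmxBl (str_coD T) -scaleN1r (str_coZ T) mulN1r mulmx_suml.
rewrite (str_co_sum T); congr (_ - _); apply: eq_bigr => k _.
by rewrite -scalemxAl (str_coZ T).
Qed.

(** Subtract from h the combination of basis vectors with the same diagonal
    entries and the same components from q to q + 2: the difference is a highest
    vector whose symbol is zero on the blocks and from q to q + 2, and from q + 2
    to q by [symbol_adjoint]. *)
Lemma even_highest_span qs h : uniq qs -> (forall j, dd j \in qs) ->
  highest e x gnat g h -> odd_part h = 0 -> h \in <<map key_vector (keys qs)>>%VS.
Proof.
move=> uqs qsP hh oh.
pose c (k : bool * nat) : F := if k.1 then
    (if [pick j | dd j == k.2] is Some j then symbol h j j else 0)
  else if solitary_at k.2 is Some j then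
    if solitary_at (k.2 + 2)%N is Some l then symbol h l j else 0 else 0.
pose s := \sum_(k <- keys qs) c k *: key_vector k.
suff h0 : h - s = 0.
  rewrite (subr0_eq h0) /s big_seq; apply: rpred_sum => k kin.
  by rewrite rpredZ // memv_span // map_f.
have sP : highest e x gnat g s /\ odd_part s = 0.
  rewrite /s big_seq; elim/big_rec: _ => [|k y kin [hy oy]].
    by split; [apply: highest0|rewrite odd_part0].
  have [hk ok] := key_highest kin; split; first exact: highest_lin.
  by rewrite odd_partD odd_partZ ok oy scaler0 addr0.
have os' : odd_part (h - s) = 0 by rewrite odd_partD odd_partN oh sP.2 subr0.
have [hg ha xh eh] : highest e x gnat g (h - s).
  by rewrite addrC -scaleN1r; apply: highest_lin => //; case: sP.
move: xh eh; rewrite !sbracket_evenr // => xh /eqP; rewrite subr_eq0 => /eqP eh.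
apply: (symbol_eq0 S hg xh eh).
have sumE i j : symbol (h - s) i j = symbol h i j -
    \sum_(q <- qs | (1 < q)%N) c (true, q) * symbol (diag_vector q) i j
    - \sum_(q <- qs | solitary_step q) c (false, q) * symbol (pair_vector_at q) i j.
  by rewrite symbol_sum big_cat /= !big_map !big_filter opprD addrA.
(* The components from a solitary string to the next one are those subtracted. *)
have up i j : solitary i -> solitary j -> dd i = (dd j + 2)%N -> symbol (h - s) i j = 0.
  move=> si sj dij; have nij : (i == j) = false.
    by apply/eqP => ij; move: dij; rewrite ij; lia.
  rewrite sumE big1 ?subr0 => [|q _]; last by rewrite symbol_diag nij mulr0.
  have sp2 : solitary_step (dd j) by rewrite /solitary_step -dij !solitary_atE.
  rewrite big_mkcond (bigD1_seq (dd j)) ?qsP //= big1 ?addr0 => [|q nq]; last first.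
    case: ifP => // sq.
    have [l [j1 [sl sj1 dj1 dl ->]]] := solitary_stepP sq.
    rewrite symbol_pair //; last by rewrite dl dj1.
    case: eqP => [jj|_]; first by rewrite jj dj1 eqxx in nq.
    case: eqP => [jl|_]; last by rewrite mulr0.
    case: eqP => [ij1|_]; last by rewrite !mulr0.
    by move: dij; rewrite ij1 jl dl dj1; clear; lia.
  rewrite sp2 /c /pair_vector_at /= -dij !solitary_atE // symbol_pair // !eqxx mulr1.
  by rewrite subrr.
apply/matrixP => i j; rewrite [RHS]mxE.
have [<-|nij] := eqVneq i j.
  rewrite sumE [X in _ - X]big1 ?subr0 => [|q sq]; last first.
    have [l [j1 [sl sj1 dj1 dl ->]]] := solitary_stepP sq.
    rewrite symbol_pair //; last by rewrite dl dj1.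
    case: eqP => [->|_].
      case: eqP => [jl|_]; last by rewrite mulr0.
      by move: dl; rewrite -jl dj1; clear; lia.
    by case: ifP => _; rewrite !mulr0.
  have [gt|le] := ltnP 1 (dd i); last first.
    rewrite big1 ?subr0; last first.
      by move=> q _; rewrite symbol_diag ltnNge le !andbF mulr0.
    apply/eqP; apply: contraT => /symbol_linked.
    by rewrite /linked eqxx ltnNge le /=; lia.
  rewrite big_mkcond (bigD1_seq (dd i)) ?qsP //= big1 ?addr0 => [|q nq]; last first.
    by rewrite symbol_diag [dd i == q]eq_sym (negPf nq) andbF mulr0 if_same.
  rewrite gt symbol_diag !eqxx gt mulr1 /c /=.
  case: pickP => [r /eqP dr|/(_ i)]; last by rewrite eqxx.
  have [->|nri] := eqVneq r i; first by rewrite subrr.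
  case: hh => hg' ha' xh' eh'; move: xh' eh'; rewrite !sbracket_evenr //.
  move=> xh' /eqP; rewrite subr_eq0 => /eqP eh'.
  by have [_ ->] := symbol_block S hg' ha' xh' eh' oh dr nri; rewrite subrr.
have [dij|dij] := eqVneq (dd i) (dd j).
  rewrite eq_sym in nij.
  by have [-> _] := symbol_block S hg ha xh eh os' (esym dij) nij.
apply/eqP; apply: contraT => Zij.
have soli : solitary i.
  by apply/solitaryP; have [? ?] := symbol_row S hg ha xh eh Zij dij.
have solj : solitary j.
  by apply/solitaryP; have [? ?] := symbol_col S hg ha xh eh Zij dij.
have lk := symbol_linked Zij.
case/or3P: lk (lk) => [/andP[dij' _]|/eqP d2|/eqP d2] lk; first by rewrite dij' in dij.
  by rewrite up // eqxx in Zij.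
have lk' : linked dd j i by rewrite /linked d2 eqxx orbT.
have := symbol_adjoint S hg xh eh os' lk'.
have solE (k r : 'I_N) : solitary k -> r != k -> G r k = 0 /\ G k r = 0.
  case/solitaryP=> _ sk nrk; have drk : dd r != dd k.
    by apply: contraNneq nrk => /sk ->.
  by rewrite !(gram_length S) // eq_sym.
rewrite [(_ *m G) i j]mxE (bigD1 j) //= [X in _ * (_ + X)]big1 => [|r nrj]; last first.
  by have [-> _] := solE _ _ solj nrj; rewrite mulr0.
rewrite [_^T _ _]mxE up // mul0r add0r mulr0 add0r.
rewrite mxE (bigD1 i) //= big1 => [|r nri]; last first.
  by have [_ ->] := solE _ _ soli nri; rewrite mul0r.
move/eqP; rewrite addr0 mulf_eq0 (negPf (solitary_gram S soli)) /= => Z0.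
by rewrite Z0 in Zij.
Qed.

(** The odd part of a highest vector is highest, so it is zero. *)
Lemma highest_span qs h : uniq qs -> (forall j, dd j \in qs) ->
  highest e x gnat g h -> h \in <<map key_vector (keys qs)>>%VS.
Proof.
move=> uqs qsP hh; have gg := osp_graded (F := F) (m := m) (n := n).
have gN := centralizer_graded (os_eev S) (os_xev S) (os_fev S) gg.
have he := highest_even (os_eev S) (os_xev S) gN gg hh.
have [og oa] := highest_odd (os_eev S) (os_xev S) gN gg hh.
rewrite !sbracket_evenl ?(os_eev S) ?(os_xev S) // => xo /eqP.
rewrite subr_eq0 => /eqP eo.
have o0 : odd_part h = 0 by rewrite (odd_highest S og oa xo eo) // even_odd.
by rewrite -[h]even_addodd o0 addr0; apply: even_highest_span; rewrite ?odd_even.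
Qed.

End Keys.

(** * The supertrace pairing of highest vectors *)

Section Pairing.
Variables (F : numFieldType) (m n N : nat) (e x f : 'M[F]_(m + n)).
Variables (dd : 'I_N -> nat) (p : 'I_N -> bool).
Variable (v : 'I_N -> nat -> 'cV[F]_(m + n)).
Variable (co : 'I_N -> nat -> 'cV[F]_(m + n) -> F).
Hypothesis S : osp_strings e x f dd p v co.
Local Notation P := (parity_mx F m n).
Local Notation G := (gram dd v).
Local Notation sp := (parity_sign F p).
Local Notation solitary := (solitary dd p).
Local Notation diag_vector := (diag_vector dd v co).
Local Notation pair_vector := (pair_vector dd v co).
Local Notation key_vector := (key_vector dd p v co).
Local Notation keys := (keys dd p).
Let T := os_str S.

Lemma trace_strings A : \tr A = \sum_j \sum_(k < dd j) co j k (A *m v j k).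
Proof.
have -> : A = string_map dd co (fun j k => A *m v j k).
  by apply: (str_mulmx_ext T) => j k lt; rewrite (string_mapE T).
have E (y : 'cV[F]_(m + n)) : \sum_c y c 0 *: delta_mx c 0 = y.
  by rewrite [RHS]matrix_sum_delta; apply: eq_bigr => c _; rewrite big_ord1.
rewrite /mxtrace; under eq_bigr => c _ do rewrite [string_map _ _ _ _ _]mxE summxE.
rewrite exchange_big /=; apply: eq_bigr => j _.
under eq_bigr => c _ do rewrite summxE.
rewrite exchange_big /=; apply: eq_bigr => k _; rewrite (string_mapE T) //.
rewrite -[in RHS](E (A *m v j k)) (str_co_sum T); apply: eq_bigr => c _.
by rewrite mxE (str_coZ T) mulrC.
Qed.

Definition lowering h := f *m h - h *m f.

(** The value of the supertrace form on the vectors of weight zero below h and h'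
    in their copies of the adjoint module. *)
Definition pairing h h' := \tr (P *m (lowering h *m lowering h')).

Lemma pairingE h h' : pairing h h' =
  \sum_j \sum_(k < dd j) sp j * co j k (lowering h *m (lowering h' *m v j k)).
Proof.
rewrite /pairing trace_strings; apply: eq_bigr => j _; apply: eq_bigr => k _.
by rewrite -!mulmxA (co_parity S).
Qed.

Lemma str_fE j k : f *m v j k = (k%:R * ((dd j)%:R - k%:R) / 2) *: v j k.-1.
Proof.
by case: k => [|k]; rewrite ?(str_f T) // (str_f0 T) !mul0r scale0r.
Qed.

(** On V(q - 1) this is the action of -x, since [f, e] = -x. *)
Lemma lowering_diag q j k : lowering (diag_vector q) *m v j k =
  if dd j == q then (((dd j)%:R - 1) / 2 - k%:R) *: v j k else 0.
Proof.
rewrite mulmxBl -!mulmxA (diag_vectorE S) str_fE -scalemxAr (diag_vectorE S).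
case: ifP => _; last by rewrite mulmx0 scaler0 subr0.
rewrite (str_f T); case: k => [|k]; last first.
  by rewrite -scalerBl; congr (_ *: _); rewrite -!natr1; field.
by rewrite !mul0r scale0r !subr0; congr (_ *: _); field.
Qed.

Section Pair.
Variables l j : 'I_N.
Hypotheses (sl : solitary l) (sj : solitary j) (dlj : dd l = (dd j + 2)%N).
Local Notation gamma := (- (G l l / G j j)).

Lemma lowering_pair i k : lowering (pair_vector l j) *m v i k =
  if i == j then ((dd j)%:R - k%:R) *: v l k.+1 else
  if i == l then - (gamma * k%:R) *: v j k.-1 else 0.
Proof.
rewrite mulmxBl -!mulmxA !(pair_vectorE S sl sj dlj) str_fE -scalemxAr.
rewrite (pair_vectorE S sl sj dlj); case: (eqVneq i j) => [->|nij].
  rewrite (str_f T) dlj; case: k => [|k].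
    by rewrite !mul0r scale0r !subr0; congr (_ *: _); rewrite natrD; field.
  by rewrite -scalerBl; congr (_ *: _); rewrite natrD -!natr1; field.
case: (eqVneq i l) => [->|nil]; last by rewrite mulmx0 scaler0 subr0.
rewrite -scalemxAr str_fE !scalerA -scalerBl dlj natrD; congr (_ *: _).
by field; apply: (solitary_gram S).
Qed.

End Pair.

Lemma co_neq_dd j r i s : dd i != dd j -> co j r (v i s) = 0.
Proof.
move=> dij; have [le|lt] := leqP (dd i) s; first by rewrite (str_0 T) // (str_co0 T).
by rewrite (str_co T) //; case: (eqVneq j i) dij => [->|//]; rewrite eqxx.
Qed.

(** The product of the two lowered operators either vanishes on a string or sends
    it to a string of another length, so it has no diagonal entries. *)
Lemma pairing_keys qs k k' : k \in keys qs -> k' \in keys qs -> k != k' ->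
  pairing (key_vector k) (key_vector k') = 0.
Proof.
move=> kin k'in nkk'; rewrite pairingE big1 // => j _; rewrite big1 // => r' _.
suff co0 r : co j r (lowering (key_vector k) *m (lowering (key_vector k') *m v j r)) = 0.
  by rewrite co0 mulr0.
move: kin k'in nkk'; rewrite !mem_cat.
case/orP=> /mapP[q + ->]; rewrite mem_filter => /andP[qP _];
case/orP=> /mapP[q' + ->]; rewrite mem_filter => /andP[q'P _]; rewrite /key_vector /=.
- move=> nqq'; rewrite lowering_diag; case: eqP => [djq'|_]; last first.
    by rewrite mulmx0 (str_co0 T).
  rewrite -scalemxAr lowering_diag djq'; case: eqP => [qq'|_].
    by rewrite qq' eqxx in nqq'.
  by rewrite scaler0 (str_co0 T).
- move=> _; have [l [j1 [sl sj1 dj1 dl ->]]] := solitary_stepP v co q'P.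
  have dlj : dd l = (dd j1 + 2)%N by rewrite dl dj1.
  have ndlj : dd l != dd j1 by rewrite dlj -{2}[dd j1]addn0 eqn_add2l.
  rewrite lowering_pair //; case: (eqVneq j j1) => [jj1|_].
    rewrite -scalemxAr lowering_diag; case: ifP => _; last by rewrite scaler0 (str_co0 T).
    by rewrite scalerA (str_coZ T) co_neq_dd ?mulr0 // jj1.
  case: (eqVneq j l) => [jl|_]; last by rewrite mulmx0 (str_co0 T).
  rewrite -scalemxAr lowering_diag; case: ifP => _; last by rewrite scaler0 (str_co0 T).
  by rewrite scalerA (str_coZ T) co_neq_dd ?mulr0 // jl eq_sym.
- move=> _; have [l [j1 [sl sj1 dj1 dl ->]]] := solitary_stepP v co qP.
  have dlj : dd l = (dd j1 + 2)%N by rewrite dl dj1.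
  have ndlj : dd l != dd j1 by rewrite dlj -{2}[dd j1]addn0 eqn_add2l.
  rewrite lowering_diag; case: ifP => _; last by rewrite mulmx0 (str_co0 T).
  rewrite -scalemxAr lowering_pair //; case: (eqVneq j j1) => [jj1|_].
    by rewrite scalerA (str_coZ T) co_neq_dd ?mulr0 // jj1.
  case: (eqVneq j l) => [jl|_]; last by rewrite scaler0 (str_co0 T).
  by rewrite scalerA (str_coZ T) co_neq_dd ?mulr0 // jl eq_sym.
move=> nqq'.
have [l [j1 [sl sj1 dj1 dl ->]]] := solitary_stepP v co qP.
have [l' [j1' [sl' sj1' dj1' dl' ->]]] := solitary_stepP v co q'P.
have dlj : dd l = (dd j1 + 2)%N by rewrite dl dj1.
have dlj' : dd l' = (dd j1' + 2)%N by rewrite dl' dj1'.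
have {}nqq' : q != q' by apply: contraNneq nqq' => ->.
rewrite (lowering_pair sl' sj1' dlj'); case: (eqVneq j j1') => [->|_].
  rewrite -scalemxAr (lowering_pair sl sj1 dlj) (str_coZ T).
  case: (eqVneq l' j1) => [l'j1|_].
    rewrite (str_coZ T) co_neq_dd ?mulr0 // dl dj1' -dj1 -l'j1 dl'.
    by rewrite -addnA -{2}[q']addn0 eqn_add2l.
  case: (eqVneq l' l) => [l'l|_]; last by rewrite (str_co0 T) mulr0.
  by rewrite (str_coZ T) co_neq_dd ?mulr0 // dj1 dj1'.
case: (eqVneq j l') => [->|_]; last by rewrite mulmx0 (str_co0 T).
rewrite -scalemxAr (lowering_pair sl sj1 dlj) (str_coZ T).
case: (eqVneq j1' j1) => [jj|_].
  by move: nqq'; rewrite -dj1 -dj1' jj eqxx.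
case: (eqVneq j1' l) => [jl|_]; last by rewrite (str_co0 T) mulr0.
rewrite (str_coZ T) co_neq_dd ?mulr0 // dj1 dl' -dj1' jl dl.
by rewrite -addnA -{1}[q]addn0 eqn_add2l.
Qed.

Lemma sum_sqr_weights q : (1 < q)%N ->
  \sum_(k < q) ((q%:R - 1) / 2 - k%:R) * ((q%:R - 1) / 2 - k%:R) != 0 :> F.
Proof.
case: q => // q q1; rewrite big_ord_recl subr0.
have real k : ((q.+1%:R - 1) / 2 - k%:R : F) \is Num.real.
  by rewrite rpredB ?rpredM ?rpredB ?rpredV ?rpred1 ?realn.
rewrite gt_eqF // ltr_pwDl //.
  have : 0 < (q.+1%:R - 1) / 2 :> F by rewrite -natr1 addrK divr_gt0 ?ltr0n.
  by move=> h; rewrite mulr_gt0.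
apply: sumr_ge0 => k _; rewrite -expr2.
exact: real_exprn_even_ge0.
Qed.

(** For [(true, q)] the pairing is the superdimension of the multiplicity space
    times the sum of the squares of the weights of V(q - 1). For [(false, q)]
    both strings have the same parity and all diagonal entries of the product
    have the same sign, up to the common factor gamma. *)
Lemma pairing_key qs k : (forall q, q \in qs -> \sum_(j | dd j == q) sp j != 0) ->
  k \in keys qs -> pairing (key_vector k) (key_vector k) != 0.
Proof.
move=> sdim; rewrite mem_cat pairingE.
case/orP=> /mapP[q + ->]; rewrite mem_filter => /andP[qP qin]; rewrite /key_vector /=.
  rewrite (bigID (fun j => dd j == q)) /= addrC big1 ?add0r => [|j /negPf djq].
    rewrite (eq_bigr (fun j => sp j *
        \sum_(k < q) ((q%:R - 1) / 2 - k%:R) * ((q%:R - 1) / 2 - k%:R))).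
      by rewrite -mulr_suml mulf_neq0 ?sdim ?sum_sqr_weights.
    move=> j /eqP djq; rewrite -djq mulr_sumr; apply: eq_bigr => r _.
    rewrite lowering_diag eqxx -scalemxAr lowering_diag eqxx !(str_coZ T).
    by rewrite (str_co T) // !eqxx mulr1.
  apply: big1 => r _; rewrite !lowering_diag djq mulmx0 (str_co0 T) mulr0 //.
have [l [j1 [sl sj1 dj1 dl ->]]] := solitary_stepP v co qP.
have dlj : dd l = (dd j1 + 2)%N by rewrite dl dj1.
have nlj : l != j1.
  by apply/eqP => lj; move/eqP: dlj; rewrite lj -{1}[dd j1]addn0 eqn_add2l.
have dj0 := str_gt0 T j1.
rewrite (bigD1 j1) //= (bigD1 l) //= [X in _ + (_ + X)]big1 ?addr0; last first.
  move=> i /andP[nij nil]; apply: big1 => r _.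
  by rewrite lowering_pair // (negPf nij) (negPf nil) mulmx0 (str_co0 T) mulr0.
(* Up to a common factor the diagonal entries are (d - k) (k + 1) on the string
   [j1] and k (d + 1 - k) on [l], where d is the length of [j1]. *)
pose gamma : F := - (G l l / G j1 j1).
have gamma0 : gamma != 0.
  by rewrite oppr_eq0 mulf_neq0 ?invr_eq0 ?(solitary_gram S).
have spl : sp l = sp j1 by rewrite /parity_sign (solitary_parity S sl sj1 dlj).
rewrite (eq_bigr (fun k : 'I_(dd j1) => - (sp j1 * gamma) * ((dd j1 - k) * k.+1)%N%:R)); last first.
  move=> r _; rewrite !lowering_pair // eqxx -scalemxAr lowering_pair // (negPf nlj) eqxx.
  rewrite /= !(str_coZ T) (str_co T) // !eqxx mulr1 natrM natrB ?(ltnW (ltn_ord r)) //.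
  by rewrite -/gamma; ring.
rewrite [X in _ + X](eq_bigr (fun k : 'I_(dd l) => - (sp j1 * gamma) * (k * (dd l - k.+1))%N%:R)); last first.
  move=> r _; rewrite !lowering_pair // (negPf nlj) eqxx -scalemxAr lowering_pair // eqxx.
  have := ltn_ord r; case: (nat_of_ord r) => [|r'] ltr.
    by rewrite !(mulr0, oppr0, mul0r, mul0n, scale0r, str_co0 T).
  rewrite /= !(str_coZ T) (str_co T) // !eqxx mulr1 natrM natrB //.
  by rewrite -/gamma spl dlj natrD -!natr1; ring.
rewrite -!mulr_sumr -mulrDr mulf_neq0 ?oppr_eq0 ?mulf_neq0 ?signr_eq0 //.
rewrite -!natr_sum -natrD pnatr_eq0 addn_eq0 negb_and.
by rewrite (bigD1 (Ordinal dj0)) //= subn0 muln1 addn_eq0 (gtn_eqF dj0).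
Qed.

End Pairing.

(** * Copies of the adjoint module and uniqueness of the multiplicity *)

(** The linear map that sends the members of the free family [t] to those of
    [w]. *)
Definition coord_map (K : fieldType) (V W : vectType K) k (t : k.-tuple V)
  (w : 'I_k -> W) (z : V) : W := \sum_i coord t i z *: w i.

Lemma coord_map_is_linear (K : fieldType) (V W : vectType K) k (t : k.-tuple V)
  (w : 'I_k -> W) : linear (coord_map t w).
Proof.
move=> a y z; rewrite /coord_map scaler_sumr -big_split /=.
by apply: eq_bigr => i _; rewrite linearP scalerDl scalerA.
Qed.
HB.instance Definition _ (K : fieldType) (V W : vectType K) k (t : k.-tuple V)
  (w : 'I_k -> W) :=
  GRing.isLinear.Build K _ _ _ (coord_map t w) (@coord_map_is_linear K V W k t w).

Lemma coord_mapE (K : fieldType) (V W : vectType K) k (t : k.-tuple V)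
  (w : 'I_k -> W) (i : 'I_k) : free t -> coord_map t w t`_i = w i.
Proof.
move=> ft; rewrite /coord_map (bigD1 i) //= coord_free // eqxx scale1r.
rewrite big1 ?addr0 // => j ji.
by rewrite coord_free // eq_sym (negPf ji) scale0r.
Qed.

Section Multiplicity.
Variables (F : numFieldType) (m n : nat) (e x f : 'M[F]_(m + n)).
Local Notation M := 'M[F]_(m + n).
Local Notation g := (osp F m n).
Local Notation s := <<[:: e; x; f]>>%VS.
Local Notation gnat := (centralizer g s).
Local Notation ev := (@even_part F m n).
Local Notation od := (@odd_part F m n).
Hypothesis fg : f \in g.
Hypotheses (oe : od e = 0) (ox : od x = 0) (o_f : od f = 0).
Hypotheses (rel : sl2_relations e x f) (f0 : f != 0).
Local Notation highest := (highest e x gnat).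

Let xe : x *m e - e *m x = e. Proof. by case: rel. Qed.
Let xf : x *m f - f *m x = - f. Proof. by case: rel. Qed.
Let ef : e *m f - f *m e = x. Proof. by case: rel. Qed.

Lemma jacobi_even (y z w : M) : od y = 0 -> od z = 0 ->
  sbracket y (sbracket z w) = sbracket z (sbracket y w) + sbracket (y *m z - z *m y) w.
Proof.
move=> oy oz; have oyz : od (y *m z - z *m y) = 0.
  by rewrite odd_partD odd_partN !odd_mul oy oz !mulmx0 !mul0mx !addr0 subr0.
rewrite !sbracket_evenl // !(mulmxBl, mulmxBr) !mulmxA; mx_abel.
Qed.

Lemma sbracket_opp (y w : M) : sbracket (- y) w = - sbracket y w.
Proof. by rewrite -scaleN1r sbracketZl scaleN1r. Qed.

Lemma sbracket_oppr (y w : M) : sbracket y (- w) = - sbracket y w.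
Proof. by rewrite -scaleN1r sbracketZr scaleN1r. Qed.

Lemma gnat_commutes a : a \in gnat ->
  [/\ a \in g, a *m e = e *m a, a *m x = x *m a & a *m f = f *m a].
Proof. by move/in_triple_centralizer; apply. Qed.

(** The centralizer commutes with f, so with the bracket by f. *)
Lemma gnat_lower a h : a \in gnat -> sbracket a h = 0 -> sbracket a (sbracket f h) = 0.
Proof.
case/gnat_commutes=> _ _ _ af ah.
have of1 : od a *m f = f *m od a.
  have /(congr1 od) := af; rewrite !odd_mul o_f !mulmx0 !mul0mx !add0r addr0.
  by rewrite (even_id o_f).
have -> : sbracket a (sbracket f h) = f *m sbracket a h - sbracket a h *m f.
  rewrite [sbracket f h]sbracket_evenl // /sbracket odd_partD odd_partN !odd_mul o_f.
  rewrite mulmx0 mul0mx addr0 add0r (even_id o_f) !mulr2n.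
  rewrite !(mulmxBl, mulmxBr, mulmxDl, mulmxDr, mulmxN, mulNmx) !mulmxA.
  have -> : a *m f *m h = f *m a *m h by rewrite af.
  have -> : h *m f *m a = h *m a *m f by rewrite -!mulmxA af.
  have -> : od h *m f *m od a = od h *m od a *m f by rewrite -!mulmxA of1.
  by mx_abel.
by rewrite ah mulmx0 mul0mx subrr.
Qed.

(** Reversing the roles of e and f, the bracket by f raises the weight of -x, and
    a string whose first weight is -1 has length three. *)
Lemma highest_string_length h : highest g h -> h != 0 ->
  [/\ sbracket f (sbracket f (sbracket f h)) = 0 &
      free [:: h; sbracket f h; sbracket f (sbracket f h)]].
Proof.
case=> hg hN hx he h0.
have XE w : sbracket (- x) (sbracket f w) = sbracket f (sbracket (- x) w) + sbracket f w.
  have E : (- x) *m f - f *m (- x) = f by rewrite mulNmx mulmxN -opprD xf opprK.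
  have ox' : od (- x) = 0 by rewrite odd_partN ox oppr0.
  by have J := @jacobi_even (- x) f w ox' o_f; rewrite E in J.
have EY w : sbracket f (sbracket e w) = sbracket e (sbracket f w) + sbracket (- x) w.
  have E : f *m e - e *m f = - x by rewrite -ef opprB.
  by have J := @jacobi_even f e w o_f oe; rewrite E in J.
have Xh : sbracket (- x) h = (-1) *: h by rewrite sbracket_opp hx scaleN1r.
have [D [D0 muD zD nzD]] := string_length (E := sbracket f) (X := sbracket (- x))
  (Y := sbracket e) XE EY Xh he h0.
have D3 : D = 3%N.
  apply/eqP; rewrite -(eqr_nat F) -subr_eq0.
  have -> : D%:R - 3%:R = -2 * (- (D%:R - 1) / 2 + 1) :> F by field.
  by rewrite -muD addNr mulr0.
rewrite D3 in zD nzD; split; first exact: (zD 3%N).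
apply: (@eigenvectors_free _ _ (sbracket (- x)) (fun k => iter k (sbracket f) h)
  (fun k => -1 + k%:R) 3) => //.
  by move=> i j _ _ /addrI/eqP; rewrite eqr_nat => /eqP.
by move=> i _; apply: (string_weight XE Xh).
Qed.

Definition adj_copy h : {vspace M} :=
  <<[:: h; sbracket f h; sbracket f (sbracket f h)]>>%VS.

Lemma e_neq0 : e != 0.
Proof.
apply: contraNneq f0 => e0; move: ef xf; rewrite e0 mul0mx mulmx0 subrr => <-.
by rewrite mul0mx mulmx0 subrr => /eqP; rewrite eq_sym oppr_eq0.
Qed.

Lemma triple_free : free [:: e; x; f].
Proof.
have x0 : x != 0.
  apply: contraNneq f0 => x0; move: xf; rewrite x0 mul0mx mulmx0 subrr => /eqP.
  by rewrite eq_sym oppr_eq0.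
apply: (@eigenvectors_free _ _ (sbracket x) (fun k => nth 0 [:: e; x; f] k)
  (fun k => 1 - k%:R) 3).
- move=> i j _ _ /addrI/oppr_inj/eqP; rewrite eqr_nat => /eqP //.
- case=> [|[|[|//]]] _ /=; rewrite sbracket_evenl // ?xe ?xf ?subrr ?scale0r ?subr0 ?scale1r //.
  by rewrite -scaleN1r; congr (_ *: _); ring.
- by case=> [|[|[|//]]] _ /=; rewrite ?e_neq0.
Qed.

Lemma highest_relations h : highest g h ->
  [/\ sbracket x (sbracket f h) = 0,
      sbracket x (sbracket f (sbracket f h)) = - sbracket f (sbracket f h),
      sbracket e (sbracket f h) = h &
      sbracket e (sbracket f (sbracket f h)) = sbracket f h].
Proof.
case=> hg hN hx he.
have x1 : sbracket x (sbracket f h) = 0.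
  by rewrite (@jacobi_even x f h) // xf hx sbracket_opp addrN.
have e1 : sbracket e (sbracket f h) = h.
  by rewrite (@jacobi_even e f h) // ef hx he sbracket0r add0r.
split; [exact: x1| |exact: e1|].
  by rewrite (@jacobi_even x f (sbracket f h)) // xf x1 sbracket0r add0r sbracket_opp.
by rewrite (@jacobi_even e f (sbracket f h)) // ef x1 e1 addr0.
Qed.

Lemma triple_map (a b c : M) :
  exists phi : 'End(M), [/\ phi e = a, phi x = b & phi f = c].
Proof.
pose t3 : 3.-tuple M := [tuple e; x; f].
exists (linfun (coord_map t3 (fun i => [:: a; b; c]`_i))); rewrite !lfunE; split.
- exact: (coord_mapE _ (0 : 'I_3) triple_free).
- exact: (coord_mapE _ (1 : 'I_3) triple_free).
- exact: (coord_mapE _ (2 : 'I_3) triple_free).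
Qed.

Lemma triple_table :
  [/\ sbracket e e = 0, sbracket e x = - e & sbracket e f = x] /\
  [/\ sbracket x e = e, sbracket x x = 0 & sbracket x f = - f] /\
  [/\ sbracket f e = - x, sbracket f x = f & sbracket f f = 0].
Proof.
rewrite !sbracket_evenl // !subrr xe xf ef.
have -> : e *m x - x *m e = - e by rewrite -[RHS](congr1 -%R xe) opprB.
have -> : f *m e - e *m f = - x by rewrite -[RHS](congr1 -%R ef) opprB.
by have -> : f *m x - x *m f = f by rewrite -[LHS]opprB xf opprK.
Qed.

Lemma triple_equivariant (phi : 'End(M)) :
  (forall y z, y \in [:: e; x; f] -> z \in [:: e; x; f] ->
     phi (sbracket y z) = sbracket y (phi z)) ->
  forall y z, y \in s -> z \in s -> phi (sbracket y z) = sbracket y (phi z).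
Proof.
have lin3 (a b c : M) (t : F * F * F) : 
    phi (t.1.1 *: a + t.1.2 *: b + t.2 *: c) =
    t.1.1 *: phi a + t.1.2 *: phi b + t.2 *: phi c.
  by rewrite !linearD !linearZ.
move=> H; have H1 y z : y \in [:: e; x; f] -> z \in s ->
    phi (sbracket y z) = sbracket y (phi z).
  move=> yin /span3P[t ->]; rewrite lin3 !(sbracketDr, sbracketZr) lin3.
  by rewrite !H // !inE eqxx ?orbT.
move=> _ z /span3P[t ->] zs; rewrite !(sbracketDl, sbracketZl) lin3.
by rewrite !H1 // !inE eqxx ?orbT.
Qed.

Lemma span3_closed (a b c : M) (T : M -> M) :
  (forall k y z, T (k *: y + z) = k *: T y + T z) ->
  (forall y, y \in [:: a; b; c] -> T y \in <<[:: a; b; c]>>%VS) ->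
  forall y, y \in <<[:: a; b; c]>>%VS -> T y \in <<[:: a; b; c]>>%VS.
Proof.
move=> lT H y /span3P[t ->]; have T0 : T 0 = 0.
  by have := lT (-1) 0 0; rewrite scaler0 addr0 scaleN1r addNr.
have -> : t.2 *: c = t.2 *: c + 0 by rewrite addr0.
by rewrite -addrA !lT T0 addr0 !rpredD ?rpredZ ?H // !inE eqxx ?orbT.
Qed.

Lemma triple_closed y z : y \in s -> z \in s -> sbracket y z \in s.
Proof.
have [[ee ex ef'] [[xe' xx xf'] [fe fx ff]]] := triple_table.
move=> yS zS; move: y yS; apply: (span3_closed (T := sbracketr z)).
  by move=> k y w; rewrite /sbracketr sbracketDl sbracketZl.
move=> y yin; rewrite /sbracketr; move: z zS; apply: span3_closed.
  by move=> k z w; rewrite sbracketDr sbracketZr.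
have S3 w : w \in [:: e; x; f] -> w \in s by move=> ?; apply: memv_span.
have [eS xS fS] : [/\ e \in s, x \in s & f \in s].
  by split; apply: S3; rewrite !inE eqxx ?orbT.
move=> z; move: yin; rewrite !inE.
by case/or3P=> /eqP->; case/or3P=> /eqP->;
  rewrite (ee, ex, ef', xe', xx, xf', fe, fx, ff) ?memvN ?mem0v.
Qed.

(** The isomorphism sends e, x, f to w0, -w1, -w2, in accordance with
    [f, e] = -x and [f, -x] = -f. *)
Lemma adj_copy_submodule (w0 w1 w2 : M) : free [:: w0; w1; w2] ->
  (forall w, w \in [:: w0; w1; w2] -> w \in g /\
     forall a, a \in gnat -> sbracket a w = 0) ->
  (forall w, w \in [:: w0; w1; w2] -> ev w = 0) \/
  (forall w, w \in [:: w0; w1; w2] -> od w = 0) ->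
  [/\ sbracket e w0 = 0, sbracket x w0 = w0 & sbracket f w0 = w1] ->
  [/\ sbracket e w1 = w0, sbracket x w1 = 0 & sbracket f w1 = w2] ->
  [/\ sbracket e w2 = w1, sbracket x w2 = - w2 & sbracket f w2 = 0] ->
  triv_adj_submodule gnat s g <<[:: w0; w1; w2]>>.
Proof.
move=> fr wg hom [e0 x0 f0'] [e1 x1 f1] [e2 x2 f2].
have [phi [phie phix phif]] := triple_map w0 (- w1) (- w2).
have [[ee ex ef'] [[xe' xx xf'] [fe fx ff]]] := triple_table.
have lin3 (a b c : M) (t : F * F * F) :
    phi (t.1.1 *: a + t.1.2 *: b + t.2 *: c) =
    t.1.1 *: phi a + t.1.2 *: phi b + t.2 *: phi c.
  by rewrite !linearD !linearZ.
have phi_s : forall y z, y \in s -> z \in s -> phi (sbracket y z) = sbracket y (phi z).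
  apply: triple_equivariant => y z; rewrite !inE.
  by case/or3P=> /eqP->; case/or3P=> /eqP->;
    rewrite ?(phie, phix, phif, ee, ex, ef', xe', xx, xf', fe, fx, ff) ?linearN ?linear0 /=
      ?(phie, phix, phif) ?sbracket_oppr ?(e0, x0, f0', e1, x1, f1, e2, x2, f2) ?oppr0 ?opprK.
have wU i : (i < 3)%N -> [:: w0; w1; w2]`_i \in <<[:: w0; w1; w2]>>%VS.
  by move=> lt; apply: memv_span; apply: mem_nth.
have img : (phi @: s)%VS = <<[:: w0; w1; w2]>>%VS.
  rewrite limg_span /= phie phix phif; apply/eqP; rewrite eqEsubv.
  apply/andP; split; apply/span_subvP => w; rewrite !inE => /or3P[]/eqP->.
  - exact: (wU 0%N).
  - by rewrite memvN; apply: (wU 1%N).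
  - by rewrite memvN; apply: (wU 2%N).
  - by apply: memv_span; rewrite !inE eqxx.
  - by rewrite -memvN; apply: memv_span; rewrite !inE eqxx orbT.
  - by rewrite -memvN; apply: memv_span; rewrite !inE eqxx !orbT.
have aw a w : a \in gnat -> w \in <<[:: w0; w1; w2]>>%VS -> sbracket a w = 0.
  move=> aN /span3P[t ->]; rewrite !(sbracketDr, sbracketZr).
  have z w' : w' \in [:: w0; w1; w2] -> sbracket a w' = 0.
    by move=> w'in; case: (wg w' w'in) => _; apply.
  by rewrite !z ?scaler0 ?addr0 // !inE eqxx ?orbT.
split; last first.
  exists phi; split=> //.
    apply/eqP; rewrite -subv0; apply/subvP => z /memv_capP[/span3P[t ->]].
    rewrite memv_ker lin3 phie phix phif memv0 => /eqP t0.
    have /freeP/(_ (fun i => [:: t.1.1; - t.1.2; - t.2]`_i)) := fr : free [tuple w0; w1; w2].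
    rewrite !big_ord_recr big_ord0 /= add0r !scaleNr -!scalerN => /(_ t0) c0.
    have := c0 (0 : 'I_3); have := c0 (1 : 'I_3); have := c0 (2 : 'I_3) => /=.
    move=> /eqP; rewrite oppr_eq0 => /eqP-> /eqP; rewrite oppr_eq0 => /eqP-> ->.
    by rewrite !scale0r !addr0.
  move=> a y z aN yS zS; rewrite phi_s // sbracketDl.
  have pz : phi z \in <<[:: w0; w1; w2]>>%VS by rewrite -img memv_img.
  by rewrite (aw a _ aN pz) add0r.
split.
- by apply/span_subvP => w /wg[].
- move=> w /span3P[t ->]; rewrite !even_partD !even_partZ.
  case: hom => [hev|hod].
    by rewrite !hev ?scaler0 ?addr0 ?mem0v // !inE eqxx ?orbT.
  rewrite !even_id ?hod ?inE ?eqxx ?orbT //.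
  by apply/span3P; exists t.
move=> _ w /memv_addP[a aN [y yS ->]] wU'.
rewrite sbracketDl (aw a _ aN wU') add0r.
move: wU'; rewrite -img => /memv_imgP[z zS ->]; rewrite -phi_s // memv_img //.
exact: triple_closed.
Qed.

Lemma adj_copyP h : highest g h -> h != 0 -> (ev h = 0 \/ od h = 0) ->
  triv_adj_submodule gnat s g (adj_copy h).
Proof.
move=> hh h0 hom; have [f3 fr] := highest_string_length hh h0.
have [hg hN hx he] := hh.
have [x1 x2 e1 e2] := highest_relations hh.
have a1 a : a \in gnat -> sbracket a (sbracket f h) = 0.
  by move=> aN; apply: gnat_lower aN (hN a aN).
have a2 a : a \in gnat -> sbracket a (sbracket f (sbracket f h)) = 0.
  by move=> aN; apply: gnat_lower aN (a1 a aN).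
have g1 : sbracket f h \in g by apply: osp_sbracket.
have g2 : sbracket f (sbracket f h) \in g by apply: osp_sbracket.
have lower_ev w : ev w = 0 -> ev (sbracket f w) = 0.
  by move=> w0; rewrite even_sbracket o_f w0 !mul0mx !mulmx0 subrr !addr0.
have lower_od w : od w = 0 -> od (sbracket f w) = 0.
  by move=> w0; rewrite odd_sbracket o_f w0 !mul0mx !mulmx0 subrr !addr0.
apply: adj_copy_submodule => //.
- by move=> w; rewrite !inE => /or3P[]/eqP->.
case: hom => w0; [left|right] => w; rewrite !inE => /or3P[]/eqP->.
- exact: w0.
- exact: (lower_ev _ w0).
- exact: (lower_ev _ (lower_ev _ w0)).
- exact: w0.
- exact: (lower_od _ w0).
- exact: (lower_od _ (lower_od _ w0)).
Qed.

Lemma directv_zero k (W' : {vspace M}) (W : 'I_k -> {vspace M}) u' (u : 'I_k -> M) :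
  directv (W' + \sum_i W i) -> u' \in W' -> (forall i, u i \in W i) ->
  u' + \sum_i u i = 0 -> u' = 0 /\ forall i, u i = 0.
Proof.
rewrite directv_addE /= => /and3P[_ dW /eqP cap] u'W uW s0.
have u'0 : u' = 0.
  apply/eqP; rewrite -memv0 -cap memv_cap u'W /=.
  move/eqP: s0; rewrite addr_eq0 => /eqP->; rewrite memvN.
  by apply: memv_sumr.
split=> // i; move: s0; rewrite u'0 add0r => s0.
have /directv_sum_independent ind := dW.
by apply: (ind u).
Qed.

(** The highest vector is the image of e, the only element of the triple of weight
    one up to scalars. *)
Lemma triv_adj_highest U : triv_adj_submodule gnat s g U ->
  exists h, [/\ h \in U, h != 0, highest g h &
    forall w, w \in U -> highest g w -> w \in <[h]>%VS].
Proof.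
case=> -[Ug gU _] [phi [img inj act]].
have S3 w : w \in [:: e; x; f] -> w \in s by move=> ?; apply: memv_span.
have [eS xS fS] : [/\ e \in s, x \in s & f \in s].
  by split; apply: S3; rewrite !inE eqxx ?orbT.
have [[ee ex ef'] [[xe' xx xf'] [fe fx ff]]] := triple_table.
have inj0 z : z \in s -> phi z = 0 -> z = 0.
  by move=> zS z0; apply/eqP; rewrite -memv0 -inj memv_cap zS memv_ker z0 /=.
have act_s y z : y \in s -> z \in s -> phi (sbracket y z) = sbracket y (phi z).
  by move=> yS zS; have := act 0 y z (mem0v _) yS zS; rewrite add0r.
have act_a a z : a \in gnat -> z \in s -> sbracket a (phi z) = 0.
  move=> aN zS; have := act a 0 z aN (mem0v _) zS.
  by rewrite sbracket0l linear0 addr0.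
have pU z : z \in s -> phi z \in U by move=> zS; rewrite -img memv_img.
exists (phi e); split.
- exact: pU.
- by apply: contraNneq e_neq0 => /(inj0 _ eS)->.
- split; first exact: (subvP Ug _ (pU e eS)).
  + by move=> a aN; apply: act_a.
  + by rewrite -act_s // xe'.
  + by rewrite -act_s // ee linear0.
move=> w; rewrite -img => /memv_imgP[z zS ->] [_ _ xz _].
have : z = sbracket x z.
  apply/eqP; rewrite -subr_eq0; apply/eqP; apply: inj0.
    by rewrite rpredB // triple_closed.
  by rewrite linearB /= act_s // xz subrr.
move/span3P: zS => [t ->]; rewrite !(sbracketDr, sbracketZr) xe' xx xf' scaler0 addr0.
rewrite scalerN -addrA => /addrI/eqP; rewrite -subr_eq0 opprK.
have /freeP/(_ (fun i => [:: 0; t.1.2; t.2 + t.2]`_i)) := triple_free : free [tuple e; x; f].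
rewrite !big_ord_recr big_ord0 /= !add0r scale0r add0r scalerDl => c0 /eqP t0.
have {}c0 : _ := c0 (etrans (addrA _ _ _) t0).
have /= t1 := c0 (1 : 'I_3); have := c0 (2 : 'I_3); rewrite /= -mulr2n => /eqP.
rewrite mulrn_eq0 /= => /eqP t2; rewrite t2 t1 !scale0r !addr0 linearZ /=.
by rewrite memvZ // memv_line.
Qed.

(** Every summand is stable, so the components of a highest vector are highest.
    In a copy this leaves a line, and in the remaining summand zero, since the
    even and odd parts of such a component would otherwise generate a copy. *)
Lemma multiplicity_highest_basis k : triv_adj_multiplicity gnat s g k ->
  exists hs : k.-tuple M, free hs /\
    forall h, highest g h <-> h \in <<hs>>%VS.
Proof.
case=> W [W' [dW sW tW W'sub noU]].
have /fin_all_exists[h hP] i := triv_adj_highest (tW i).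
have sz : size (mkseq (fun i => if insub i is Some j then h j else 0) k) == k.
  by rewrite size_mkseq.
pose hs := Tuple sz.
have hsE (i : 'I_k) : hs`_i = h i by rewrite nth_mkseq // valK.
exists hs; split.
  apply/freeP => c; under eq_bigr do rewrite hsE; move=> c0 i.
  have := @directv_zero k W' W 0 (fun i => c i *: h i) dW (mem0v _).
  rewrite add0r => /(_ _ c0)[i'|_ /(_ i)/eqP].
    by case: (hP i') => hU _ _ _; rewrite memvZ.
  by rewrite scaler_eq0; case: (hP i) => _ /negPf-> _ _; rewrite orbF => /eqP.
move=> w; split; last first.
  move=> /coord_span->; elim/big_rec: _ => [|i y _ hy]; first exact: highest0.
  by apply: highest_lin hy; rewrite hsE; case: (hP i).
move=> hw; have [wg wN wx we] := hw.
move: (wg); rewrite -sW => /memv_addP[w' w'W [_ /memv_sumP[u uW ->] wE]].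
have uW' i : u i \in W i by apply: uW.
have [W'g gW' W's] := W'sub.
(* The decomposition is stable, so the components of w are eigenvectors as soon
   as w is. *)
have stab (y : M) : (forall U, submodule (gnat + s) g U -> forall w, w \in U -> sbracket y w \in U) ->
    forall c, sbracket y w = c *: w -> sbracket y w' = c *: w' /\
      forall i, sbracket y (u i) = c *: u i.
  move=> yst c yw; have [|||E1 E2] := @directv_zero k W' W (sbracket y w' - c *: w')
    (fun i => sbracket y (u i) - c *: u i) dW.
  - by rewrite rpredB ?rpredZ // yst.
  - by move=> i; rewrite rpredB ?rpredZ // yst //; case: (tW i).
  - move: yw; rewrite wE sbracketDr scalerDr.
    have -> : sbracket y (\sum_i u i) = \sum_i sbracket y (u i) by apply: linear_sum.
    rewrite scaler_sumr sumrB => /eqP; rewrite -subr_eq0 => /eqP E.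
    by rewrite -[RHS]E opprD addrACA.
  split; first by apply/eqP; rewrite -subr_eq0 E1.
  by move=> i; apply/eqP; rewrite -subr_eq0 E2.
have stS y : y \in s -> forall U, submodule (gnat + s) g U -> forall w, w \in U -> sbracket y w \in U.
  by move=> yS U [_ _ cl] z zU; apply: cl => //; rewrite -[y]add0r memv_add ?mem0v.
have stN a : a \in gnat -> forall U, submodule (gnat + s) g U -> forall w, w \in U -> sbracket a w \in U.
  by move=> aN U [_ _ cl] z zU; apply: cl => //; rewrite -[a]addr0 memv_add ?mem0v.
have S3 z : z \in [:: e; x; f] -> z \in s by move=> ?; apply: memv_span.
have [eS xS fS] : [/\ e \in s, x \in s & f \in s].
  by split; apply: S3; rewrite !inE eqxx ?orbT.
have wx1 : sbracket x w = 1 *: w by rewrite scale1r.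
have we0 : sbracket e w = 0 *: w by rewrite scale0r.
have [x' xu] := stab x (stS x xS) 1 wx1.
have [e' eu] := stab e (stS e eS) 0 we0.
have Nwu a : a \in gnat -> sbracket a w' = 0 /\ forall i, sbracket a (u i) = 0.
  move=> aN; have wa0 : sbracket a w = 0 *: w by rewrite scale0r wN.
  have [a' au] := stab a (stN a aN) 0 wa0.
  by split=> [|i]; rewrite ?a' ?au scale0r.
have hu i : highest g (u i).
  split; rewrite ?xu ?eu ?scale1r ?scale0r //.
    by case: (tW i) => -[/subvP Wg _ _] _; apply: Wg.
  by move=> a /Nwu[].
have hw' : highest g w'.
  split; rewrite ?x' ?e' ?scale1r ?scale0r //; first exact: (subvP W'g).
  by move=> a /Nwu[].
(* The complement contains no copy, hence no homogeneous highest vector. *)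
have nohom z : z \in W' -> highest g z -> (ev z = 0 \/ od z = 0) -> z = 0.
  move=> zW hz homz; apply/eqP; apply: contraT => z0.
  case: (noU (adj_copy z)); last exact: adj_copyP.
  apply/span_subvP => y; rewrite !inE => /or3P[]/eqP-> //.
    exact: (stS f fS).
  by do 2!apply: (stS f fS) => //.
have gg := osp_graded (F := F) (m := m) (n := n).
have gN := centralizer_graded oe ox o_f gg.
have w'0 : w' = 0.
  have e0 : ev w' = 0.
    apply: nohom (gW' _ w'W) (highest_even oe ox gN gg hw') _.
    by right; apply: odd_even.
  have o0 : od w' = 0.
    apply: nohom (graded_odd gW' w'W) (highest_odd oe ox gN gg hw') _.
    by left; apply: even_odd.
  by rewrite -[w']even_addodd e0 o0 addr0.
rewrite wE w'0 add0r; apply: rpred_sum => i _.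
have [_ _ _ /(_ _ (uW' i) (hu i))/vlineP[c ->]] := hP i.
by rewrite memvZ // -hsE memv_span // mem_nth // size_tuple.
Qed.

Lemma triv_adj_multiplicity_unique k k' :
  triv_adj_multiplicity gnat s g k -> triv_adj_multiplicity gnat s g k' -> k = k'.
Proof.
move=> /multiplicity_highest_basis[hs [/eqP f1 s1]] /multiplicity_highest_basis[hs' [/eqP f2 s2]].
move: f1 f2; rewrite !size_tuple => <- <-; congr (\dim _).
by apply/vspaceP => h; apply/idP/idP => [/s1/s2|/s2/s1].
Qed.

End Multiplicity.

(** * The orthogonal complement of the copies *)

Section Supertrace.
Variables (F : numFieldType) (m n : nat).
Local Notation M := 'M[F]_(m + n).
Local Notation P := (parity_mx F m n).
Local Notation ev := (@even_part F m n).
Local Notation od := (@odd_part F m n).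

(** The supertrace form; it is invariant for the bracket. *)
Definition sform (X Y : M) : F := \tr (P *m (X *m Y)).

Lemma traceN (A : M) : \tr (- A) = - \tr A.
Proof. by rewrite -scaleN1r mxtraceZ mulN1r. Qed.
Lemma traceB (A C : M) : \tr (A - C) = \tr A - \tr C.
Proof. by rewrite mxtraceD traceN. Qed.

Lemma sformDr X Y Z : sform X (Y + Z) = sform X Y + sform X Z.
Proof. by rewrite /sform !mulmxDr mxtraceD. Qed.
Lemma sformZr a X Y : sform X (a *: Y) = a * sform X Y.
Proof. by rewrite /sform -!scalemxAr mxtraceZ. Qed.
Lemma sformNr X Y : sform X (- Y) = - sform X Y.
Proof. by rewrite -scaleN1r sformZr mulN1r. Qed.
Lemma sform0r X : sform X 0 = 0.
Proof. by rewrite /sform !mulmx0 mxtrace0. Qed.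
Lemma sformNl X Y : sform (- X) Y = - sform X Y.
Proof. by rewrite /sform mulNmx mulmxN traceN. Qed.
Lemma sform0l X : sform 0 X = 0.
Proof. by rewrite /sform !(mul0mx, mulmx0) mxtrace0. Qed.
Lemma sform_sumr X I (r : seq I) (Q : pred I) (Y : I -> M) :
  sform X (\sum_(i <- r | Q i) Y i) = \sum_(i <- r | Q i) sform X (Y i).
Proof. by elim/big_rec2: _ => [|i y1 y2 _ <-]; rewrite ?sform0r ?sformDr. Qed.

Definition sform_functional (X : M) : M -> F^o := sform X.

Lemma sform_functional_is_linear X : linear (sform_functional X).
Proof. by move=> a Y Z; rewrite /sform_functional sformDr sformZr. Qed.
HB.instance Definition _ X :=
  GRing.isLinear.Build F M F^o _ (sform_functional X) (sform_functional_is_linear X).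

Definition orthogonal_to (X : M) : {vspace M} := lker (linfun (sform_functional X)).

Lemma mem_orthogonal_to X Y : (Y \in orthogonal_to X) = (sform X Y == 0).
Proof. by rewrite memv_ker lfunE. Qed.

Lemma sform_bracket y X Y : od y = 0 ->
  sform (sbracket y X) Y = - sform X (sbracket y Y).
Proof.
move=> oy; rewrite !sbracket_evenl // /sform.
have Py : P *m y = y *m P by rewrite -(even_id oy) parity_even.
rewrite mulmxBl !mulmxBr !traceB opprB; congr (_ - _); last by rewrite !mulmxA.
by rewrite !mulmxA Py -!mulmxA mxtrace_mulC !mulmxA.
Qed.

Lemma sform_even w Y : od w = 0 -> sform w (ev Y) = sform w Y.
Proof.
move=> ow; rewrite -[in RHS](even_addodd Y) sformDr.
rewrite [X in _ + X](_ : _ = 0) ?addr0 //.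
have : sform w (od Y) = - sform w (od Y).
  rewrite {1}/sform mulmxA -{1}(even_id ow) parity_even (even_id ow).
  rewrite -mulmxA parity_odd mulmxN traceN mulmxA mxtrace_mulC.
  by rewrite /sform mulmxA.
by move/eqP; rewrite -subr_eq0 opprK -mulr2n mulrn_eq0 => /eqP.
Qed.

(** Invariance of the form, for an even w that commutes with a; it is proved
    for the even and odd parts of a separately because of the signs. *)
Lemma sform_commuting w a Y : od w = 0 -> sbracket a w = 0 -> sform w (sbracket a Y) = 0.
Proof.
move=> ow aw.
have aw' : a *m w = w *m a.
  by move: aw; rewrite sbracket_evenr // => /eqP; rewrite subr_eq0 => /eqP.
have ea : ev a *m w = w *m ev a.
  have /(congr1 ev) := aw'; rewrite !even_mul ow mulmx0 mul0mx !addr0.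
  by rewrite (even_id ow).
have oa : od a *m w = w *m od a.
  have /(congr1 od) := aw'; rewrite !odd_mul ow mulmx0 mul0mx add0r addr0.
  by rewrite (even_id ow).
have Pw : P *m w = w *m P by rewrite -(even_id ow) parity_even.
have E0 (Z : M) : sform w (ev a *m Z - Z *m ev a) = 0.
  rewrite /sform mulmxBr mulmxBr traceB; apply/eqP; rewrite subr_eq0; apply/eqP.
  rewrite !mulmxA [RHS]mxtrace_mulC !mulmxA -parity_even.
  by rewrite -(mulmxA P (ev a)) ea mulmxA.
have E1 (Z : M) : sform w (od a *m Z + Z *m od a) = 0.
  rewrite /sform mulmxDr mulmxDr mxtraceD; apply/eqP; rewrite addr_eq0; apply/eqP.
  rewrite !mulmxA [in RHS]mxtrace_mulC !mulmxA.
  have -> : od a *m P = - (P *m od a) by rewrite parity_odd opprK.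
  by rewrite !mulNmx traceN opprK -(mulmxA P (od a)) oa mulmxA.
have E2 : sform w (od a *m ev Y - ev Y *m od a) = 0.
  rewrite -(sform_even _ ow) (_ : ev _ = 0) ?sform0r //.
  rewrite even_partD even_partN !even_mul even_even odd_odd even_odd odd_even.
  by rewrite !(mul0mx, mulmx0, addr0, subr0).
by rewrite sbracketE (sformDr w (_ + _)) (sformDr w (_ - _)) E0 E2 E1 !addr0.
Qed.

End Supertrace.

Section Complement.
Variables (F : numFieldType) (m n : nat) (e x f : 'M[F]_(m + n)).
Local Notation M := 'M[F]_(m + n).
Local Notation g := (osp F m n).
Local Notation s := <<[:: e; x; f]>>%VS.
Local Notation gnat := (centralizer g s).
Local Notation od := (@odd_part F m n).
Hypotheses (eg : e \in g) (xg : x \in g) (fg : f \in g).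
Hypotheses (oe : od e = 0) (ox : od x = 0) (o_f : od f = 0).
Hypotheses (rel : sl2_relations e x f) (f0 : f != 0).
Local Notation highest := (highest e x gnat).

Variables (k : nat) (hs hs1 hs2 : 'I_k -> M).
Hypotheses (hs1E : forall i, sbracket f (hs i) = hs1 i)
  (hs2E : forall i, sbracket f (hs1 i) = hs2 i).
Hypotheses (hsP : forall i, highest g (hs i)) (hs_even : forall i, od (hs i) = 0).
Hypotheses (pair0 : forall i j, i != j -> pairing f (hs i) (hs j) = 0).
Hypotheses (pair1 : forall i, pairing f (hs i) (hs i) != 0).
Hypothesis spanning : forall h, highest g h -> exists c, h = \sum_i c i *: hs i.

Let c i := pairing f (hs i) (hs i).

Let hs_neq0 i : hs i != 0.
Proof.
apply: contraNneq (pair1 i) => ->.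
by rewrite /pairing /lowering mulmx0 mul0mx subrr !mulmx0 mxtrace0.
Qed.

Let even_lower w : od w = 0 -> od (sbracket f w) = 0.
Proof. by move=> w0; rewrite odd_sbracket o_f w0 !mul0mx !mulmx0 subrr !addr0. Qed.

Let hs1_even i : od (hs1 i) = 0. Proof. by rewrite -hs1E even_lower. Qed.
Let hs2_even i : od (hs2 i) = 0. Proof. by rewrite -hs2E even_lower. Qed.

Let sform11 i j : sform (hs1 i) (hs1 j) = if i == j then c j else 0.
Proof.
have -> : sform (hs1 i) (hs1 j) = pairing f (hs i) (hs j).
  by rewrite -!hs1E /sform !sbracket_evenl.
by case: (eqVneq i j) => [->|/pair0].
Qed.

Let sform02 i j : sform (hs i) (hs2 j) = if i == j then - c j else 0.
Proof.
have -> : sform (hs i) (hs2 j) = - sform (hs1 i) (hs1 j).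
  by rewrite -hs2E -[X in - sform X _]hs1E (@sform_bracket _ _ _ f (hs i)) // opprK.
by rewrite sform11; case: ifP; rewrite ?oppr0.
Qed.

Let sform20 i j : sform (hs2 i) (hs j) = if i == j then - c j else 0.
Proof.
have -> : sform (hs2 i) (hs j) = - sform (hs1 i) (hs1 j).
  by rewrite -hs2E (@sform_bracket _ _ _ f (hs1 i)) // hs1E.
by rewrite sform11; case: ifP; rewrite ?oppr0.
Qed.

Let weight w w' (a b : F) : sbracket x w = a *: w -> sbracket x w' = b *: w' ->
  a + b != 0 -> sform w w' = 0.
Proof.
move=> xw xw' ab; have := @sform_bracket _ _ _ x w w' ox.
rewrite xw xw' sformZr {1}/sform -scalemxAl -scalemxAr mxtraceZ -/(sform w w').
move/eqP; rewrite -subr_eq0 opprK -mulrDl mulf_eq0 (negPf ab) /=.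
by move/eqP.
Qed.

Let xhs i : sbracket x (hs i) = 1 *: hs i.
Proof. by case: (hsP i) => _ _ -> _; rewrite scale1r. Qed.
Let rels i : [/\ sbracket x (hs1 i) = 0, sbracket x (hs2 i) = - hs2 i,
  sbracket e (hs1 i) = hs i & sbracket e (hs2 i) = hs1 i].
Proof. by rewrite -hs2E -hs1E; apply: (highest_relations oe ox o_f rel (hsP i)). Qed.

Let xhs1 i : sbracket x (hs1 i) = 0 *: hs1 i.
Proof. by have [-> _ _ _] := rels i; rewrite scale0r. Qed.
Let xhs2 i : sbracket x (hs2 i) = (-1) *: hs2 i.
Proof. by have [_ -> _ _] := rels i; rewrite scaleN1r. Qed.

Let table i j :
  [/\ sform (hs i) (hs j) = 0, sform (hs i) (hs1 j) = 0,
      sform (hs1 i) (hs j) = 0, sform (hs1 i) (hs2 j) = 0 &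
      sform (hs2 i) (hs1 j) = 0 /\ sform (hs2 i) (hs2 j) = 0].
Proof.
have n2 : 1 + 1 != 0 :> F by rewrite -[_ + _]/(2%:R) pnatr_eq0.
split.
- exact: (weight (xhs i) (xhs j) n2).
- by apply: (weight (xhs i) (xhs1 j)); rewrite addr0 oner_neq0.
- by apply: (weight (xhs1 i) (xhs j)); rewrite add0r oner_neq0.
- by apply: (weight (xhs1 i) (xhs2 j)); rewrite add0r oppr_eq0 oner_neq0.
split.
  by apply: (weight (xhs2 i) (xhs1 j)); rewrite addr0 oppr_eq0 oner_neq0.
by apply: (weight (xhs2 i) (xhs2 j)); rewrite -opprD oppr_eq0.
Qed.

Let pr i (Y : M) : M := (c i)^-1 *: (sform (hs1 i) Y *: hs1 i
  - sform (hs2 i) Y *: hs i - sform (hs i) Y *: hs2 i).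

Let prD i Y Z : pr i (Y + Z) = pr i Y + pr i Z.
Proof.
rewrite /pr !sformDr !scalerDl -scalerDr; congr (_ *: _).
by rewrite !opprD [RHS]addrACA [in RHS](addrACA (sform (hs1 i) Y *: _)).
Qed.

Let prZ i a Y : pr i (a *: Y) = a *: pr i Y.
Proof.
rewrite /pr !sformZr [RHS]scalerA [a * _^-1]mulrC -[RHS]scalerA; congr (_ *: _).
by rewrite !scalerBr !scalerA.
Qed.

Let pr_sum i (r : seq 'I_k) (u : 'I_k -> M) :
  pr i (\sum_(j <- r) u j) = \sum_(j <- r) pr i (u j).
Proof.
elim/big_rec2: _ => [|j y1 y2 _ <-]; last by rewrite prD.
by rewrite /pr !sform0r !scale0r !subr0 scaler0.
Qed.

Let W i := <<[:: hs i; hs1 i; hs2 i]>>%VS.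

Let prW i j w : w \in W j -> pr i w = if i == j then w else 0.
Proof.
case/span3P=> t ->; rewrite !prD !prZ.
have [t00 t01 t10 t12 [t21 t22]] := table i j.
have p0 : pr i (hs j) = if i == j then hs j else 0.
  rewrite /pr t10 t00 sform20 !scale0r sub0r subr0; case: eqP => [->|_].
    by rewrite scaleNr opprK scalerA mulVf ?scale1r ?pair1.
  by rewrite scale0r oppr0 scaler0.
have p1 : pr i (hs1 j) = if i == j then hs1 j else 0.
  rewrite /pr t01 t21 sform11 !scale0r !subr0; case: eqP => [->|_].
    by rewrite scalerA mulVf ?scale1r ?pair1.
  by rewrite scale0r scaler0.
have p2 : pr i (hs2 j) = if i == j then hs2 j else 0.
  rewrite /pr t12 t22 sform02 !scale0r subr0 sub0r; case: eqP => [->|_].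
    by rewrite scaleNr opprK scalerA mulVf ?scale1r ?pair1.
  by rewrite scale0r oppr0 scaler0.
by rewrite p0 p1 p2; case: eqP => _; rewrite // !scaler0 !addr0.
Qed.

Let W' : {vspace M} :=
  (g :&: \bigcap_i (orthogonal_to (hs i) :&: (orthogonal_to (hs1 i) :&: orthogonal_to (hs2 i))))%VS.

Let W'P Y : reflect (Y \in g /\ forall i, [/\ sform (hs i) Y = 0,
    sform (hs1 i) Y = 0 & sform (hs2 i) Y = 0]) (Y \in W').
Proof.
have orthP w : reflect (sform w Y = 0) (Y \in orthogonal_to w).
  by rewrite mem_orthogonal_to; apply: eqP.
apply: (iffP memv_capP) => -[Yg H]; split; try exact: Yg.
  move=> i; move: H; rewrite memvE => /subv_bigcapP/(_ i isT).
  rewrite -memvE => /memv_capP [/orthP H0 /memv_capP[/orthP H1 /orthP H2]].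
  by split.
rewrite memvE; apply/subv_bigcapP => i _; rewrite -memvE.
have [H0 H1 H2] := H i.
apply/memv_capP; split; first exact/orthP.
by apply/memv_capP; split; apply/orthP.
Qed.

Let W_osp i : (W i <= g)%VS.
Proof.
have hg : hs i \in g by case: (hsP i).
have hg1 : hs1 i \in g by rewrite -hs1E osp_sbracket.
have hg2 : hs2 i \in g by rewrite -hs2E osp_sbracket.
by apply/span_subvP => w; rewrite !inE => /or3P[]/eqP->.
Qed.

Let sumW u : u \in (\sum_i W i)%VS -> exists2 w, forall i, w i \in W i &
  u = \sum_i w i.
Proof. by case/memv_sumP=> w wW ->; exists w => // i; apply: wW. Qed.

Let comp u (w : 'I_k -> M) i : (forall j, w j \in W j) -> u = \sum_j w j -> pr i u = w i.
Proof.
move=> wW ->; rewrite pr_sum (bigD1 i) //= (prW _ (wW i)) eqxx big1 ?addr0 // => j ji.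
by rewrite (prW _ (wW j)) eq_sym (negPf ji).
Qed.

Let pr_orth i Y : Y \in W' -> pr i Y = 0.
Proof.
by case/W'P=> _ /(_ i)[s0 s1 s2]; rewrite /pr s0 s1 s2 !scale0r !subr0 scaler0.
Qed.

Let Y_split Y : Y \in g -> Y - \sum_i pr i Y \in W'.
Proof.
have sW w i : w \in W i -> w \in g by apply/subvP/W_osp.
have prin i : pr i Y \in W i.
  rewrite rpredZ // !rpredB // rpredZ // memv_span // !inE eqxx ?orbT //.
move=> Yg; apply/W'P; split.
  by rewrite rpredB // rpred_sum // => i _; apply: sW.
move=> j; have one w : (forall i, i != j -> sform w (pr i Y) = 0) ->
    sform w (pr j Y) = sform w Y -> sform w (Y - \sum_i pr i Y) = 0.
  move=> w0 w1; rewrite sformDr sformNr sform_sumr (bigD1 j isT) /= w1.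
  by rewrite big1 => [|i ij]; [rewrite addr0 subrr|exact: w0].
have E w i : sform w (pr i Y) = (c i)^-1 * (sform (hs1 i) Y * sform w (hs1 i)
   - sform (hs2 i) Y * sform w (hs i) - sform (hs i) Y * sform w (hs2 i)).
  by rewrite /pr sformZr !sformDr !sformNr !sformZr.
split; apply: one => [i ij|]; rewrite E.
- have [-> -> _ _ _] := table j i; rewrite sform02 eq_sym (negPf ij).
  by rewrite !mulr0 !subr0 mulr0.
- have [-> -> _ _ _] := table j j; rewrite sform02 eqxx.
  by rewrite !mulr0 subrr sub0r !mulrN opprK mulrC mulfK ?pair1.
- have [_ _ -> -> _] := table j i; rewrite sform11 eq_sym (negPf ij).
  by rewrite !mulr0 !subr0 mulr0.
- have [_ _ -> -> _] := table j j; rewrite sform11 eqxx.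
  by rewrite !mulr0 !subr0 mulrC mulfK ?pair1.
- have [_ _ _ _ [-> ->]] := table j i; rewrite sform20 eq_sym (negPf ij).
  by rewrite !mulr0 !subr0 mulr0.
have [_ _ _ _ [-> ->]] := table j j; rewrite sform20 eqxx.
by rewrite !mulr0 sub0r subr0 !mulrN opprK mulrC mulfK ?pair1.
Qed.

Let W'_submodule : submodule (gnat + s) g W'.
Proof.
split.
- by apply/subvP => Y /W'P[].
- move=> Y /W'P[Yg s0]; apply/W'P; split; first exact: osp_graded.
  by move=> i; rewrite !sform_even //; apply: s0.
move=> _ Y /memv_addP[a aN [y yS ->]] /W'P[Yg s0]; rewrite sbracketDl.
have ag : a \in g by case/in_triple_centralizer: aN.
have yg : y \in g.
  case/span3P: yS => t ->; by rewrite !rpredD ?rpredZ.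
apply/W'P; split; first by rewrite rpredD // osp_sbracket.
move=> i; have [t0 t1 t2] := s0 i.
have [hg hN hx he] := hsP i.
have [x1 x2 e1 e2] := rels i.
have [f3 _] := highest_string_length oe ox o_f rel (hsP i) (hs_neq0 i).
rewrite hs1E hs2E in f3.
have a1 : sbracket a (hs1 i) = 0 by rewrite -hs1E; apply: (gnat_lower oe ox o_f aN); apply: hN.
have a2 : sbracket a (hs2 i) = 0 by rewrite -hs2E; apply: (gnat_lower oe ox o_f aN).
have yE w : od w = 0 -> sbracket a w = 0 -> sform (sbracket e w) Y = 0 ->
    sform (sbracket x w) Y = 0 -> sform (sbracket f w) Y = 0 ->
    sform w (sbracket a Y + sbracket y Y) = 0.
  move=> ow aw ew xw fw; rewrite sformDr sform_commuting // add0r.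
  case/span3P: yS => t ->; rewrite !(sbracketDl, sbracketZl) !sformDr !sformZr.
  have E z : od z = 0 -> sform (sbracket z w) Y = 0 -> sform w (sbracket z Y) = 0.
    by move=> oz /eqP; rewrite sform_bracket // oppr_eq0 => /eqP.
  by rewrite !E // !mulr0 !addr0.
split; apply: yE.
- exact: hs_even.
- exact: hN.
- by rewrite he sform0l.
- by rewrite hx.
- by rewrite hs1E.
- exact: hs1_even.
- exact: a1.
- by rewrite e1.
- by rewrite x1 sform0l.
- by rewrite hs2E.
- exact: hs2_even.
- exact: a2.
- by rewrite e2.
- by rewrite x2 sformNl t2 oppr0.
- by rewrite f3 sform0l.
Qed.

(** The matrix of the form on the span of a triple of vectors h, [f, h],
    [f, [f, h]] is antidiagonal with entries plus or minus the pairing of h with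
    itself. A copy inside the orthogonal would contain a highest vector
    orthogonal to all the last ones, hence zero. *)
Lemma triv_adj_multiplicity_exists : triv_adj_multiplicity gnat s g k.
Proof.
exists W, W'; split.
- rewrite directv_addE /=; apply/and3P; split.
  + by rewrite directvE.
  + apply/directv_sum_independent => u uW u0 i _.
    by rewrite -(@comp 0 u i (fun j => uW j isT) (esym u0)) /pr !sform0r !scale0r !subr0 scaler0.
  + rewrite -subv0; apply/subvP => u /memv_capP[uW' /sumW[w wW uE]].
    rewrite memv0 uE big1 // => i _.
    by rewrite -(comp i wW uE) pr_orth.
- apply/eqP; rewrite eqEsubv; apply/andP; split.
    rewrite subv_add; apply/andP; split; first by apply/subvP => Y /W'P[].
    by apply/subv_sumP => i _; apply: W_osp.
  apply/subvP => Y Yg; rewrite -[Y](subrK (\sum_i pr i Y)).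
  apply: memv_add; first exact: Y_split.
  apply: memv_sumr => i _; rewrite /pr rpredZ // !rpredB // rpredZ // memv_span //;
    by rewrite !inE eqxx ?orbT.
- move=> i; have := adj_copyP fg oe ox o_f rel f0 (hsP i) (hs_neq0 i) (or_intror (hs_even i)).
  by rewrite /adj_copy hs1E hs2E.
- exact: W'_submodule.
move=> U UW' /(triv_adj_highest oe ox o_f rel f0)[h [hU h0 hh _]].
have [d hE] := spanning hh; case/eqP: h0; rewrite hE big1 // => i _.
have /W'P[_ /(_ i)[_ _ s2]] := subvP UW' _ hU.
move: s2; rewrite hE sform_sumr (bigD1 i) //= sformZr sform20 eqxx big1 => [|j ji].
  move/eqP; rewrite addr0 mulf_eq0 oppr_eq0 (negPf (pair1 i)) orbF => /eqP->.
  by rewrite scale0r.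
by rewrite sformZr sform20 eq_sym (negPf ji) mulr0.
Qed.

End Complement.

(** * Odd elements of square zero *)

Lemma sbracket_odd (F : fieldType) m n (X Y : 'M[F]_(m + n)) :
  even_part X = 0 -> even_part Y = 0 -> sbracket X Y = X *m Y + Y *m X.
Proof.
move=> eX eY; rewrite sbracketE eX eY !mul0mx !mulmx0 !subr0 !add0r.
by rewrite !odd_id.
Qed.

Lemma symplectic_unit (F : fieldType) n : ~~ odd n -> symplectic_mx F n \in unitmx.
Proof.
move=> evn; have : symplectic_mx F n *m (- symplectic_mx F n) = 1%:M.
  by rewrite mulmxN symplectic_sqr // opprK.
by case/mulmx1_unit.
Qed.

(** The odd element given by a column w has, up to sign, the rank one matrix
    w w^T J as the lower block of its square. *)
Lemma osp1_odd_square (F : fieldType) r (X : 'M[F]_(1 + r)) : ~~ odd r ->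
  X \in osp F 1 r -> even_part X = 0 -> X *m X = 0 -> X = 0.
Proof.
move=> evr /ospP[_ ospX] eX XX; rewrite (odd_id eX) in ospX.
have XE : X = block_mx 0 (ursubmx X) (dlsubmx X) 0 by rewrite -[LHS](odd_id eX).
move: ospX XX; rewrite XE; set u := ursubmx X; set w := dlsubmx X.
rewrite tr_block_mx /osp_form /parity_mx !mulmx_block !trmx0.
rewrite !(mul0mx, mulmx0, mul1mx, mulmx1, addr0, add0r) add_block_mx -!block_mx0.
move=> /eq_block_mx[_ wu _ _] /eq_block_mx[_ _ _ ww].
have uE : u = - (w^T *m symplectic_mx F r).
  by apply/eqP; rewrite -addr_eq0 addrC wu.
have w0 : w = 0.
  have := ww; rewrite uE mulmxN mulmxA => /eqP; rewrite oppr_eq0 => /eqP.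
  move/(congr1 (mulmx^~ (invmx (symplectic_mx F r)))).
  rewrite mulmxK ?symplectic_unit // mul0mx => ww0.
  apply/colP => i; rewrite mxE; have /matrixP/(_ i i) := ww0.
  by rewrite !mxE big_ord1 !mxE => /eqP; rewrite mulf_eq0 orbb => /eqP.
by rewrite uE w0 trmx0 mul0mx oppr0 !block_mx0.
Qed.

Lemma mx_double_eq0 (F : numFieldType) a b (Z : 'M[F]_(a, b)) : Z *+ 2 = 0 -> Z = 0.
Proof. by rewrite -scaler_nat => /eqP; rewrite scaler_eq0 pnatr_eq0 => /eqP. Qed.

(** The reductive part is even, and the components of y in the copies of
    osp(1|r) pairwise commute, being in different ideals, so each of them has
    square zero. *)
Lemma reductive_odd_square (F : numFieldType) (m n : nat)
  (L : {vspace 'M[F]_(m + n)}) y : reductive_plus_osp1 L ->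
  y \in L -> even_part y = 0 -> y *m y = 0 -> y = 0.
Proof.
case=> A [k [B [r [dir sum [[idA _ _] [evA _]] BP]]]] yL ey yy.
have dirB : directv (\sum_i B i) by move: dir; rewrite directv_addE => /and3P[].
have BL i : (B i <= L)%VS by case: (BP i) => -[].
have gB i : graded (B i) by case: (BP i) => -[].
have actB i z w : z \in L -> w \in B i -> sbracket z w \in B i.
  by case: (BP i) => -[_ _ act] _ _; apply: act.
move: yL; rewrite -sum => /memv_addP[a aA [_ /memv_sumP[b0 b0B ->] yE]].
pose b i := odd_part (b0 i).
have bB i : b i \in B i by apply: (graded_odd (gB i)); apply: b0B.
have eb i : even_part (b i) = 0 by apply: even_odd.
have {}yE : y = \sum_i b i.
  rewrite -[LHS](odd_id ey) yE odd_partD (evA _ aA) add0r.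
  exact: (linear_sum (@odd_part F m n)).
have bbC i j : sbracket (b i) (b j) = sbracket (b j) (b i).
  by rewrite !sbracket_odd // addrC.
have bbE i : sbracket (b i) (b i) = (b i *m b i) *+ 2.
  by rewrite sbracket_odd.
(* Brackets between different summands lie in both, hence vanish. *)
have bij i j : i != j -> sbracket (b i) (b j) = 0.
  move=> nij; have /directv_sumP/(_ j isT) cap := dirB.
  apply/eqP; rewrite -memv0 -cap memv_cap actB ?(subvP (BL i)) //=.
  have sub : (B i <= \sum_(l | true && (l != j)) B l)%VS by apply: (sumv_sup i).
  by rewrite bbC; apply: (subvP sub); rewrite actB // (subvP (BL j)).
have sq0 i : b i *m b i = 0.
  have s0 : \sum_i sbracket (b i) (b i) = 0.
    have : sbracket y y = 0.
      by rewrite sbracket_odd // yy addr0.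
    rewrite {2}yE (linear_sum (sbracket y)) => yb; rewrite -[RHS]yb.
    apply: eq_bigr => j _ /=.
    have -> : sbracket y (b j) = \sum_i sbracket (b i) (b j).
      by rewrite {1}yE; exact: (linear_sum (sbracketr (b j))).
    by rewrite (bigD1 j) //= big1 ?addr0 // => l lj; apply: bij.
  have /directv_sum_independent/(_ (fun i => sbracket (b i) (b i))) ind := dirB.
  have : sbracket (b i) (b i) = 0.
    by apply: ind => // l _; rewrite actB // (subvP (BL l)).
  by rewrite bbE => /mx_double_eq0.
rewrite yE big1 // => i _; have [_ ri [phi [img inj ev br]]] := BP i.
apply/eqP; rewrite -memv0 -inj memv_cap bB memv_ker /=; apply/eqP.
apply: (@osp1_odd_square _ (r i)) => //.
- by rewrite -img memv_img.
- by rewrite -ev // eb linear0.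
have ep : even_part (phi (b i)) = 0 by rewrite -ev // eb linear0.
have := br _ _ (bB i) (bB i); rewrite bbE sq0 mul0rn linear0.
rewrite sbracket_odd // -mulr2n.
by move/esym/mx_double_eq0.
Qed.

(** Complete the restriction of G to A by the identity: the resulting invertible
    matrix has its determinant multiplied by (-1)^|A| under transposition. *)
Lemma alternating_even (F : numFieldType) N (G : 'M[F]_N) (A : {set 'I_N}) :
  G \in unitmx -> (forall i j, i \in A -> j \notin A -> G i j = 0 /\ G j i = 0) ->
  (forall i j, i \in A -> j \in A -> G j i = - G i j) -> ~~ odd #|A|.
Proof.
move=> uG out alt.
pose H : 'M[F]_N := \matrix_(i, j)
  if i \in A then G i j else (i == j)%:R.
have uH : H \in unitmx.
  rewrite -unitmx_tr -row_free_unit -kermx_eq0; apply/rowV0P => y /sub_kermxP yH.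
  have yHi i : \sum_j y 0 j * H i j = 0.
    have E : (y *m H^T) 0 i = 0 by rewrite yH mxE.
    by rewrite -[RHS]E [RHS]mxE; apply: eq_bigr => j _; rewrite [H^T _ _]mxE.
  have yi i : i \notin A -> y 0 i = 0.
    move=> iA; have := yHi i; rewrite (bigD1 i) //= big1 => [|j ji].
      by rewrite mxE (negPf iA) eqxx mulr1 addr0.
    by rewrite mxE (negPf iA) eq_sym (negPf ji) mulr0.
  have yG : y *m G^T = 0.
    apply/rowP => i; rewrite [RHS]mxE [LHS]mxE.
    have [iA|iA] := boolP (i \in A).
      rewrite -[RHS](yHi i); apply: eq_bigr => j _.
      by rewrite [G^T _ _]mxE [H _ _]mxE iA.
    apply: big1 => j _; rewrite [G^T _ _]mxE.
    have [jA|jA] := boolP (j \in A); last by rewrite yi ?mul0r.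
    by have [_ ->] := out _ _ jA iA; rewrite mulr0.
  have := congr1 (mulmx^~ (invmx G^T)) yG.
  by rewrite mulmxK ?unitmx_tr // mul0mx.
pose D : 'rV[F]_N := \row_i (-1) ^+ (i \in A).
have HT : H^T = diag_mx D *m H.
  apply/matrixP => i j; rewrite mul_diag_mx [RHS]mxE [D _ _]mxE [H^T _ _]mxE ![H _ _]mxE.
  have [iA|iA] := boolP (i \in A); have [jA|jA] := boolP (j \in A).
  - by rewrite expr1 mulN1r alt.
  - have [-> _] := out _ _ iA jA; rewrite mulr0.
    by case: eqP jA => // ->; rewrite iA.
  - have [-> _] := out _ _ jA iA; rewrite expr0 mul1r.
    by case: eqP iA => // ->; rewrite jA.
  - by rewrite expr0 mul1r eq_sym.
have := congr1 determinant HT; rewrite det_tr det_mulmx det_diag.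
have -> : \prod_i D 0 i = (-1) ^+ #|A|.
  rewrite (eq_bigr (fun i => if i \in A then -1 else 1)) => [|i _]; last first.
    by rewrite mxE; case: (i \in A).
  by rewrite -big_mkcond /= prodr_const.
move=> dH; apply/negP => oA; move: dH; rewrite -signr_odd oA expr1 mulN1r => /eqP.
rewrite -subr_eq0 opprK -mulr2n mulrn_eq0 /=.
by move: uH; rewrite unitmxE unitfE => /negPf->.
Qed.

(** * Consequences for the multiplicity spaces *)

(** Provides the isotropic vectors of the blocks on which the form is symmetric. *)
Lemma isotropic_combination (F : numClosedFieldType) (a b c : F) :
  exists s t, (s != 0) || (t != 0) /\ s * s * a + s * t * b + t * t * c = 0.
Proof.
have [->|a0] := eqVneq a 0.
  by exists 1, 0; rewrite oner_neq0; split=> //; ring.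
exists ((- b + sqrtC (b * b - 4 * a * c)) / (2 * a)), 1.
split; first by rewrite oner_neq0 orbT.
have := sqrtCK (b * b - 4 * a * c); move: (sqrtC _) => r; rewrite expr2 => rr.
have -> : (- b + r) / (2 * a) * ((- b + r) / (2 * a)) * a +
   (- b + r) / (2 * a) * 1 * b + 1 * 1 * c = (r * r - (b * b - 4 * a * c)) / (4 * a).
  by field; rewrite a0 /=.
by rewrite rr subrr mul0r.
Qed.

Section Blocks.
Variables (F : numClosedFieldType) (m n N : nat) (e x f : 'M[F]_(m + n)).
Variables (dd : 'I_N -> nat) (p : 'I_N -> bool).
Variable (v : 'I_N -> nat -> 'cV[F]_(m + n)).
Variable (co : 'I_N -> nat -> 'cV[F]_(m + n) -> F).
Hypothesis S : osp_strings e x f dd p v co.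
Local Notation G := (gram dd v).
Local Notation sp := (parity_sign F p).
Local Notation sd := (length_sign F dd).
Local Notation gnat := (centralizer (osp F m n) <<[:: e; x; f]>>).
Local Notation symplectic := (symplectic dd p).
Local Notation skew_delta := (skew_delta F dd p).
Let T := os_str S.

Lemma symplectic_gram l : symplectic l -> G l l = 0.
Proof.
move=> sl; have := gramC S l l; rewrite sign_symplectic sl expr1 mulN1r => /eqP.
by rewrite -subr_eq0 opprK -mulr2n mulrn_eq0 => /eqP.
Qed.

Lemma block_parity i j : dd i = dd j -> (p i == p j) = (symplectic i == symplectic j).
Proof.
by move=> dij; rewrite /symplectic dij; case: (p i) (p j) (odd _) => -[] [].
Qed.

(** Let u be isotropic in the span of [k1] and [k2], in the symmetric part of the
    block, and w the vector [l] of the alternating part. The odd skew operator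
    u w^T - w u^T, up to signs, squares to zero since the form vanishes on the
    span of u and w. *)
Lemma no_mixed_block k1 k2 l : reductive_plus_osp1 gnat ->
  dd k1 = dd l -> dd k2 = dd l -> k1 != k2 ->
  ~~ symplectic k1 -> ~~ symplectic k2 -> symplectic l -> False.
Proof.
move=> red d1 d2 n12 s1 s2 sl.
have p1 : p k1 (+) p l = true.
  have := block_parity d1; rewrite (negPf s1) sl; by case: (p k1) (p l) => -[].
have p2 : p k2 (+) p l = true.
  have := block_parity d2; rewrite (negPf s2) sl; by case: (p k2) (p l) => -[].
have [s [t [st iso]]] := isotropic_combination (G k1 k1) (G k1 k2 + G k2 k1) (G k2 k2).
pose K := s *: skew_delta k1 l + t *: skew_delta k2 l.
have tK : parity_type dd p true K.
  move=> i j; rewrite !mxE => nz.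
  have [E1|E1] := eqVneq (skew_delta k1 l i j) 0; last first.
    by have := skew_delta_type d1 E1; rewrite p1.
  have [E2|E2] := eqVneq (skew_delta k2 l i j) 0; last first.
    by have := skew_delta_type d2 E2; rewrite p2.
  by move: nz; rewrite !mxE in E1 E2 *; rewrite E1 E2 !mulr0 addr0 eqxx.
have sK : super_skew dd p true K.
  move=> i j; have E1 := skew_delta_skew F p d1 i j; have E2 := skew_delta_skew F p d2 i j.
  rewrite p1 in E1; rewrite p2 in E2.
  have KE a b : K a b = s * skew_delta k1 l a b + t * skew_delta k2 l a b.
    by rewrite [LHS]mxE [(_ *: skew_delta k1 l) _ _]mxE [(_ *: skew_delta k2 l) _ _]mxE.
  by rewrite !KE E1 E2; ring.
have yN := gnat_blockop S tK sK.
have tKG : parity_type dd p true (K *m G).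
  by rewrite -[true]addbF; apply: parity_type_mul tK (gram_type S).
have bKG := parity_type_blockwise tKG.
have ey := blockop_parity S tKG.
have K1 : skew_delta k1 l = delta_mx k1 l - sd l *: delta_mx l k1.
  by rewrite /skew_delta p1 expr1 mulrAC parity_sign_sqr mul1r /length_sign d1.
have K2 : skew_delta k2 l = delta_mx k2 l - sd l *: delta_mx l k2.
  by rewrite /skew_delta p2 expr1 mulrAC parity_sign_sqr mul1r /length_sign d2.
pose u : 'cV[F]_N := s *: delta_mx k1 0 + t *: delta_mx k2 0.
pose w : 'cV[F]_N := delta_mx l 0.
have dE (i j : 'I_N) : delta_mx i j = (delta_mx i 0 : 'cV[F]_N) *m (delta_mx j 0 : 'cV[F]_N)^T.
  by rewrite trmx_delta mul_delta_mx.
have uT : u^T = s *: (delta_mx k1 0 : 'cV[F]_N)^T + t *: (delta_mx k2 0 : 'cV[F]_N)^T.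
  by apply/matrixP => a b; rewrite !mxE.
have KE : K = u *m w^T - sd l *: (w *m u^T).
  rewrite /K K1 K2 !dE uT /u /w mulmxDl mulmxDr -!scalemxAl -!scalemxAr.
  by mx_abel.
have ent (i j : 'I_N) : (delta_mx i 0 : 'cV[F]_N)^T *m G *m (delta_mx j 0 : 'cV[F]_N) = (G i j)%:M.
  by rewrite trmx_delta -rowE -colE; apply/matrixP => a b; rewrite !ord1 !mxE.
have wGw : w^T *m G *m w = 0 by rewrite ent symplectic_gram // raddf0.
have G0 i j : dd i = dd j -> p i (+) p j = true -> G i j = 0.
  by move=> _ pij; rewrite (gram_parity S) //; move: pij; case: (p i) (p j) => -[].
have wGu : w^T *m G *m u = 0.
  rewrite /u mulmxDr -!scalemxAr !ent !G0 ?raddf0 ?scaler0 ?addr0 //;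
  by rewrite 1?addbC.
have uGw : u^T *m G *m w = 0.
  rewrite uT !mulmxDl -!scalemxAl !ent !G0 ?raddf0 ?scaler0 ?addr0 //.
have uGu : u^T *m G *m u = 0.
  rewrite uT /u !mulmxDl -!scalemxAl !mulmxDr -!scalemxAr !ent.
  move: (G k1 k1) (G k1 k2) (G k2 k1) (G k2 k2) iso => g11 g12 g21 g22 iso.
  apply/matrixP => i j; rewrite !ord1 !mxE /= !mulr1n -[RHS]iso; ring.
have KGK : K *m G *m K = 0.
  rewrite KE !(mulmxBl, mulmxBr) -!scalemxAl -!scalemxAr.
  have -> : u *m w^T *m G *m (u *m w^T) = u *m (w^T *m G *m u) *m w^T by rewrite !mulmxA.
  have -> : w *m u^T *m G *m (u *m w^T) = w *m (u^T *m G *m u) *m w^T by rewrite !mulmxA.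
  have -> : u *m w^T *m G *m (w *m u^T) = u *m (w^T *m G *m w) *m u^T by rewrite !mulmxA.
  have -> : w *m u^T *m G *m (w *m u^T) = w *m (u^T *m G *m w) *m u^T by rewrite !mulmxA.
  by rewrite wGw wGu uGw uGu !(mulmx0, mul0mx, scaler0, subr0).
have yy : blockop dd v co (K *m G) *m blockop dd v co (K *m G) = 0.
  rewrite (blockop_mul S) // mulmxA KGK mul0mx; apply: (str_mulmx_ext T) => j k _.
  rewrite mul0mx (blockopE S); last by move=> a b _; rewrite mxE.
  by apply: big1 => i _; rewrite mxE scale0r.
have y0 := reductive_odd_square red yN ey yy.
have := blockop_eq0 S bKG y0 => /(congr1 (mulmx^~ (invmx G))).
rewrite mulmxK ?(gram_unit S) // mul0mx => K0.
have nl1 : (l == k1) = false by apply: contraNF s1 => /eqP<-.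
have nl2 : (l == k2) = false by apply: contraNF s2 => /eqP<-.
move: st; have := congr1 (fun M : 'M_N => M k1 l) K0; have := congr1 (fun M : 'M_N => M k2 l) K0.
rewrite /K K1 K2 !mxE !eqxx [k1 == l]eq_sym [k2 == l]eq_sym nl1 nl2 (negPf n12) eq_sym (negPf n12) /=.
by rewrite !(mulr0, oppr0, subr0, mulr1, addr0, add0r) => -> ->; rewrite eqxx.
Qed.

(** The alternating part of a block carries a nondegenerate alternating form. *)
Lemma symplectic_even q : ~~ odd #|[set j | (dd j == q) && symplectic j]|.
Proof.
apply: (alternating_even (gram_unit S)) => i j; rewrite !inE.
  move=> /andP[/eqP di si]; rewrite negb_and => /orP[dj|sj].
    have dij : dd i != dd j by rewrite di eq_sym.
    by rewrite !(gram_length S) // eq_sym.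
  have [dij|dij] := eqVneq (dd i) (dd j); last by rewrite !(gram_length S) // eq_sym.
  have pij : p i != p j by rewrite (block_parity dij) si (negPf sj).
  by rewrite !(gram_parity S) // eq_sym.
move=> /andP[/eqP di si] /andP[/eqP dj sj].
by rewrite (gramC S) sign_symplectic si expr1 mulN1r.
Qed.

(** Up to sign this is the difference between the dimensions of the symmetric
    and alternating parts. The latter is even, and if it is nonzero the former
    is at most one. *)
Lemma superdimension_neq0 q : reductive_plus_osp1 gnat -> (exists j, dd j = q) ->
  \sum_(j | dd j == q) sp j != 0.
Proof.
move=> red [j0 dj0].
pose A := [set j | (dd j == q) && symplectic j].
pose C := [set j | (dd j == q) && ~~ symplectic j].
have -> : \sum_(j | dd j == q) sp j = (-1) ^+ q.-1 * (#|C|%:R - #|A|%:R).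
  rewrite (bigID symplectic) /= addrC mulrBr; congr (_ + _).
    rewrite -sum1dep_card natr_sum mulr_sumr; apply: eq_bigr => j /andP[/eqP dj sj].
    have := sign_symplectic F dd p j; rewrite (negPf sj) expr0 => E.
    by rewrite mulr1 -[LHS]mulr1 -[X in _ * X](length_sign_sqr F dd j) mulrA E mul1r /length_sign dj.
  rewrite -sum1dep_card natr_sum mulr_sumr -sumrN; apply: eq_bigr => j /andP[/eqP dj sj].
  have := sign_symplectic F dd p j; rewrite sj expr1 => E.
  by rewrite mulr1 -[LHS]mulr1 -[X in _ * X](length_sign_sqr F dd j) mulrA E mulN1r /length_sign dj.
rewrite mulf_neq0 ?signr_eq0 // subr_eq0 eqr_nat.
have evA := symplectic_even q; rewrite -/A in evA.
have [A0|/set0Pn[l]] := eqVneq A set0.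
  have : j0 \in C.
    rewrite inE dj0 eqxx /=; apply/negP => sj.
    have : j0 \in A by rewrite inE dj0 eqxx.
    by rewrite A0 inE.
  by rewrite A0 cards0 -lt0n => j0C; apply/card_gt0P; exists j0.
rewrite inE => /andP[/eqP dl sl].
have C1 : (#|C| <= 1)%N.
  rewrite leqNgt; apply/negP => /card_gt1P[k1 [k2 []]].
  rewrite !inE => /andP[/eqP d1 s1] /andP[/eqP d2 s2] n12.
  by apply: (@no_mixed_block k1 k2 l red) => //; rewrite ?d1 ?d2 ?dl.
have A0 : (0 < #|A|)%N by apply/card_gt0P; exists l; rewrite inE dl eqxx.
by apply/negP => /eqP CA; move: evA C1 A0; rewrite CA; case: #|A| => [|[|]].
Qed.

End Blocks.

(** * so(4) is not simple *)

Section SO4.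
Variable F : numFieldType.
Local Notation M := 'M[F]_(4 + 0).
Local Notation i0 := (0 : 'I_4).
Local Notation i1 := (1 : 'I_4).
Local Notation i2 := (2 : 'I_4).
Local Notation i3 := (3 : 'I_4).

Lemma sum_ord4 (h : 'I_4 -> F) : \sum_i h i = h i0 + h i1 + h i2 + h i3.
Proof.
rewrite !big_ord_recl big_ord0 addr0 !addrA.
by congr (h _ + h _ + h _ + h _); apply: val_inj.
Qed.

Lemma so4_even (X : M) : odd_part X = 0.
Proof.
apply/matrixP => i j; rewrite !mxE.
case: splitP => i' _; last by case: i'.
by rewrite mxE; case: splitP => j' _; [rewrite mxE|case: j'].
Qed.

Lemma so4_form : osp_form F 4 0 = 1%:M :> M.
Proof.
rewrite (scalar_mx_block 4 0 1) /osp_form; congr block_mx.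
by apply/matrixP => -[].
Qed.

Lemma so4P (X : M) : reflect (forall i j, X i j = - X j i) (X \in osp F 4 0).
Proof.
have E : reflect (X^T + X = 0) (X \in osp F 4 0).
  apply: (iffP (ospP X)); rewrite (even_id (so4_even X)) so4_even so4_form.
    by rewrite mulmx1 mul1mx => -[].
  by rewrite trmx0 mul0mx mulmx0 addr0 mulmx1 mul1mx.
apply: (iffP E) => [XX i j|XX].
  by have := congr1 (fun Y : M => Y j i) XX; rewrite !mxE => /eqP; rewrite addr_eq0 => /eqP.
by apply/matrixP => i j; rewrite !mxE XX addNr.
Qed.

(** The coordinates of the anti-self-dual part of a skew matrix for the Hodge
    star of dimension four; its kernel is an ideal of so(4). *)
Definition anti_self_dual (X : M) : 'rV[F]_3 :=
  \row_k [:: X i0 i1 - X i2 i3; X i0 i2 + X i1 i3; X i0 i3 - X i1 i2]`_k.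

Lemma anti_self_dual_is_linear : linear anti_self_dual.
Proof.
move=> a X Y; apply/rowP => k; rewrite !mxE.
by case: k => -[|[|[|//]]] ? /=; ring.
Qed.
HB.instance Definition _ :=
  GRing.isLinear.Build F _ _ _ anti_self_dual anti_self_dual_is_linear.

Lemma anti_self_dual_eq0 (X : M) : anti_self_dual X = 0 <->
  [/\ X i0 i1 = X i2 i3, X i0 i2 = - X i1 i3 & X i0 i3 = X i1 i2].
Proof.
split=> [/rowP E|[E1 E2 E3]].
  have := E (0 : 'I_3); have := E (1 : 'I_3); have := E (2 : 'I_3); rewrite !mxE /=.
  move=> /eqP; rewrite subr_eq0 => /eqP-> /eqP; rewrite addr_eq0 => /eqP->.
  by move=> /eqP; rewrite subr_eq0 => /eqP->.
apply/rowP => k; rewrite !mxE; case: k => -[|[|[|//]]] ? /=.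
- by rewrite E1 subrr.
- by rewrite E2 addNr.
- by rewrite E3 subrr.
Qed.

(** The kernel of [anti_self_dual] is a nonzero proper ideal. *)
Lemma so4_not_simple : ~ simple_superalgebra (osp F 4 0).
Proof.
case=> _ simple; pose I := (osp F 4 0 :&: lker (linfun anti_self_dual))%VS.
have memI X : reflect (X \in osp F 4 0 /\ anti_self_dual X = 0) (X \in I).
  have kerE : (X \in lker (linfun anti_self_dual)) = (anti_self_dual X == 0).
    by rewrite memv_ker lfunE.
  by rewrite memv_cap kerE; apply: (iffP andP) => -[Xg /eqP].
pose rot i j : M := delta_mx i j - delta_mx j i.
have rot_so i j : rot i j \in osp F 4 0.
  apply/so4P => a b; rewrite !mxE opprB; congr (_%:R - _%:R); rewrite andbC //.
have one0 : 1 != 0 :> F := oner_neq0 F.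
case: (simple I).
- split; first exact: capvSl.
    by move=> X; rewrite (even_id (so4_even X)).
  move=> X Y Xso /memI[Yso /anti_self_dual_eq0[Y1 Y2 Y3]]; apply/memI.
  split; first exact: osp_sbracket.
  move/so4P: Xso => XX; move/so4P: Yso => YY.
  have E a b : sbracket X Y a b =
      \sum_c X a c * Y c b - \sum_c Y a c * X c b.
    rewrite (sbracket_evenl _ (so4_even X)) !mxE.
    by [].
  have X0 a : X a a = 0.
    by have /eqP := XX a a; rewrite -subr_eq0 opprK -mulr2n mulrn_eq0 => /eqP.
  have Y0 a : Y a a = 0.
    by have /eqP := YY a a; rewrite -subr_eq0 opprK -mulr2n mulrn_eq0 => /eqP.
  apply/anti_self_dual_eq0; rewrite !E !sum_ord4 !X0 !Y0.
  rewrite ?(XX i1 i0) ?(XX i2 i0) ?(XX i3 i0) ?(XX i2 i1) ?(XX i3 i1) ?(XX i3 i2).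
  rewrite ?(YY i1 i0) ?(YY i2 i0) ?(YY i3 i0) ?(YY i2 i1) ?(YY i3 i1) ?(YY i3 i2).
  by rewrite Y1 Y2 Y3; split; ring.
- move=> I0; have : rot i0 i1 + rot i2 i3 \in I.
    apply/memI; split; first by rewrite rpredD.
    by apply/anti_self_dual_eq0; rewrite !mxE /=; split; ring.
  rewrite I0 memv0 => /eqP/matrixP/(_ i0 i1); rewrite !mxE /= !(subr0, addr0).
  by move/eqP; rewrite (negPf one0).
move=> Ig; have := rot_so i0 i1; rewrite -Ig => /memI[_ /anti_self_dual_eq0[+ _ _]].
by rewrite !mxE /= !subr0 => /eqP; rewrite (negPf one0).
Qed.

End SO4.

(** * Combinatorics of the parts *)

Section Counting.
Local Open Scope nat_scope.

Lemma geq_trans : transitive geq.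
Proof. by move=> a b c ba ac; apply: leq_trans ba. Qed.

(** A pair of positions is determined by its second member, and the order of the
    list makes the condition on positions automatic. *)
Lemma step2_pairsE (lam Q : seq nat) (par : pred nat) :
  uniq Q -> sorted geq Q ->
  step2_pairs lam Q par =
  count (fun q => [&& q + 2 \in Q, mult_of lam (q + 2) == 1,
                      mult_of lam q == 1, par (q + 2) & par q]) Q.
Proof.
move=> uQ sQ; rewrite /step2_pairs.
set A := [set _ | _]; set C := fun q => _.
have injA : {in A &, injective snd}.
  move=> [p j] [p' j']; rewrite !inE /= => /and5P[_ /eqP E _ _ _].
  move=> /and5P[_ /eqP E' _ _ _] jj'; rewrite -jj' in E' *; congr (_, _).
  by apply/ord_inj/eqP; rewrite -(nth_uniq 0 _ _ uQ) // E E'.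
have EC : count C Q = \sum_(j < size Q) C (nth 0 Q j).
  by rewrite -sumn_count sumnE big_map (big_nth 0) big_mkord.
rewrite [RHS]EC.
rewrite -(card_in_imset injA) -sum1_card big_mkcond; apply: eq_bigr => j _ /=.
rewrite -[X in X = _]/(nat_of_bool (j \in _)); congr nat_of_bool.
apply/imsetP/and5P => [[[p j']]|[/(nthP 0)[p pQ E] C1 C2 C3 C4]].
  rewrite inE /= => /and5P[_ /eqP E C1 C2 /andP[C3 C4]] ->.
  by split; rewrite -?E // mem_nth.
exists (Ordinal pQ, j) => //; rewrite inE /= E eqxx C1 C2 C3 C4 !andbT.
rewrite ltnNge; apply/negP => jp.
have := sorted_leq_nth geq_trans leqnn 0 sQ j p (ltn_ord j) pQ jp.
by rewrite /geq /= E; lia.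
Qed.

(** The parts whose multiplicity space is a line with a symmetric form. *)
Definition special (alpha beta : seq nat) (q : nat) :=
  if odd q then (mult_of alpha q == 1) && (mult_of beta q == 0)
  else (mult_of alpha q == 0) && (mult_of beta q == 1).

Definition special_step (alpha beta : seq nat) (q : nat) :=
  special alpha beta q && special alpha beta (q + 2).

(** The multiplicity formula without reference to a partition of the parts. *)
Definition parts_count (alpha beta : seq nat) :=
  let Q := undup (alpha ++ beta) in
  count (fun q => 1 < q) Q + count (special_step alpha beta) Q.

Lemma mult_of_gt0 (lam : seq nat) q : (0 < mult_of lam q) = (q \in lam).
Proof. by rewrite -has_count has_pred1. Qed.

Lemma special_part alpha beta q : special alpha beta q -> q \in alpha ++ beta.
Proof.
rewrite mem_cat -!mult_of_gt0 /special.
by case: ifP => _ /andP[/eqP-> /eqP->].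
Qed.

(** A special part q such that q + 2 is special belongs to the first list if it
    is odd and to the second if it is even, together with q + 2. *)
Lemma mult_formulaE (alpha beta Q1 Q2 Q3 Q4 : seq nat) :
  parts_partition alpha beta Q1 Q2 Q3 Q4 ->
  mult_formula alpha beta Q1 Q2 Q3 Q4 = parts_count alpha beta.
Proof.
case=> uQ memQ [s1 s2 _ _] [nu0 mu0 mu1 nu1]; rewrite /mult_formula /parts_count.
have /permP EQ : perm_eq (Q1 ++ Q2 ++ Q3 ++ Q4) (undup (alpha ++ beta)).
  by apply: uniq_perm; rewrite ?undup_uniq // => q; rewrite mem_undup memQ.
have [u1 u2] : uniq Q1 /\ uniq Q2.
  by move: uQ; rewrite !cat_uniq => /and3P[-> _ /and3P[-> _ _]].
rewrite -!EQ -addnA; congr (_ + _).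
rewrite !step2_pairsE // !count_cat.
have -> : count (special_step alpha beta) Q3 = 0.
  apply/eqP; rewrite -leqn0 leqNgt -has_count; apply/hasP => -[q qQ].
  have [E1 E2] := mu1 q qQ; rewrite /special_step /special E1.
  by case: (mult_of beta q) E2 => // k _; rewrite !andbF; case: ifP.
have -> : count (special_step alpha beta) Q4 = 0.
  apply/eqP; rewrite -leqn0 leqNgt -has_count; apply/hasP => -[q qQ].
  have [E1 E2] := nu1 q qQ; rewrite /special_step /special E1.
  by case: (mult_of alpha q) E2 => // k _; rewrite !andbF; case: ifP.
rewrite !addn0; congr (_ + _); apply: eq_in_count => q qQ.
  rewrite /special_step /special nu0 // eqxx andbT oddD /= addbF.
  case: ifP => odq; rewrite ?andbF //=.
  rewrite andbT; case: (eqVneq (mult_of alpha q) 1) => _; rewrite ?andbF //=.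
  case: (eqVneq (mult_of alpha (q + 2)) 1) => E; rewrite ?andbF //= andbT.
  apply/idP/eqP => [/nu0 //|E0].
  have : q + 2 \in Q1 ++ Q2 ++ Q3 ++ Q4.
    by rewrite memQ mem_cat -mult_of_gt0 E.
  rewrite !mem_cat => /or4P[] // qQi.
  - by have := mu0 _ qQi; rewrite E.
  - by have [_] := mu1 _ qQi; rewrite E0.
  - by have [] := nu1 _ qQi; rewrite E0.
rewrite /special_step /special mu0 // eqxx oddD /= addbF.
case: ifP => odq; rewrite ?andbF //=.
case: (eqVneq (mult_of beta q) 1) => _; rewrite ?andbF //=.
case: (eqVneq (mult_of beta (q + 2)) 1) => E; rewrite ?andbF //= !andbT.
apply/idP/eqP => [/mu0 //|E0].
have : q + 2 \in Q1 ++ Q2 ++ Q3 ++ Q4.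
  by rewrite memQ mem_cat -!mult_of_gt0 E orbT.
rewrite !mem_cat => /or4P[] // qQi.
- by have := nu0 _ qQi; rewrite E.
- by have [] := mu1 _ qQi; rewrite E0.
- by have [_] := nu1 _ qQi; rewrite E0.
Qed.

Section Partitions.
Variables (alpha beta : seq nat).
Hypothesis nu_odd : forall q, odd q -> ~~ odd (mult_of beta q).
Hypothesis mu_even : forall q, ~~ odd q -> ~~ odd (mult_of alpha q).
Hypothesis mu_le1 : forall q, odd q -> 0 < mult_of beta q ->
  mult_of alpha q <= 1.
Hypothesis nu_le1 : forall q, ~~ odd q -> 0 < mult_of alpha q ->
  mult_of beta q <= 1.

(** The parts are sorted according to their multiplicities; a part with
    mu = nu = 1 goes to the third list. *)
Lemma parts_partition_exists :
  exists Q1 Q2 Q3 Q4, parts_partition alpha beta Q1 Q2 Q3 Q4.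
Proof.
pose mu := mult_of alpha; pose nu := mult_of beta.
pose Q P := sort geq [seq q <- undup (alpha ++ beta) | P q].
have memQ P q : (q \in Q P) = P q && (q \in alpha ++ beta).
  by rewrite mem_sort mem_filter mem_undup.
have uQ P : uniq (Q P) by rewrite sort_uniq filter_uniq ?undup_uniq.
have sQ P : sorted geq (Q P).
  by apply: sort_sorted => a b; rewrite /geq /= leq_total.
exists (Q (fun q => nu q == 0)), (Q (fun q => (mu q == 0) && (nu q != 0))),
  (Q (fun q => (mu q == 1) && (nu q != 0))),
  (Q (fun q => (1 < mu q) && (nu q != 0))).
split=> //.
- rewrite !cat_uniq !uQ /= andbT; apply/and3P; split.
  + apply/hasP => -[q]; rewrite !mem_cat !memQ => h /andP[/eqP E _].
    by move: h; rewrite E !andbF.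
  + apply/hasP => -[q]; rewrite !mem_cat !memQ => h /andP[/andP[/eqP E _] _].
    by move: h; rewrite E.
  + apply/hasP => -[q]; rewrite !memQ => h /andP[/andP[/eqP E _] _].
    by move: h; rewrite E.
- move=> q; rewrite !mem_cat !memQ mem_cat -!mult_of_gt0 -/(mu q) -/(nu q).
  by case: (mu q) (nu q) => [|[|a]] [|b].
- split=> q; rewrite memQ => /andP[+ qQ].
  + by move/eqP.
  + by case/andP => /eqP.
  + by case/andP => /eqP mu1 nu0; rewrite lt0n.
  case/andP => mu1 nu0.
  have [odq|evq] := boolP (odd q).
    by have := mu_le1 odq; rewrite lt0n nu0 leqNgt mu1 => /(_ isT).
  have mu0 : 0 < mult_of alpha q by apply: ltn_trans mu1.
  by split=> //; have := nu_le1 evq mu0; move: nu0; rewrite /nu; case: mult_of => [|[]].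
Qed.

End Partitions.

Lemma two_valued_partition (lam : seq nat) q : 1 < q -> sorted geq lam ->
  (forall p, p \in lam -> p = q \/ p = 1) ->
  lam = nseq (mult_of lam q) q ++ nseq (mult_of lam 1) 1.
Proof.
move=> q1; elim: lam => [//|p lam IH] /= plam vals.
have /IH E : sorted geq lam by apply: path_sorted plam.
have {}E := E (fun p' p'in => vals p' (@mem_behead _ (p :: lam) _ p'in)).
have [->|p1] := vals p (mem_head _ _); rewrite /mult_of /= ?eqxx.
  by rewrite gtn_eqF //= [LHS](congr1 (cons q) E).
rewrite p1 (ltn_eqF q1) /= add0n.
have -> : count_mem q lam = 0.
  apply/count_memPn/negP => qlam.
  have /allP/(_ _ qlam) := order_path_min geq_trans plam.
  by rewrite /= p1 leqNgt q1.
rewrite /= [in LHS]E /mult_of.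
suff -> : count_mem q lam = 0 by [].
apply/count_memPn/negP => qlam.
have /allP/(_ _ qlam) := order_path_min geq_trans plam.
by rewrite /= p1 leqNgt q1.
Qed.

(** A pair of special parts q, q + 2 requires q = 1 and the part 3, each
    occurring once in alpha and never in beta. *)
Lemma two_valued_parts_count (q a b c d : nat) : 1 < q -> 0 < a + c ->
  ~ [/\ q = 3, a = 1, b = 1, c = 0 & d = 0] ->
  parts_count (nseq a q ++ nseq b 1) (nseq c q ++ nseq d 1) = 1.
Proof.
move=> q1 ac nso4; set alpha := _ ++ _; set beta := _ ++ nseq d 1.
have memab p : (p \in alpha ++ beta) =
    (p == q) || (0 < b + d) && (p == 1).
  rewrite !mem_cat !mem_nseq addn_gt0; move: ac; rewrite addn_gt0.
  by case: (0 < a) (0 < c) (0 < b) (0 < d) (p == q) (p == 1) => [] [] [] [] [] [].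
have E1 : count (fun p => 1 < p) (undup (alpha ++ beta)) = 1.
  rewrite -size_filter; apply: (perm_size (_ : perm_eq _ [:: q])).
  apply: uniq_perm; rewrite ?filter_uniq ?undup_uniq // => p.
  rewrite mem_filter mem_undup memab inE.
  by case: eqVneq => [->|_] /=; [rewrite q1|case: eqVneq => [->|]; rewrite ?andbF].
rewrite /parts_count E1; suff -> : count (special_step alpha beta) (undup (alpha ++ beta)) = 0 by [].
apply/eqP; rewrite -leqn0 leqNgt -has_count; apply/hasP => -[p].
rewrite mem_undup memab => pab /andP[sp sp2].
have := special_part sp2; rewrite memab => /orP[|]; last by lia.
move=> /eqP p2q; have p1 : p = 1 by move: pab; lia.
have q3 : q = 3 by rewrite -p2q p1.
apply: nso4; move: sp sp2; rewrite p2q p1 q3 /special /mult_of /alpha /beta.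
rewrite q3 !count_cat !count_nseq /= !mul0n !mul1n !add0n !addn0.
by move=> /andP[/eqP-> /eqP->] /andP[/eqP-> /eqP->].
Qed.

Section OnePair.
Variables (m n : nat) (alpha beta : seq nat).
Hypothesis palpha : is_partition alpha m.
Hypothesis pbeta : is_partition beta n.
Hypothesis nu_odd : forall q, odd q -> ~~ odd (mult_of beta q).
Hypothesis mu_even : forall q, ~~ odd q -> ~~ odd (mult_of alpha q).
Hypothesis mu_le1 : forall q, odd q -> 0 < mult_of beta q ->
  mult_of alpha q <= 1.
Hypothesis nu_le1 : forall q, ~~ odd q -> 0 < mult_of alpha q ->
  mult_of beta q <= 1.
Hypothesis not_so3 : ~ (m = 3 /\ n = 0).
Hypothesis not_so4 : ~ (m = 4 /\ n = 0).

Lemma parts_count_one_two_valued : parts_count alpha beta = 1 ->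
  exists q a b c d, [/\ 1 < q, 0 < a + c,
    alpha = nseq a q ++ nseq b 1 & beta = nseq c q ++ nseq d 1].
Proof.
case: palpha pbeta => sa a0 _ [sb b0 _].
rewrite /parts_count; set Q := undup _ => E.
have pos p : p \in alpha ++ beta -> 0 < p.
  by rewrite lt0n mem_cat; case: eqP => // ->; rewrite (negPf a0) (negPf b0).
(* If no part exceeds 1 then no part is special together with its successor by
   two, so the count is 0. *)
have hasQ : has (fun q => 1 < q) Q.
  rewrite has_count lt0n; apply/eqP => E0; move: E; rewrite E0 add0n => E.
  have : has (special_step alpha beta) Q by rewrite has_count E.
  case/hasP => p; rewrite mem_undup => pab /andP[_ /special_part p2].
  have : 0 < count (fun q => 1 < q) Q.
    by rewrite -has_count; apply/hasP; exists (p + 2);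
      rewrite ?mem_undup // ltn_addl.
  by rewrite E0.
have [q qQ q1] : exists2 q, q \in Q & 1 < q by apply/hasP.
have E1 : size [seq q <- Q | 1 < q] = 1.
  by move: hasQ E; rewrite has_count size_filter; lia.
have vals p : p \in alpha ++ beta -> p = q \/ p = 1.
  move=> pab; have [p1|p1] := ltnP 1 p; last by right; have := pos p pab; lia.
  left; have pF : p \in [seq q <- Q | 1 < q] by rewrite mem_filter p1 mem_undup.
  have : q \in [seq q <- Q | 1 < q] by rewrite mem_filter q1.
  by case: [seq _ <- _ | _] E1 pF => [|y []] //= _; rewrite !inE => /eqP-> /eqP->.
exists q, (mult_of alpha q), (mult_of alpha 1), (mult_of beta q), (mult_of beta 1).
split=> //; first by rewrite addn_gt0 !mult_of_gt0 -mem_cat -mem_undup.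
  by apply: two_valued_partition => // p pin; apply: vals; rewrite mem_cat pin.
by apply: two_valued_partition => // p pin; apply: vals; rewrite mem_cat pin orbT.
Qed.

Lemma parts_count_one : parts_count alpha beta = 1 <-> mult_one_pair m n alpha beta.
Proof.
have [_ _ ma] := palpha; have [_ _ nb] := pbeta.
split.
  case/parts_count_one_two_valued => q [a [b [c [d [q1 ac Ea Eb]]]]].
  have Em : m = q * a + b by rewrite -ma Ea sumn_cat !sumn_nseq mul1n.
  have En : n = q * c + d by rewrite -nb Eb sumn_cat !sumn_nseq mul1n.
  have Mq : mult_of alpha q = a /\ mult_of alpha 1 = b.
    rewrite /mult_of Ea !count_cat !count_nseq /= !eqxx.
    by rewrite (gtn_eqF q1) (ltn_eqF q1); lia.
  have Nq : mult_of beta q = c /\ mult_of beta 1 = d.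
    rewrite /mult_of Eb !count_cat !count_nseq /= !eqxx.
    by rewrite (gtn_eqF q1) (ltn_eqF q1); lia.
  have [Ma Mb] := Mq; have [Nc Nd] := Nq.
  have d2 : ~~ odd d by rewrite -Nd; apply: nu_odd.
  have b1 : 0 < d -> b <= 1 by rewrite -Nd -Mb; apply: mu_le1.
  have c2 : odd q -> ~~ odd c by rewrite -Nc; apply: nu_odd.
  have a2 : ~~ odd q -> ~~ odd a by rewrite -Ma; apply: mu_even.
  have a1 : odd q -> 0 < c -> a <= 1 by rewrite -Nc -Ma; apply: mu_le1.
  have c1 : ~~ odd q -> 0 < a -> c <= 1 by rewrite -Nc -Ma; apply: nu_le1.
  case: (posnP c) => [c0|c_gt0]; last case: (posnP a) => [a0|a_gt0].
  - rewrite c0 addn0 in ac; rewrite c0 muln0 add0n in En; rewrite c0 /= -En in Eb.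
    case: (posnP b) => [b0|b_gt0].
      exists q, a, 0; do 2!split=> //; do 2!right; left; split=> //.
        by rewrite Ea b0 cats0.
      by rewrite Em b0 addn0.
    case: (posnP d) => [d0|d_gt0].
      exists q, a, b; do 2!split=> //; left; split=> //.
      + by rewrite Eb En d0.
      + by rewrite En d0.
      have n0 : n = 0 by rewrite En d0.
      rewrite ltn_neqAle eq_sym; apply/andP; split.
        by apply/eqP => m4; apply: not_so4.
      rewrite leqNgt; apply/negP => m_lt.
      case: (boolP (odd q)) => [odq|evq].
        by apply: not_so3; split=> //; nia.
      have := a2 evq; nia.
    have {b_gt0 b1} b1 : b = 1 by have := b1 d_gt0; lia.
    exists q, a, 0; do 2!split=> //; do 3!right; left; split=> //.
      by rewrite Ea b1.
    by rewrite Em b1.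
  - rewrite a0 muln0 add0n in Em; rewrite a0 /= -Em in Ea.
    case: (posnP d) => [d0|d_gt0].
      exists q, c, 0; do 2!split=> //; do 4!right; left; split=> //.
        by rewrite Eb d0 cats0.
      by rewrite En d0 addn0.
    case: (posnP b) => [b0|b_gt0].
      exists q, c, d; do 2!split=> //; right; left; split=> //.
        by rewrite Ea Em b0.
      by rewrite Em b0.
    have {b_gt0 b1} b1 : b = 1 by have := b1 d_gt0; lia.
    exists q, c, d; do 2!split=> //; do 5!right; left; split=> //.
    by rewrite Ea Em b1.
  have [odq|evq] := boolP (odd q).
    have a1' : a = 1 by have := a1 odq c_gt0; lia.
    have {}c2 := c2 odq; rewrite a1' muln1 in Em; rewrite a1' /= in Ea.
    case: (posnP d) => [d0|d_gt0].
      exists q, c, b; do 2!split=> //; do 6!right; left; split=> //.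
        by rewrite Eb d0 cats0.
      by rewrite En d0 addn0.
    case: (posnP b) => [b0|b_gt0].
      exists q, c, d; do 2!split=> //; do 11!right; split=> //.
        by rewrite Ea b0.
      by rewrite Em b0 addn0.
    have {b_gt0 b1} b1 : b = 1 by have := b1 d_gt0; lia.
    exists q, c, d; do 2!split=> //; do 9!right; left; split=> //.
      by rewrite Ea b1.
    by rewrite Em b1.
  have c1' : c = 1 by have := c1 evq a_gt0; lia.
  have {}a2 := a2 evq; rewrite c1' muln1 in En; rewrite c1' /= in Eb.
  case: (posnP d) => [d0|d_gt0].
    exists q, a, b; do 2!split=> //; do 8!right; left; split=> //.
      by rewrite Eb d0.
    by rewrite En d0 addn0.
  case: (posnP b) => [b0|b_gt0].
    exists q, a, d; do 2!split=> //; do 7!right; left; split=> //.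
    by rewrite Ea b0 cats0.
  have {b_gt0 b1} b1 : b = 1 by have := b1 d_gt0; lia.
  exists q, a, d; do 2!split=> //; do 10!right; left; split=> //.
    by rewrite Ea b1.
  by rewrite Em b1.
case=> q [l [r [q1 [l0 pairs]]]].
have [a [b [c [d [Ea Eb ac]]]]] : exists a b c d,
    [/\ alpha = nseq a q ++ nseq b 1, beta = nseq c q ++ nseq d 1 & 0 < a + c].
  have lk k : 0 < l + k by rewrite addn_gt0 l0.
  have kl k : 0 < k + l by rewrite addn_gt0 l0 orbT.
  case: pairs => [[-> -> _ _ _]|]; first by exists l, r, 0, 0.
  case=> [[-> -> _ _ _]|]; first by exists 0, 0, l, r.
  case=> [[-> -> _ _]|]; first by exists l, 0, 0, n; rewrite cats0.
  case=> [[-> -> _ _]|]; first by exists l, 1, 0, n.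
  case=> [[-> -> _ _]|]; first by exists 0, m, l, 0; rewrite cats0.
  case=> [[-> -> _ _]|]; first by exists 0, 1, l, r.
  case=> [[-> -> _ _ _]|]; first by exists 1, r, l, 0; rewrite cats0.
  case=> [[-> -> _ _ _]|]; first by exists l, 0, 1, r; rewrite cats0.
  case=> [[-> -> _ _ _]|]; first by exists l, r, 1, 0.
  case=> [[-> -> _ _]|]; first by exists 1, 1, l, r.
  case=> [[-> -> _ _]|[-> -> _ _]]; first by exists l, 1, 1, r.
  by exists 1, 0, l, r.
rewrite Ea Eb; apply: two_valued_parts_count => // -[q3 a1 b1 c0 d0].
apply: not_so4; rewrite -ma -nb Ea Eb !sumn_cat !sumn_nseq q3 a1 b1 c0 d0.
by [].
Qed.

End OnePair.
End Counting.

(** * The multiplicity formula *)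

Section PairLengths.
Local Open Scope nat_scope.
Variables (alpha beta : seq nat).
Hypotheses (alpha0 : 0 \notin alpha) (beta0 : 0 \notin beta).
Local Notation len := (@pair_len alpha beta).
Local Notation odd_string := (@pair_odd alpha beta).
Local Notation mu := (mult_of alpha).
Local Notation nu := (mult_of beta).

Lemma mult_of_sum (lam : seq nat) q :
  mult_of lam q = \sum_(i < size lam) (nth 0 lam i == q).
Proof. by rewrite /mult_of -sumn_count sumnE big_map (big_nth 0) big_mkord. Qed.

Lemma card_pair b q :
  #|[set j | (len j == q) && (odd_string j == b)]| = if b then nu q else mu q.
Proof.
rewrite -sum1_card big_mkcond /= (eq_bigr (fun j => (len j == q) && (odd_string j == b) : nat)).
  rewrite big_split_ord /= /pair_len /pair_odd.
  under eq_bigr do rewrite split_lshiftE.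
  under [X in _ + X]eq_bigr do rewrite split_rshiftE.
  rewrite !mult_of_sum; case: b.
    by rewrite big1 ?add0n => [|i _]; [apply: eq_bigr => i _|]; rewrite ?andbT ?andbF.
  by rewrite [X in _ + X]big1 ?addn0 => [|i _]; [apply: eq_bigr => i _|]; rewrite ?andbT ?andbF.
by move=> j _; rewrite inE; case: ifP.
Qed.

Lemma pair_len_mem j : len j \in alpha ++ beta.
Proof.
rewrite mem_cat /pair_len.
by case: splitP => i _; rewrite mem_nth ?orbT.
Qed.

Lemma pair_len_gt0 q : q \in alpha ++ beta -> 0 < q.
Proof.
by rewrite lt0n mem_cat; case: eqP => // ->; rewrite (negPf alpha0) (negPf beta0).
Qed.

Lemma pair_len_surj q : q \in alpha ++ beta -> exists j, len j = q.
Proof.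
rewrite mem_cat => /orP[] /(nthP 0)[i il <-].
  exists (lshift (size beta) (Ordinal il)).
  by rewrite /pair_len split_lshiftE.
exists (rshift (size alpha) (Ordinal il)).
by rewrite /pair_len split_rshiftE.
Qed.

(** The form on the multiplicity space is symmetric on the even strings and
    alternating on the odd ones for odd q, and conversely for even q. *)
Lemma card_symplectic b q : 0 < q ->
  #|[set j | (len j == q) && (symplectic len odd_string j == b)]|
  = if odd q (+) b then mu q else nu q.
Proof.
move=> q0.
transitivity #|[set j | (len j == q) && (odd_string j == ~~ (odd q (+) b))]|.
  apply: eq_card => j; rewrite !inE; rewrite /symplectic.
  case: eqP => //= ->; case: q q0 => // q _ /=.
  by case: (odd q) b (odd_string j) => [] [] [].
by rewrite card_pair; case: (_ (+) _).
Qed.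

Lemma card_symplectic_part q : 0 < q ->
  #|[set j | (len j == q) && symplectic len odd_string j]|
  = if odd q then nu q else mu q.
Proof.
move=> q0; transitivity #|[set j | (len j == q) && (symplectic len odd_string j == true)]|.
  by apply: eq_card => j; rewrite !inE eqb_id.
by rewrite card_symplectic // addbT if_neg.
Qed.

(** Being solitary means that the symmetric part of the block is a line and the
    alternating part zero. *)
Lemma solitary_special q : 0 < q ->
  (solitary_at len odd_string q : bool) = special alpha beta q.
Proof.
move=> q0.
have -> : special alpha beta q =
  (#|[set j | (len j == q) && (symplectic len odd_string j == false)]| == 1)
  && (#|[set j | (len j == q) && (symplectic len odd_string j == true)]| == 0).
  rewrite !card_symplectic // /special; case: (odd q) => //=.
  by rewrite andbC.
rewrite /solitary_at; case: pickP => [j /andP[/eqP jq /solitaryP[js uj]]|none] /=.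
  apply/esym/andP; split.
    apply/cards1P; exists j; apply/setP => l; rewrite !inE.
    apply/andP/eqP => [[/eqP lq _]|->]; last by rewrite jq eqxx (negPf js).
    by apply: uj; rewrite jq.
  rewrite cards_eq0; apply/eqP/setP => l; rewrite !inE.
  by apply/negP => /andP[/eqP lq]; rewrite (uj l) ?lq // (negPf js).
apply/esym/negP => /andP[/cards1P[j Ej] /eqP/cards0_eq E0].
have : j \in [set j] by rewrite inE.
rewrite -Ej inE => /andP[/eqP jq js].
have := none j; rewrite jq eqxx /= => /solitaryP; apply; split.
  by rewrite (eqP js).
move=> l lq; apply/eqP; have := in_set1 l j; rewrite -Ej inE lq jq eqxx /= => <-.
have := in_set0 l; rewrite -E0 inE lq jq eqxx /=.
by case: symplectic.
Qed.

Lemma size_keys :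
  size (keys len odd_string (undup (alpha ++ beta))) = parts_count alpha beta.
Proof.
rewrite /keys size_cat !size_map !size_filter; congr (_ + _).
apply: eq_in_count => q; rewrite mem_undup => /pair_len_gt0 q0.
by rewrite /solitary_step !solitary_special // addn2.
Qed.

End PairLengths.

Section Multiplicities.
Variables (F : numClosedFieldType) (m n : nat) (e x f : 'M[F]_(m + n)).
Variables (alpha beta : seq nat).
Local Notation len := (@pair_len alpha beta).
Local Notation odd_string := (@pair_odd alpha beta).
Variables (v : 'I_(size alpha + size beta) -> nat -> 'cV[F]_(m + n)).
Variables (co : 'I_(size alpha + size beta) -> nat -> 'cV[F]_(m + n) -> F).
Hypothesis S : osp_strings e x f len odd_string v co.
Hypotheses (alpha0 : 0%N \notin alpha) (beta0 : 0%N \notin beta).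
Local Notation gnat := (centralizer (osp F m n) <<[:: e; x; f]>>%VS).
Local Notation mu := (mult_of alpha).
Local Notation nu := (mult_of beta).

Lemma odd_part_even_mult q : odd q -> ~~ odd (nu q).
Proof.
move=> odq; have q0 : (0 < q)%N by case: q odq.
have := symplectic_even S q; have := card_symplectic_part alpha beta q0.
by rewrite odq => ->.
Qed.

Lemma even_part_even_mult q : ~~ odd q -> ~~ odd (mu q).
Proof.
move=> evq; have [q0|q0] := posnP q.
  by rewrite q0 /mult_of (count_memPn alpha0).
have := symplectic_even S q; have := card_symplectic_part alpha beta q0.
by rewrite (negPf evq) => ->.
Qed.

Hypothesis red : reductive_plus_osp1 gnat.

Lemma no_mixed_part q : (0 < q)%N ->
  (0 < if odd q then nu q else mu q)%N ->
  ((if odd q then mu q else nu q) <= 1)%N.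
Proof.
move=> q0 B0; rewrite leqNgt; apply/negP => A1.
rewrite -(card_symplectic_part alpha beta q0) in B0.
have := card_symplectic alpha beta false q0.
rewrite addbF => cA; rewrite -cA in A1.
have /card_gt0P[l] := B0; rewrite inE => /andP[/eqP lq ls].
have /card_gt1P[k1 [k2 []]] := A1; rewrite !inE.
move=> /andP[/eqP k1q /eqP k1s] /andP[/eqP k2q /eqP k2s] k12.
by apply: (no_mixed_block S red _ _ k12 _ _ ls); rewrite ?k1q ?k2q ?lq ?k1s ?k2s.
Qed.

(** The highest vectors of [keys] satisfy the conditions of
    [triv_adj_multiplicity_exists]. *)
Lemma osp_multiplicity : f != 0 ->
  triv_adj_multiplicity gnat <<[:: e; x; f]>> (osp F m n)
    (parts_count alpha beta).
Proof.
move=> f0; rewrite -size_keys //; set qs := undup _; set ks := keys _ _ _.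
have uks : uniq ks.
  have uqs : uniq qs by apply: undup_uniq.
  rewrite cat_uniq !map_inj_uniq ?filter_uniq // => [|a b []//|a b []//].
  by rewrite andbT; apply/hasP => -[k /mapP[q _ ->] /mapP[q' _]].
have memqs q : q \in qs -> exists j, len j = q.
  by rewrite mem_undup; apply: pair_len_surj.
pose hs i := key_vector len odd_string v co (tnth (in_tuple ks) i).
have hk i : tnth (in_tuple ks) i \in ks by apply: mem_tnth.
have [eg xg fg] := And3 (os_e S) (os_x S) (os_f S).
apply: (@triv_adj_multiplicity_exists _ _ _ _ _ _ eg xg fg (os_eev S) (os_xev S)
  (os_fev S) (os_rel S) f0 _ hs (fun i => sbracket f (hs i))
  (fun i => sbracket f (sbracket f (hs i)))) => //.
- by move=> i; have [] := key_highest S (hk i).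
- by move=> i; have [] := key_highest S (hk i).
- move=> i j ij; apply: (pairing_keys S (hk i) (hk j)).
  apply: contra ij; rewrite !(tnth_nth (true, 0%N)) /= => E.
  by apply/eqP/ord_inj/eqP; rewrite -(nth_uniq (true, 0%N) _ _ uks).
- move=> i; apply: (pairing_key S _ (hk i)) => q /memqs.
  exact: (superdimension_neq0 S red).
move=> h hh.
have : h \in <<[seq key_vector len odd_string v co i | i <- ks]>>%VS.
  apply: (highest_span S (undup_uniq _) _ hh).
  by move=> j; rewrite mem_undup; apply: pair_len_mem.
move=> hspan; have sz : size [seq key_vector len odd_string v co i | i <- ks] = size ks.
  by rewrite size_map.
pose T := tcast sz (in_tuple [seq key_vector len odd_string v co i | i <- ks]).
have hT : h \in <<T>>%VS by rewrite val_tcast.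
exists (fun i => coord T i h); rewrite {1}(coord_span hT).
apply: eq_bigr => i _; congr (_ *: _).
by rewrite val_tcast /= (nth_map (true, 0%N)) // /hs (tnth_nth (true, 0%N)).
Qed.

End Multiplicities.

Theorem proposition4p9 (R : realType) (m n : nat) (e x f : 'M[R[i]]_(m + n))
    (alpha beta : seq nat) :
  let g := osp R[i] m n in
  let s := <<[:: e; x; f]>>%VS in
  let gnat := centralizer g s in
  ~~ odd n ->
  simple_superalgebra g ->
  ~ (m = 3%N /\ n = 0%N) ->
  nilpotent_mx f ->
  sl2_triple g e x f ->
  encoded_by e x f alpha beta ->
  reductive_plus_osp1 gnat ->
  [/\ exists Q1 Q2 Q3 Q4, parts_partition alpha beta Q1 Q2 Q3 Q4,
      forall Q1 Q2 Q3 Q4, parts_partition alpha beta Q1 Q2 Q3 Q4 ->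
        triv_adj_multiplicity gnat s g (mult_formula alpha beta Q1 Q2 Q3 Q4) &
      triv_adj_multiplicity gnat s g 1 <-> mult_one_pair m n alpha beta].
Proof.
move=> g s gnat n_even simple not_so3 fnil [sg sev f0 [xe xf ef]] enc red.
have [es xs fs] : [/\ e \in s, x \in s & f \in s].
  by split; apply: memv_span; rewrite !inE eqxx ?orbT.
have [eg xg fg] : [/\ e \in g, x \in g & f \in g].
  by split; apply: (subvP sg).
have [e_ev x_ev f_ev] := And3 (sev e es) (sev x xs) (sev f fs).
have rel : sl2_relations e x f by split; rewrite -sbracket_evenl.
have [v [co [str par]]] := encoded_strings e_ev x_ev f_ev rel fnil enc.
have S := OspStrings n_even eg xg fg e_ev x_ev f_ev rel str par.
have [palpha pbeta _ _] := enc.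
have [[_ alpha0 _] [_ beta0 _]] := (palpha, pbeta).
have mult := osp_multiplicity S alpha0 beta0 red f0.
have nu_odd := odd_part_even_mult S.
have mu_even := even_part_even_mult S alpha0.
have mu_le1 q : odd q -> (0 < mult_of beta q -> mult_of alpha q <= 1)%N.
  move=> odq; have q0 : (0 < q)%N by case: q odq.
  by have := no_mixed_part S red q0; rewrite odq.
have nu_le1 q : ~~ odd q -> (0 < mult_of alpha q -> mult_of beta q <= 1)%N.
  move=> evq; have [->|q0] := posnP q.
    by rewrite /mult_of (count_memPn alpha0).
  by have := no_mixed_part S red q0; rewrite (negPf evq).
split; first exact: parts_partition_exists mu_le1 nu_le1.
  by move=> Q1 Q2 Q3 Q4 /mult_formulaE ->.
(* This excludes the only pair for which the second count matters. *)
have not_so4 : ~ (m = 4%N /\ n = 0%N).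
  move=> [m4 n0]; move: simple; rewrite /g; move: m4 n0.
  by clear => -> ->; apply: so4_not_simple.
apply: iff_trans (parts_count_one palpha pbeta nu_odd mu_even mu_le1 nu_le1 not_so3 not_so4).
split=> [mult1|<- //].
exact: (triv_adj_multiplicity_unique fg e_ev x_ev f_ev rel f0 mult mult1).
Qed.
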